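(* Let $1<\alpha<2$, $T>0$, $\Omega=\{(x,y,t):0\le x\le1,\ 0\le y\le1,\ 0\le t\le T\}$ and $T^*=\max(T,1)$. Let $\varphi,\psi:[0,1]^2\to\mathbb{C}$ and $f:\Omega\to\mathbb{C}$ be continuous. (i) Homogeneous problem. Let $$v(x,y,t)=\sum_{m,n\in\mathbb{N}}\big[C_{m,n}E_{\alpha,1}(-\mu_{m,n}t^\alpha)+D_{m,n}\,t\,E_{\alpha,2}(-\mu_{m,n}t^\alpha)\big]J_0(\gamma_m x)\sin(n\pi y)$$ be the solution of ${}_cD^\alpha_{0t}v=v_{xx}+\frac1x v_x+v_{yy}$ with $\lim_{x\to0}x v_x=0$, $v(1,y,t)=v(x,0,t)=v(x,1,t)=0$, $v(x,y,0)=\varphi(x,y)$, $v_t(x,y,0)=\psi(x,y)$. Then for every $t\in[0,T]$, $$\|v(\cdot,\cdot,t)\|_2\le\sqrt{2\big(\|\varphi\|_2^2+\|\psi\|_2^2\big)}.$$ (ii) Non-homogeneous problem. Let $$w(x,y,t)=\sum_{m,n\in\mathbb{N}}\left(\int_0^t(t-\xi)^{\alpha-1}E_{\alpha,\alpha}\big(-\mu_{m,n}(t-\xi)^\alpha\big)F_{m,n}(\xi)\,d\xi\right)J_0(\gamma_m x)\sin(n\pi y)$$ be the solution of ${}_cD^\alpha_{0t}w=w_{xx}+\frac1x w_x+w_{yy}+f$ with $\lim_{x\to0}x w_x=0$, $w(1,y,t)=w(x,0,t)=w(x,1,t)=0$, $w(x,y,0)=w_t(x,y,0)=0$. Then there is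 a constant $C>0$, independent of $f$ and $T$, such that $$\|w\|_\infty\le C\,(T^* )^{1/4}\,\|f\|_\infty.$$ Consequently the solution $u=v+w$ of the problem with data $(\varphi,\psi,f)$ depends continuously on the data: if $u$ and $u'$ are the solutions for data $(\varphi,\psi,f)$ and $(\varphi',\psi',f')$, then $u-u'=V+W$, where $\|V(\cdot,\cdot,t)\|_2\le\sqrt{2(\|\varphi-\varphi'\|_2^2+\|\psi-\psi'\|_2^2)}$ for all $t\in[0,T]$ and $\|W\|_\infty\le C(T^* )^{1/4}\|f-f'\|_\infty$.
   Context: $\mathbb{N}=\{1,2,3,\dots\}$. For $1<\alpha<2$ the Caputo derivative in $t$ is ${}_cD^\alpha_{0t}g(t)=\frac{1}{\Gamma(2-\alpha)}\int_0^t\frac{g''(z)}{(t-z)^{\alpha-1}}\,dz$. The Mittag-Leffler function is $E_{\alpha,\beta}(z)=\sum_{k=0}^\infty\frac{z^k}{\Gamma(\alpha k+\beta)}$. $J_0$ is the Bessel function of the first kind of order $0$, $\gamma_m$ its $m$-th positive zero, and $\mu_{m,n}=(n\pi)^2+\gamma_m^2$. $\|\cdot\|_2$ is the $L^2([0,1]^2)$ norm with weight $x$: $\|g\|_2^2=\int_0^1\int_0^1x|g(x,y)|^2\,dx\,dy$. $\|\cdot\|_\infty$ is the supremum norm on $\Omega$. The series for $v(\cdot,\cdot,t)$ is understood as converging in this weighted $L^2$ space. The coefficients are $$C_{m,n}=\frac{1}{\|J_0(\gamma_m x)\sin(n\pi y)\|_2^2}\int_0^1\int_0^1x\,\varphi(x,y)J_0(\gamma_m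 x)\sin(n\pi y)\,dx\,dy,$$ with $D_{m,n}$ given by the same formula with $\psi$ in place of $\varphi$, and $F_{m,n}(t)$ by the same formula with $f(x,y,t)$ in place of $\varphi(x,y)$. The full problem with data $(\varphi,\psi,f)$ is ${}_cD^\alpha_{0t}u=u_{xx}+\frac1x u_x+u_{yy}+f$ with $\lim_{x\to0}xu_x=0$, $u(1,y,t)=u(x,0,t)=u(x,1,t)=0$, $u(x,y,0)=\varphi(x,y)$, $u_t(x,y,0)=\psi(x,y)$; its solution is taken to be the series solution $u=v+w$. *)

(* Defs.v *)
From HB Require Import structures.
From mathcomp Require Import all_boot all_order all_algebra finmap.
From mathcomp Require Import all_classical all_reals all_analysis.
From mathcomp.real_closed Require Export complex.
From mathcomp.analysis.showcase Require Export summability.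

Set Implicit Arguments.
Unset Strict Implicit.
Unset Printing Implicit Defensive.

Import Order.TTheory GRing.Theory Num.Theory.
Import numFieldNormedType.Exports.
Import Normc.

Local Open Scope classical_set_scope.
Local Open Scope ring_scope.
Local Open Scope complex_scope.

(* R[i] viewed as an abstract numFieldType, through which it receives the
   topology of its modulus. *)
Definition cplx (R : realType) : numFieldType := R[i].

Section SpecialFunctions.
Context {R : realType}.
Implicit Types (s a b x z : R) (k m : nat).

(* Meaningful for s > 0, the only range used below. *)
Definition Gamma s : R :=
  \int[lebesgue_measure]_(x in `]0, +oo[) (x `^ (s - 1) * expR (- x)).

(* Only real arguments occur below. *)
Definition mittag_leffler a b z : R :=
  limn (series (fun k => z ^+ k / Gamma (a * k%:R + b))).

Definition bessel_J0 x : R :=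
  limn (series (fun k => (-1) ^+ k / k`!%:R ^+ 2 * (x / 2) ^+ (2 * k))).

(* The m-th positive zero (m >= 1) is the zero z such that ]0, z] contains
   exactly m zeros. *)
Definition bessel_J0_zero m : R :=
  xget 0 [set z | [/\ 0 < z, bessel_J0 z = 0
    & ([set x | (0 < x <= z)%R /\ bessel_J0 x = 0] #= `I_m)%card]].

End SpecialFunctions.

Section Problem.
Context {R : realType}.
Implicit Types (phi psi g : R * R -> cplx R) (f u v w : R * R * R -> cplx R).
Implicit Types (alpha T t : R) (m n : nat) (p : R * R).

Definition unit_square : set (R * R) := `[0, 1] `*` `[0, 1].

(* Points of Omega are the triples ((x, y), t). *)
Definition Omega T : set (R * R * R) := unit_square `*` `[0, T].

Definition leb2 := (@lebesgue_measure R \x @lebesgue_measure R)%E.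

Definition Cintegral d (X : measurableType d) (mu : {measure set X -> \bar R})
    (D : set X) (h : X -> cplx R) : cplx R :=
  (\int[mu]_(x in D) complex.Re (h x)) +i* (\int[mu]_(x in D) complex.Im (h x)).

(* The norm of L^2([0,1]^2) with weight x. *)
Definition wL2norm g : \bar R :=
  sqrte (\int[leb2]_(p in unit_square) (p.1 * normc (g p) ^+ 2)%:E)%E.

Definition sup_norm T f : \bar R :=
  ereal_sup [set (normc (f q))%:E | q in Omega T].

Definition wL2 g : Prop :=
  [/\ measurable_fun unit_square (fun p => complex.Re (g p)),
      measurable_fun unit_square (fun p => complex.Im (g p))
    & (wL2norm g < +oo)%E].

Definition mode_eigenvalue m n : R := (n%:R * pi) ^+ 2 + bessel_J0_zero m ^+ 2.

Definition mode m n : R * R -> cplx R := fun p =>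
  (bessel_J0 (bessel_J0_zero m * p.1) * sin (n%:R * pi * p.2))%:C.

Definition coefficient g m n : cplx R :=
  ((fine (wL2norm (mode m n)) ^+ 2)^-1)%:C *
  Cintegral leb2 unit_square (fun p => p.1%:C * g p * mode m n p).

Definition homogeneous_term alpha phi psi t m n : R * R -> cplx R := fun p =>
  (coefficient phi m n *
     (mittag_leffler alpha 1 (- mode_eigenvalue m n * t `^ alpha))%:C
   + coefficient psi m n *
     (t * mittag_leffler alpha 2 (- mode_eigenvalue m n * t `^ alpha))%:C)
  * mode m n p.

Definition nonhomogeneous_term alpha f t m n : R * R -> cplx R := fun p =>
  Cintegral lebesgue_measure `[0, t] (fun xi =>
    ((t - xi) `^ (alpha - 1) *
     mittag_leffler alpha alpha (- mode_eigenvalue m n * (t - xi) `^ alpha))%:C *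
    coefficient (fun p' => f (p', xi)) m n)
  * mode m n p.

(* Double series over m, n >= 1 are unordered sums, i.e. limits of the partial
   sums along the finite subsets of nat * nat; the pair (i, j) carries the term
   of index (i + 1, j + 1). *)
Definition partial_series (s : nat -> nat -> R * R -> cplx R)
    (F : {fset nat * nat}) : R * R -> cplx R :=
  fun p => partial_sum (fun k : nat * nat => s k.1.+1 k.2.+1 p) F.

(* The series solution of the problem with source term 0: for each t the series
   converges to v(., ., t) in the weighted L^2 space. *)
Definition homogeneous_solution alpha T phi psi v : Prop :=
  forall t, 0 <= t <= T ->
    wL2 (fun p => v (p, t)) /\
    (wL2norm (fun p => v (p, t) -
       partial_series (homogeneous_term alpha phi psi t) F p)
      @[F --> totally] --> 0%E).

(* The series solution of the problem with initial data 0: the series converges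
   pointwise on Omega, where the supremum norm is taken. *)
Definition nonhomogeneous_solution alpha T f w : Prop :=
  forall p t, Omega T (p, t) ->
    partial_series (nonhomogeneous_term alpha f t) F p
      @[F --> totally] --> w (p, t).

Definition solution alpha T phi psi f u : Prop :=
  exists v w, [/\ homogeneous_solution alpha T phi psi v,
    nonhomogeneous_solution alpha T f w
    & forall q, Omega T q -> u q = v q + w q].

End Problem.

(* Main.v *)
Require Import Defs.
From HB Require Import structures.
From mathcomp Require Import all_boot all_order all_algebra finmap.
From mathcomp Require Import all_classical all_reals all_analysis.
From mathcomp Require Import measurable_realfun.
From mathcomp Require Import ring lra.

Set Implicit Arguments.
Unset Strict Implicit.
Unset Printing Implicit Defensive.

Import Order.TTheory GRing.Theory Num.Theory.
Import numFieldNormedType.Exports.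

Local Open Scope classical_set_scope.
Local Open Scope ring_scope.
Import Normc.

(** Expansion in the modes J_0(gamma_m x) sin(n pi y), which are orthogonal for the
    weight x, decouples the problem, so everything rests on bounds for the
    Mittag-Leffler functions that are uniform in mu = mu_(m,n).

    Write alpha = b + 1, e(t) = E_(alpha,1)(- t^alpha) and J^b for the fractional
    integral of order b; then e' = - J^b e.  The form
    int_0^T (h J^b h + alpha h J^b e + K e J^b e), K = alpha^2 / (4 (1 - b)^2), is
    nonnegative, because its kernel is a superposition of exponentials for which one
    can complete a square.  With h = 0 this gives (e^2)' a nonpositive integral,
    hence |E_(alpha,1)| <= 1; with h = t e' it bounds t e', hence
    |E_(alpha,alpha)(- x)| <= C / (1 + x).  For t E_(alpha,2)(- mu t^alpha), whose
    derivative is bounded by 1 and whose primitive is a fractional integral of 1 - e,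
    a Taylor estimate gives the bound 1 as soon as mu >= 4 exp(1), which all
    mu_(m,n) satisfy.

    The homogeneous estimate is then Bessel's inequality, and Riesz-Fischer provides
    the solution.  For the source term, |E_(alpha,alpha)(- x)| <= C x^(-7/8) and the
    lower bound gamma J_0'(gamma)^2 >= c at the zeros (so that the squared norm of a
    mode is at least a multiple of 1 / gamma_m) reduce uniform absolute convergence
    to that of sum gamma_m mu_(m,n)^(-7/4), which is dominated by
    sum (m n)^(-5/4); the kernel (t - s)^(alpha/8 - 1) that remains integrates to a
    multiple of t^(alpha/8) <= (T^* )^(1/4). *)

(** * Power series and integrals over intervals *)

(** The exponent 7/8 is the midpoint of a window. If |E_(alpha,alpha)(- x)| <= C x^(-theta), the
    time kernel behaves like s^(alpha (1 - theta) - 1), which is integrable only for theta < 1,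
    while the planar sum of gamma_m mu_(m,n)^(-2 theta) converges only for theta > 3/4. At theta =
    7/8 the time integral is a multiple of t^(alpha/8), and alpha < 2 is what produces the power
    1/4. The cross term of the quadratic form has a similar origin. Multiplication by t does not
    commute with J^b, so h = t e' satisfies h' = - J^b h - alpha J^b e instead of the equation of e.
    Positivity of the integral of h J^b h alone therefore says nothing about h^2; the form contains
    exactly the extra term alpha h J^b e, and the multiple of e J^b e that completes the square has
    a bounded integral by the energy identity for e. In the uniform estimate the modes are summed at
    a fixed time, before integrating, so that Bessel's inequality for the slice f(., ., xi) provides
    the square summability of the coefficients. *)

Section PowerSeries.
Context {R : realType}.
Implicit Types (c d : R^nat) (x y r : R).

Definition psum c x : R := limn (pseries c x).

Definition entire c := forall x, cvgn (pseries c x).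

Lemma entire_norm c : entire c -> entire (fun n => `|c n|).
Proof.
move=> cc x; apply: (@is_cvg_pseries_inside_norm _ _ (`|x| + 1)) => //.
by rewrite [ltRHS]ger0_norm ?ltrDl// addr_ge0.
Qed.

(** A geometric factor in the coefficients amounts to a rescaling of the variable, harmless for a
    series that converges everywhere. *)
Lemma le_entire c d (A B : R) : 0 <= A -> 0 <= B ->
  (forall n, `|d n| <= A * B ^+ n * `|c n|) -> entire c -> entire d.
Proof.
move=> A0 B0 dc cc x; apply: normed_cvg.
have H : cvgn (series (A *: (fun n => `|c n| * (B * `|x|) ^+ n))).
  by apply: is_cvg_seriesZ; exact: entire_norm.
apply: series_le_cvg H => [n|n|n] /=; rewrite ?normr_ge0//.
  by rewrite !mulr_ge0// exprn_ge0// mulr_ge0.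
rewrite normrM normrX.
rewrite [leRHS](_ : _ = A * B ^+ n * `|c n| * `|x| ^+ n); last first.
  by rewrite -[LHS]/(A * (`|c n| * (B * `|x|) ^+ n)) exprMn; ring.
by rewrite ler_wpM2r ?exprn_ge0// dc.
Qed.

Lemma entire_shift c : entire c -> entire (fun n => c n.+1).
Proof.
move=> cc x; have [->|x0] := eqVneq x 0.
  apply: (cvgP (c 1)); rewrite -(cvg_shiftn 1)/=.
  rewrite (_ : (fun n => _) = fun=> c 1); first exact: cvg_cst.
  apply/funext => n; rewrite addn1 /pseries/= /series/= big_nat_recl//= expr0 mulr1.
  by rewrite big1 ?addr0// => i _; rewrite expr0n mulr0.
have H : cvgn (series (x^-1 *: (fun n => c n.+1 * x ^+ n.+1))).
  apply: is_cvg_seriesZ; have /cvg_ex[l lc] := cc x.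
  apply: (cvgP (l - c 0)).
  rewrite (_ : series _ = fun n => pseries c x (n + 1)%N - c 0); last first.
    apply/funext => n; rewrite /pseries/= /series/= addn1 [X in X - _]big_nat_recl//=.
    by rewrite expr0 mulr1 addrAC subrr add0r.
  by apply: cvgB; [rewrite (cvg_shiftn 1)|exact: cvg_cst].
rewrite (_ : pseries _ _ = series (x^-1 *: (fun n => c n.+1 * x ^+ n.+1)))//.
rewrite /pseries; congr series; apply/funext => n /=.
by rewrite -[RHS]/(x^-1 * (c n.+1 * x ^+ n.+1)) exprS; field.
Qed.

(** The factor n + 1 is at most 2^n, so [le_entire] applies with B = 2. *)
Lemma entire_diffs c : entire c -> entire (pseries_diffs c).
Proof.
move=> /entire_shift cc; apply: (@le_entire _ _ 1 2 _ _ _ cc) => // n.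
rewrite /pseries_diffs normrM mul1r ger0_norm// ler_wpM2r//.
by rewrite -natrX ler_nat ltn_expl.
Qed.

Lemma entire_invfact : entire (fun n => (n`!%:R : R)^-1).
Proof.
move=> x; have := is_cvg_series_exp_coeff x.
rewrite (_ : exp_coeff x = fun n => (n`!%:R)^-1 * x ^+ n)//.
by apply/funext => n; rewrite /exp_coeff/= mulrC.
Qed.

Lemma is_derive_psum c x : entire c ->
  is_derive x (1 : R) (psum c) (psum (pseries_diffs c) x).
Proof.
move=> cc; apply: (@pseries_snd_diffs _ _ (`|x| + 1)); rewrite ?cc//.
- exact: entire_diffs.
- exact/entire_diffs/entire_diffs.
- by rewrite [ltRHS]ger0_norm ?ltrDl// addr_ge0.
Qed.

Lemma continuous_psum c : entire c -> continuous (psum c).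
Proof.
move=> cc x; apply/differentiable_continuous/derivable1_diffP.
by have [] := is_derive_psum x cc.
Qed.

Lemma psum_recl c x : entire c -> psum c x = c 0 + x * psum (fun n => c n.+1) x.
Proof.
move=> cc; rewrite /psum; apply/cvg_lim => //.
rewrite -(cvg_shiftn 1).
rewrite (_ : (fun n => _) = fun n => c 0 + x * pseries (fun n => c n.+1) x n).
  by apply: cvgD; [exact: cvg_cst|apply: cvgM; [exact: cvg_cst|exact: entire_shift]].
apply/funext => n; rewrite addn1 /pseries/= /series/= big_nat_recl//= expr0 mulr1.
by congr (_ + _); rewrite mulr_sumr; apply: eq_bigr => i _; rewrite exprS; ring.
Qed.

Lemma psum0 c : entire c -> psum c 0 = c 0.
Proof. by move=> cc; rewrite psum_recl// mul0r addr0. Qed.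

Lemma psumD c d x : entire c -> entire d ->
  psum (fun n => c n + d n) x = psum c x + psum d x.
Proof.
move=> cc cd; rewrite /psum -[RHS]lim_seriesD; [|exact: cc|exact: cd].
by congr (limn (series _)); apply/funext => n /=; rewrite mulrDl.
Qed.

Lemma psumZ k c x : entire c -> psum (fun n => k * c n) x = k * psum c x.
Proof.
move=> cc; rewrite /psum -[RHS]lim_seriesZ; last exact: cc.
by congr (limn (series _)); apply/funext => n /=; rewrite -mulrA.
Qed.

(** The Euler operator y d/dy is diagonal on coefficients; differential identities thereby become
    identities between coefficients. *)
Lemma psum_scale_diffs c y : entire c ->
  y * psum (pseries_diffs c) y = psum (fun k => k%:R * c k) y.
Proof.
move=> cc; have ck : entire (fun k => k%:R * c k).
  apply: (@le_entire c _ 1 2) => // k.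
  by rewrite normrM mul1r ger0_norm// ler_wpM2r// -natrX ler_nat ltnW// ltn_expl.
by rewrite [RHS]psum_recl// mul0r add0r.
Qed.

Lemma pseries_norm_le c x r n : entire c -> `|x| <= r ->
  `|pseries c x n| <= psum (fun n => `|c n|) r.
Proof.
move=> cc xr; have r0 : 0 <= r by exact: le_trans xr.
apply: le_trans (_ : pseries (fun n => `|c n|) r n <= _).
  rewrite (le_trans (ler_norm_sum _ _ _))// ler_sum// => i _.
  by rewrite normrM normrX ler_wpM2l// lerXn2r ?nnegrE.
apply: nondecreasing_cvgn_le; last exact: entire_norm.
by apply: nondecreasing_series => i _ _; rewrite mulr_ge0// exprn_ge0.
Qed.

Lemma psum_norm_le c x r : entire c -> `|x| <= r ->
  `|psum c x| <= psum (fun n => `|c n|) r.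
Proof.
move=> cc xr.
have cn : `|pseries c x n| @[n --> \oo] --> `|psum c x| by apply: cvg_norm; exact: cc.
rewrite -(cvg_lim _ cn)//; apply: limr_le; first exact: cvgP cn.
by apply: nearW => n; exact: pseries_norm_le.
Qed.

End PowerSeries.

(** * The fundamental theorem of calculus on closed intervals *)

Section IntegralCalculus.
Context {R : realType}.
Notation mu := (@lebesgue_measure R).
Implicit Types (f g F : R -> R) (a b : R).

Lemma continuous_integrable f a b : {within `[a, b], continuous f} ->
  mu.-integrable `[a, b] (EFin \o f).
Proof.
by move=> cf; apply: continuous_compact_integrable => //; exact: segment_compact.
Qed.

Lemma FTC2_within F f a b : a <= b ->
  {within `[a, b], continuous F} -> {within `[a, b], continuous f} ->
  (forall x, a < x < b -> is_derive x 1 F (f x)) ->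
  (\int[mu]_(x in `[a, b]) (f x)%:E = (F b - F a)%:E)%E.
Proof.
move=> ab cF cf dF; have [->|/= aNb] := eqVneq a b.
  by rewrite set_itv1 integral_set1 subrr.
have {}ab : a < b by rewrite lt_neqAle aNb.
rewrite (continuous_FTC2 ab cf (F := F)) ?EFinB//.
- have /(continuous_within_itvP _ ab)[_ ca cb] := cF; split => //.
  by move=> x; rewrite in_itv/= => /dF[].
- move=> x; rewrite in_itv/= => /dF[? <-].
  by rewrite derive1E.
Qed.

Lemma Rintegral_FTC2 F f a b : a <= b ->
  {within `[a, b], continuous F} -> {within `[a, b], continuous f} ->
  (forall x, a < x < b -> is_derive x 1 F (f x)) ->
  \int[mu]_(x in `[a, b]) f x = F b - F a.
Proof. by move=> *; rewrite /Rintegral (@FTC2_within F). Qed.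

Lemma is_derive_Rintegral f a b x : {within `[a, b], continuous f} -> a < x < b ->
  is_derive x 1 (fun t => \int[mu]_(s in `[a, t]) f s) (f x).
Proof.
move=> cf /andP[ax xb]; have ab := lt_trans ax xb.
have fx : {for x, continuous f}.
  by have /(continuous_within_itvP _ ab)[+ _ _] := cf; apply; rewrite in_itv/= ax.
have [dF F'] := continuous_FTC1_closed xb (continuous_integrable cf) ax fx.
by apply: DeriveDef dF _; rewrite -derive1E.
Qed.

Lemma continuous_Rintegral f a b : a <= b -> {within `[a, b], continuous f} ->
  {within `[a, b], continuous (fun t => \int[mu]_(s in `[a, t]) f s)}.
Proof.
by move=> ab cf; apply: parameterized_integral_continuous => //; exact: continuous_integrable.
Qed.

Lemma withinM f g a b : {within `[a, b], continuous f} ->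
  {within `[a, b], continuous g} ->
  {within `[a, b], continuous (fun x => f x * g x)}.
Proof. by move=> cf cg x; apply: cvgM; [exact: cf|exact: cg]. Qed.

Lemma withinD f g a b : {within `[a, b], continuous f} ->
  {within `[a, b], continuous g} ->
  {within `[a, b], continuous (fun x => f x + g x)}.
Proof. by move=> cf cg x; apply: cvgD; [exact: cf|exact: cg]. Qed.

Lemma withinB f g a b : {within `[a, b], continuous f} ->
  {within `[a, b], continuous g} ->
  {within `[a, b], continuous (fun x => f x - g x)}.
Proof. by move=> cf cg x; apply: cvgB; [exact: cf|exact: cg]. Qed.

Lemma withinZ k f a b : {within `[a, b], continuous f} ->
  {within `[a, b], continuous (fun x => k * f x)}.
Proof. by move=> cf x; apply: cvgM; [exact: cvg_cst|exact: cf]. Qed.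

Lemma within_continuous f a b : continuous f -> {within `[a, b], continuous f}.
Proof. by move=> cf; exact: continuous_subspaceT. Qed.

Lemma is_derive_chain F f x (l m c : R) :
  is_derive (F x) 1 f l -> is_derive x 1 F m -> c = l * m ->
  is_derive x 1 (fun t => f (F t)) c.
Proof. by move=> df dF ->; exact: is_derive1_comp. Qed.

(** Derivatives are asked only inside the interval, because an integral over [[0, t]] is in general
    not differentiable at t = 0. *)
Lemma ge0_nondecreasing_itv F f a b : a <= b ->
  {within `[a, b], continuous F} ->
  (forall x, a < x < b -> is_derive x 1 F (f x)) ->
  (forall x, a < x < b -> 0 <= f x) -> F a <= F b.
Proof.
move=> ab cF dF f0; have [->//|/= aNb] := eqVneq a b.
have {}ab : a < b by rewrite lt_neqAle aNb.
have dF' x : x \in `]a, b[ -> is_derive x 1 F (f x) by rewrite in_itv/= => /dF.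
have [c cab /(canRL (subrK _)) ->] := MVT ab dF' cF.
by rewrite in_itv/= in cab; rewrite lerDr mulr_ge0 ?f0// subr_ge0 ltW.
Qed.

End IntegralCalculus.

(** * The Gamma and Beta integrals *)

Section MeasurableComposition.
Context {R : realType} d1 d2 (T1 : measurableType d1) (T2 : measurableType d2).

Lemma measurable_fun_comp (h : R -> R) (D : set T1) (g : T1 -> R) :
  measurable_fun setT h -> measurable_fun D g -> measurable_fun D (fun p => h (g p)).
Proof. by move=> mh mg; exact: (measurableT_comp mh mg). Qed.

Lemma measurable_fun_comp_fst d3 (T3 : measurableType d3) (h : T1 -> T3) :
  measurable_fun setT h -> measurable_fun setT (fun p : T1 * T2 => h p.1).
Proof. by move=> mh; exact: (measurableT_comp mh measurable_fst). Qed.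

Lemma measurable_fun_comp_snd d3 (T3 : measurableType d3) (h : T2 -> T3) :
  measurable_fun setT h -> measurable_fun setT (fun p : T1 * T2 => h p.2).
Proof. by move=> mh; exact: (measurableT_comp mh measurable_snd). Qed.

End MeasurableComposition.

Section AffineChange.
Context {R : realType}.
Notation mu := (@lebesgue_measure R).
Local Open Scope ereal_scope.

Lemma measurable_affine (c h : R) :
  measurable_fun [set: measurableTypeR R]
    ((fun x : R => c * x + h)%R : _ -> measurableTypeR R).
Proof.
apply: (@continuous_measurable_fun R) => x.
by apply: cvgD; [exact: mulrl_continuous|exact: cvg_cst].
Qed.

(** The image of Lebesgue measure under x -> c x + h, multiplied by c, gives every half-open
    interval its length, hence is Lebesgue measure by uniqueness. *)
Lemma ge0_integral_affine (c h : R) (f : R -> \bar R) : (0 < c)%R ->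
  measurable_fun setT f -> (forall x, 0 <= f x) ->
  \int[mu]_x f (c * x + h)%R = (c^-1)%:E * \int[mu]_x f x.
Proof.
move=> c0 mf f0; pose phi : measurableTypeR R -> measurableTypeR R :=
  fun x => (c * x + h)%R.
have mphi : measurable_fun setT phi by exact: measurable_affine.
have ci0 : (0 <= c^-1)%R by rewrite invr_ge0 ltW.
pose k := NngNum (ltW c0).
pose pm : {measure set (measurableTypeR R) -> \bar R} := pushforward mu phi.
have -> : \int[mu]_x f (c * x + h)%R = \int[pm mphi]_y f y.
  by rewrite ge0_integral_pushforward// preimage_setT.
have -> : \int[mu]_x f x = \int[mscale k (pm mphi)]_x f x.
  apply: eq_measure_integral => A mA _.
  apply: lebesgue_measure_unique => // _ [[a b]] _ <-.
  rewrite -[RHS]/(c%:E * mu (phi @^-1` `]a, b])).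
  rewrite (_ : phi @^-1` `]a, b] = `]((a - h) / c)%R, ((b - h) / c)%R]%classic); last first.
    apply/seteqP; split=> x; rewrite /phi/= !in_itv/= => /andP[xa xb]; apply/andP.
      by rewrite ltr_pdivrMr// ler_pdivlMr// ltrBlDr lerBrDr mulrC.
    by move: xa xb; rewrite ltr_pdivrMr// ler_pdivlMr// ltrBlDr lerBrDr mulrC.
  rewrite !lebesgue_measure_itv/= !lte_fin ltr_pM2r ?invr_gt0// ltrD2r.
  case: ifPn => // ab; rewrite ?mule0// -!EFinB -EFinM; congr _%:E.
  by field; rewrite gt_eqF.
rewrite ge0_integral_mscale//= muleA -EFinM mulVf ?mul1e// gt_eqF//.
Qed.

End AffineChange.

Section GammaFunction.
Context {R : realType}.
Notation mu := (@lebesgue_measure R).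
Implicit Types (a b s t x y z r : R).
Local Open Scope ereal_scope.

(** This is x_+^(a-1), extended by 0 so that convolutions and Laplace transforms are integrals over
    the whole line. *)
Definition trunc_powR a x : R := (if 0 < x then x `^ (a - 1) else 0)%R.

Lemma trunc_powR_ge0 a x : (0 <= trunc_powR a x)%R.
Proof. by rewrite /trunc_powR; case: ifPn => // _; exact: powR_ge0. Qed.

Lemma trunc_powR_gt0 a x : (0 < x)%R -> trunc_powR a x = (x `^ (a - 1))%R.
Proof. by rewrite /trunc_powR => ->. Qed.

Lemma trunc_powR_le0 a x : (x <= 0)%R -> trunc_powR a x = 0%R.
Proof. by rewrite /trunc_powR ltNge => ->. Qed.

Lemma trunc_powRE a : trunc_powR a = ((fun x => x `^ (a - 1)) \_ `]0, +oo[)%R.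
Proof.
apply/funext => x; rewrite /trunc_powR patchE.
by case: ifPn => x0; [rewrite mem_set|rewrite memNset//]; rewrite //= in_itv/= andbT//; exact/negP.
Qed.

Lemma measurable_trunc_powR a : measurable_fun setT (trunc_powR a).
Proof.
rewrite trunc_powRE; apply/(measurable_restrictT _ _).1 => //.
by apply: measurable_funTS; exact: measurable_powR.
Qed.

(** Extended-real valued, so that Tonelli's theorem can be applied before the integral is known to
    be finite ([eGamma_fin]). *)
Definition eGamma a := \int[mu]_x (trunc_powR a x * expR (- x))%:E.

Lemma eGamma_ge0 a : 0 <= eGamma a.
Proof.
by apply: integral_ge0 => x _; rewrite lee_fin mulr_ge0 ?expR_ge0// trunc_powR_ge0.
Qed.

Lemma eGammaE a :
  eGamma a = \int[mu]_(x in `]0%R, +oo[) (x `^ (a - 1) * expR (- x))%:E.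
Proof.
rewrite [RHS]integral_mkcond; apply: eq_integral => x _.
rewrite patchE /trunc_powR.
by case: ifPn => x0; [rewrite mem_set|rewrite memNset ?mul0r//]; rewrite //= in_itv/= andbT//; exact/negP.
Qed.

Lemma Gamma_fine a : Gamma a = fine (eGamma a).
Proof. by rewrite /Gamma /Rintegral eGammaE. Qed.

Lemma measurable_expRN : measurable_fun setT (fun x : R => expR (- x)).
Proof. exact: measurableT_comp. Qed.

(** Laplace transform of x_+^(a-1) at r, by the substitution x -> r x. *)
Lemma eGamma_scale a r : (0 < r)%R ->
  \int[mu]_x (trunc_powR a x * expR (- (r * x)))%:E = (r `^ (- a))%:E * eGamma a.
Proof.
move=> r0; have := @ge0_integral_affine R r 0 (fun x => (trunc_powR a x * expR (- x))%:E) r0.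
under eq_integral do rewrite addr0.
rewrite -/(eGamma a) => H; rewrite [X in _ * X](_ : _ = r%:E * (r^-1%:E * eGamma a)); last first.
  by rewrite muleA -EFinM divff ?mul1e// gt_eqF.
rewrite -H; last 2 first.
- apply/measurable_EFinP/measurable_funM; first exact: measurable_trunc_powR.
  exact: measurable_expRN.
- by move=> x; rewrite lee_fin mulr_ge0 ?expR_ge0// trunc_powR_ge0.
rewrite muleA -EFinM -ge0_integralZl//; last 3 first.
- apply/measurable_EFinP/measurable_funM; last first.
    by apply: measurableT_comp => //; exact: measurableT_comp.
  by apply: measurableT_comp => //; exact: measurable_trunc_powR.
- by move=> x _; rewrite lee_fin mulr_ge0 ?expR_ge0// trunc_powR_ge0.
- by rewrite lee_fin mulr_ge0 ?powR_ge0// ltW.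
apply: eq_integral => x _; rewrite -EFinM; congr _%:E; rewrite mulrA; congr (_ * _)%R.
have [x0|x0] := ltP 0%R x; last by rewrite !trunc_powR_le0 ?mulr0// pmulr_rle0.
rewrite !trunc_powR_gt0 ?mulr_gt0// powRM// ?ltW// mulrA.
rewrite (_ : r `^ (- a) * r * r `^ (a - 1) = 1)%R ?mul1r//.
have rN0 : r != 0%R by rewrite gt_eqF.
rewrite mulrAC -powRD ?rN0 ?implybT// (_ : - a + (a - 1) = -1)%R; last by ring.
by rewrite powR_inv1 ?(ltW r0)// mulVf.
Qed.

(** Convolution of two truncated powers; at z = 1 it is the Beta integral. *)
Definition trunc_conv a b z := \int[mu]_x (trunc_powR b x * trunc_powR a (z - x))%:E.

Lemma trunc_conv_ge0 a b z : 0 <= trunc_conv a b z.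
Proof. by apply: integral_ge0 => x _; rewrite lee_fin mulr_ge0 ?trunc_powR_ge0. Qed.

Lemma trunc_conv_le0 a b z : (z <= 0)%R -> trunc_conv a b z = 0.
Proof.
move=> z0; apply: integral0_eq => x _; have [x0|x0] := ltP 0%R x.
  by rewrite [X in (_ * X)%R]trunc_powR_le0 ?mulr0// subr_le0 (le_trans z0)// ltW.
by rewrite trunc_powR_le0 ?mul0r.
Qed.

Lemma measurable_trunc_powR_sub a z :
  measurable_fun setT (fun x => trunc_powR a (z - x)).
Proof.
apply: (@measurableT_comp _ _ _ _ _ _ (trunc_powR a)).
  exact: measurable_trunc_powR.
by apply: measurable_funB.
Qed.

Lemma trunc_conv_scale a b z : (0 < z)%R ->
  trunc_conv a b z = (z `^ (a + b - 1))%:E * trunc_conv a b 1.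
Proof.
move=> z0.
have := @ge0_integral_affine R z 0 (fun x => (trunc_powR b x * trunc_powR a (z - x))%:E) z0.
rewrite -/(trunc_conv a b z) => H.
have -> : trunc_conv a b z = z%:E * (z^-1%:E * trunc_conv a b z).
  by rewrite muleA -EFinM divff ?mul1e// gt_eqF.
rewrite -H; last 2 first.
- apply/measurable_EFinP/measurable_funM; first exact: measurable_trunc_powR.
  exact: measurable_trunc_powR_sub.
- by move=> x; rewrite lee_fin mulr_ge0 ?trunc_powR_ge0.
have scale c x : trunc_powR c (z * x) = (z `^ (c - 1) * trunc_powR c x)%R.
  have [x0|x0] := ltP 0%R x; last by rewrite !trunc_powR_le0 ?mulr0// pmulr_rle0.
  by rewrite !trunc_powR_gt0 ?mulr_gt0// powRM// ltW.
rewrite (_ : z `^ (a + b - 1) = z * (z `^ (b - 1) * z `^ (a - 1)))%R; last first.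
  have zN0 : z != 0%R by rewrite gt_eqF.
  rewrite -powRD ?zN0 ?implybT//; transitivity (z `^ 1 * z `^ (b - 1 + (a - 1)))%R.
    by rewrite -powRD ?zN0 ?implybT//; congr powR; ring.
  by rewrite powRr1// ltW.
rewrite EFinM -muleA; congr (_ * _).
rewrite -ge0_integralZl//; last 3 first.
- apply/measurable_EFinP/measurable_funM; first exact: measurable_trunc_powR.
  exact: measurable_trunc_powR_sub.
- by move=> x _; rewrite lee_fin mulr_ge0 ?trunc_powR_ge0.
- by rewrite lee_fin mulr_ge0 ?powR_ge0.
apply: eq_integral => x _; rewrite -EFinM; congr _%:E.
by rewrite addr0 (_ : z - z * x = z * (1 - x))%R ?scale; ring.
Qed.

(** Substituting z = x + y in the product of the two integrals makes the convolution appear by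
    Tonelli; its homogeneity ([trunc_conv_scale]) then separates the variable z. *)
Lemma eGammaM a b : eGamma a * eGamma b = eGamma (a + b) * trunc_conv a b 1.
Proof.
have mt := @measurable_trunc_powR.
have me := measurable_expRN.
have -> : eGamma a * eGamma b =
    \int[mu]_x \int[mu]_z (trunc_powR b x * trunc_powR a (z - x) * expR (- z))%:E.
  rewrite muleC -ge0_integralZr//; last 3 first.
  - by apply/measurable_EFinP/measurable_funM; [exact: mt|exact: me].
  - by move=> x _; rewrite lee_fin mulr_ge0 ?expR_ge0// trunc_powR_ge0.
  - exact: eGamma_ge0.
  apply: eq_integral => x _.
  pose h z := (trunc_powR b x * trunc_powR a (z - x) * expR (- z))%:E.
  have := @ge0_integral_affine R 1 x h ltr01; rewrite invr1 mul1e => <-; last 2 first.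
  - apply/measurable_EFinP/measurable_funM; last exact: me.
    apply: measurable_funM => //.
    apply: (@measurableT_comp _ _ _ _ _ _ (trunc_powR a)) => //.
    by apply: measurable_funB.
  - by move=> z; rewrite lee_fin !mulr_ge0 ?expR_ge0// trunc_powR_ge0.
  rewrite -ge0_integralZl//; last 3 first.
  - by apply/measurable_EFinP/measurable_funM; [exact: mt|exact: me].
  - by move=> z _; rewrite lee_fin mulr_ge0 ?expR_ge0// trunc_powR_ge0.
  - by rewrite lee_fin mulr_ge0 ?expR_ge0// trunc_powR_ge0.
  apply: eq_integral => z _; rewrite -EFinM; congr _%:E.
  by rewrite /h mul1r addrK opprD expRD; ring.
pose F p : \bar R := (trunc_powR b p.1 * trunc_powR a (p.2 - p.1) * expR (- p.2))%:E.
transitivity (\int[mu]_z \int[mu]_x F (x, z)).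
  apply: (@fubini_tonelli _ _ _ _ R mu mu F).
    apply/measurable_EFinP/measurable_funM; last exact: measurable_fun_comp_snd me.
    apply: measurable_funM; first exact: (measurable_fun_comp_fst (mt b)).
    apply: (measurable_fun_comp (mt a)).
    by apply: measurable_funB; [exact: measurable_snd|exact: measurable_fst].
  by move=> p; rewrite lee_fin !mulr_ge0 ?expR_ge0// trunc_powR_ge0.
rewrite -ge0_integralZr//; last 3 first.
- by apply/measurable_EFinP/measurable_funM; [exact: mt|exact: me].
- by move=> z _; rewrite lee_fin mulr_ge0 ?expR_ge0// trunc_powR_ge0.
- exact: trunc_conv_ge0.
apply: eq_integral => z _.
transitivity ((expR (- z))%:E * trunc_conv a b z).
  rewrite -ge0_integralZl//; last 2 first.
  - apply/measurable_EFinP/measurable_funM; first exact: mt.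
    exact: measurable_trunc_powR_sub.
  - by move=> x _; rewrite lee_fin mulr_ge0 ?trunc_powR_ge0.
  by apply: eq_integral => x _; rewrite -EFinM mulrC.
have [z0|z0] := ltP 0%R z; last by rewrite trunc_conv_le0// trunc_powR_le0// mul0r !(mul0e, mule0).
by rewrite trunc_conv_scale// trunc_powR_gt0// muleA -EFinM mulrC.
Qed.

End GammaFunction.

Section TruncatedPowers.
Context {R : realType}.
Notation mu := (@lebesgue_measure R).
Implicit Types (a b s t x y z r : R).

Lemma powR_le1 x a : 0 <= x <= 1 -> 0 <= a -> x `^ a <= 1.
Proof.
move=> /andP[x0 x1] a0; have := @ge0_ler_powR R a a0 x 1.
by rewrite !nnegrE x0 ler01 x1 powR1; apply.
Qed.

(** Truncating at 0 gives continuity on the whole line and changes nothing at nonnegative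
    arguments. *)
Lemma continuous_powR_max a : 0 < a ->
  continuous (fun x => (Num.max 0 x) `^ a).
Proof.
move=> a0 x; have [x0|x0|x0] := ltgtP x 0.
- apply: (near_cst_continuous 0); near=> y.
  have y0 : y < 0 by near: y; exact: lt_nbhsl.
  by rewrite max_l ?(ltW y0)// powR0 ?gt_eqF.
- have cp : {for x, continuous (@powR R ^~ a)}.
    apply/differentiable_continuous/derivable1_diffP.
    by have [] := is_derive1_powR a x0.
  rewrite /continuous_at max_r ?(ltW x0)//; apply: cvg_trans cp.
  apply: near_eq_cvg; near=> y; have y0 : 0 < y by near: y; exact: lt_nbhsr.
  by rewrite max_r// ltW.
- rewrite x0; apply/cvgrPdist_lt => e e0; near=> y.
  rewrite maxxx powR0 ?gt_eqF// sub0r normrN ger0_norm ?powR_ge0//.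
  rewrite -[ltRHS](powRr1 (ltW e0)) -(@mulVf _ a) ?gt_eqF// powRrM.
  apply: gt0_ltr_powR => //; rewrite ?nnegrE ?powR_ge0// ?le_max ?lexx//.
  have [y0|y0] := leP y 0; first by rewrite powR_gt0.
  near: y; apply: lt_nbhsl.
  by rewrite powR_gt0.
Unshelve. all: by end_near. Qed.

(** For b < 1 the integrand is singular at 0, so []0, t]] is exhausted by the intervals
    [[t / (i + 1), t]] and monotone convergence is used. *)
Lemma integral_powR_itv b t : 0 < b -> 0 < t ->
  (\int[mu]_(x in `]0%R, t]) (x `^ (b - 1))%:E = (t `^ b / b)%:E)%E.
Proof.
move=> b0 t0; pose F (i : nat) : set R := `[t / i.+1%:R, t]%classic.
have ti0 (i : nat) : 0 < t / i.+1%:R by rewrite divr_gt0.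
have tile (i : nat) : t / i.+1%:R <= t.
  by rewrite ler_pdivrMr// ler_peMr ?(ltW t0)// ler1n.
have UF : \bigcup_i F i = `]0, t]%classic.
  apply/seteqP; split=> x.
    by move=> [i _]; rewrite /F/= !in_itv/= => /andP[tx ->]; rewrite (lt_le_trans (ti0 i)).
  rewrite /= in_itv/= => /andP[x0 xt].
  exists (Num.truncn (t / x)) => //; rewrite /F/= in_itv/= xt andbT.
  rewrite ler_pdivrMr// mulrC -ler_pdivrMr// ltW//.
  by rewrite truncnS_gt// divr_ge0// ltW.
have dF i x : t / i.+1%:R < x < t -> is_derive x 1 (fun x => x `^ b / b) (x `^ (b - 1)).
  move=> /andP[tx _]; have x0 : 0 < x by rewrite (lt_trans (ti0 i)).
  have D := is_derive1_powR b x0.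
  apply: is_derive_eq; rewrite scaler0 add0r /GRing.scale/=.
  by rewrite mulrA mulVf ?mul1r// gt_eqF.
have cpow (c : R) i : {within `[t / i.+1%:R, t]%classic, continuous (@powR R ^~ c)}.
  apply: continuous_in_subspaceT => x; rewrite inE/= in_itv/= => /andP[tx _].
  apply/differentiable_continuous/derivable1_diffP.
  by have [] := is_derive1_powR c (lt_le_trans (ti0 i) tx).
have E (i : nat) : (\int[mu]_(x in F i) (x `^ (b - 1))%:E =
    (t `^ b / b - (t / i.+1%:R) `^ b / b)%:E)%E.
  apply: FTC2_within (tile i) _ (cpow _ _) (dF i).
  by move=> x; apply: cvgM; [exact: cpow|exact: cvg_cst].
have H : (\int[mu]_(x in F i) (x `^ (b - 1))%:E)%E @[i --> \oo] -->
    (\int[mu]_(x in `]0%R, t]) (x `^ (b - 1))%:E)%E.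
  rewrite -UF; apply: (@ge0_nondecreasing_set_cvg_integral _ (measurableTypeR R) R F _ mu).
  - apply/nondecreasing_seqP => n; rewrite subsetEset => x; rewrite /F/= !in_itv/=.
    move=> /andP[tx ->]; rewrite andbT (le_trans _ tx)// ler_pM2l// lef_pV2 ?posrE//.
    by rewrite ler_nat.
  - by move=> i; exact: measurable_itv.
  - move=> i; apply/measurable_EFinP; apply: measurable_funTS; exact: measurable_powR.
  - by move=> i x _; rewrite lee_fin powR_ge0.
move: H; under eq_fun do rewrite E.
move=> H; apply: (cvg_unique _ H) => //.
apply: cvg_EFin; first exact: nearW.
rewrite -[X in _ --> X]subr0; apply: cvgB; first exact: cvg_cst.
rewrite -[X in _ --> X](mul0r b^-1); apply: cvgM; last exact: cvg_cst.
have c0 : {for 0, continuous (fun x : R => (Num.max 0 x) `^ b)} by exact: continuous_powR_max.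
have c1 : t / i.+1%:R @[i --> \oo] --> (0 : R).
  rewrite -[X in _ --> X](mulr0 t); apply: cvgM; first exact: cvg_cst.
  exact: cvg_harmonic.
have := cvg_comp (fun i : nat => t / i.+1%:R) (fun x : R => (Num.max 0 x) `^ b) c1 c0.
rewrite maxxx powR0 ?gt_eqF// => H'; apply: cvg_trans H'; apply: near_eq_cvg.
by apply: nearW => i /=; rewrite max_r// ltW.
Qed.

End TruncatedPowers.

Section GammaProperties.
Context {R : realType}.
Notation mu := (@lebesgue_measure R).
Implicit Types (a b s t x y z r : R).
Local Open Scope ereal_scope.

Lemma eGamma1 : eGamma 1 = 1 :> \bar R.
Proof.
rewrite eGammaE integral_itv_obnd_cbnd; last first.
  apply/measurable_EFinP; apply: measurable_funTS; apply: measurable_funM.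
    exact: measurable_powR.
  exact: measurable_expRN.
transitivity (\int[mu]_(x in `[0%R, +oo[) (expR (- x))%:E).
  by apply: eq_integral => x _; rewrite subrr powRr0 mul1r.
have cE : continuous (fun x : R => expR (- x)).
  by move=> x; apply: continuous_comp; [exact: continuousN|exact: continuous_expR].
rewrite (@ge0_continuous_FTC2y R _ (fun x => - expR (- x))%R 0 0%R).
- by rewrite oppr0 expR0 sub0e EFinN oppeK.
- by move=> x _; exact: expR_ge0.
- exact: continuous_subspaceT.
- by rewrite -oppr0; apply: cvgN; exact: cvgr_expR.
- by move=> x _; apply: ex_derive.
- by apply: cvg_at_right_filter; apply: cvgN; exact: cE.
- move=> x _; rewrite derive1E derive_val/=.
  by rewrite -[X in (- X)%R]/(expR (- x) * - 1)%R; ring.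
Qed.

(** For a >= 1 the factor (1 - x)^(a-1) is at most 1. The bound serves to prove that the Gamma
    integral is finite. *)
Lemma trunc_conv_le a b : (1 <= a)%R -> (0 < b)%R ->
  trunc_conv a b 1 <= (b^-1)%:E.
Proof.
move=> a1 b0; rewrite (_ : b^-1%:E = \int[mu]_(x in `]0%R, 1%R]) (x `^ (b - 1))%:E); last first.
  by rewrite integral_powR_itv// powR1 div1r.
rewrite [leRHS]integral_mkcond; apply: ge0_le_integral => //.
- by move=> x _; rewrite lee_fin mulr_ge0 ?trunc_powR_ge0.
- apply/measurable_EFinP/measurable_funM; first exact: measurable_trunc_powR.
  exact: measurable_trunc_powR_sub.
- apply/(measurable_restrictT _ _).1 => //; apply/measurable_EFinP; apply: measurable_funTS.
  exact: measurable_powR.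
move=> x _; rewrite patchE; case: ifPn => [|].
  rewrite inE/= in_itv/= => /andP[x0 x1]; rewrite lee_fin trunc_powR_gt0//.
  rewrite ler_piMr ?powR_ge0//; have [xl|xl] := ltP x 1%R; last first.
    by rewrite trunc_powR_le0 ?ler01// subr_le0.
  by rewrite trunc_powR_gt0 ?subr_gt0// powR_le1 ?subr_ge0 ?x1// gerBl ltW.
rewrite notin_setE/= in_itv/= => /negP; rewrite negb_and -leNgt -ltNge => /orP[x0|x1].
  by rewrite trunc_powR_le0 ?mul0r.
by rewrite [X in (_ * X)%R]trunc_powR_le0 ?mulr0// subr_le0 ltW.
Qed.

Lemma trunc_conv1 b : (0 < b)%R -> trunc_conv 1 b 1 = (b^-1)%:E.
Proof.
move=> b0; rewrite (_ : b^-1%:E = \int[mu]_(x in `]0%R, 1%R]) (x `^ (b - 1))%:E); last first.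
  by rewrite integral_powR_itv// powR1 div1r.
rewrite -integral_itv_bndo_bndc; last first.
  by apply/measurable_EFinP; apply: measurable_funTS; exact: measurable_powR.
rewrite [RHS]integral_mkcond; apply: eq_integral => x _.
rewrite patchE; case: ifPn => [|].
  rewrite inE/= in_itv/= => /andP[x0 x1]; rewrite trunc_powR_gt0//.
  by rewrite trunc_powR_gt0 ?subr_gt0// subrr powRr0 mulr1.
rewrite notin_setE/= in_itv/= => /negP; rewrite negb_and -!leNgt => /orP[x0|x1].
  by rewrite trunc_powR_le0 ?mul0r.
by rewrite [X in (_ * X)%R]trunc_powR_le0 ?mulr0// subr_le0.
Qed.

(** The case a = 1 of [eGammaM], where the Beta integral equals 1 / b. *)
Lemma eGammaS b : (0 < b)%R -> eGamma (b + 1) = b%:E * eGamma b.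
Proof.
move=> b0; have := eGammaM 1%R b; rewrite eGamma1 mul1e trunc_conv1// => ->.
by rewrite muleCA -EFinM divff ?gt_eqF// mule1 addrC.
Qed.

Lemma eGamma_nat n : eGamma n.+1%:R = (n`!%:R : R)%:E.
Proof.
elim: n => [|n IH]; first by rewrite fact0 eGamma1.
by rewrite -natr1 eGammaS// IH -EFinM -natrM factS.
Qed.

(** On [[1, +oo[] the power is at least 1, and what remains integrates to exp(-1). *)
Lemma eGamma_ge1 x : (1 <= x)%R -> (expR (- 1))%:E <= eGamma x.
Proof.
move=> x1; have cE : continuous (fun x : R => expR (- x)).
  by move=> y; apply: continuous_comp; [exact: continuousN|exact: continuous_expR].
have <- : \int[mu]_(y in `[1%R, +oo[) (expR (- y))%:E = (expR (- 1))%:E.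
  rewrite (@ge0_continuous_FTC2y R _ (fun x => - expR (- x))%R 1 0%R).
  - by rewrite sub0e EFinN oppeK.
  - by move=> y _; exact: expR_ge0.
  - exact: continuous_subspaceT.
  - by rewrite -oppr0; apply: cvgN; exact: cvgr_expR.
  - by move=> y _; apply: ex_derive.
  - by apply: cvg_at_right_filter; apply: cvgN; exact: cE.
  - move=> y _; rewrite derive1E derive_val/=.
    by rewrite -[X in (- X)%R]/(expR (- y) * - 1)%R; ring.
rewrite integral_mkcond; apply: ge0_le_integral => //.
- by move=> y _; apply: erestrict_ge0 => z _; rewrite lee_fin expR_ge0.
- apply/(measurable_restrictT _ _).1 => //; apply/measurable_EFinP; apply: measurable_funTS.
  exact: measurable_expRN.
- apply/measurable_EFinP/measurable_funM; first exact: measurable_trunc_powR.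
  exact: measurable_expRN.
move=> y _; rewrite patchE; case: ifPn => [|]; last first.
  by move=> _; rewrite lee_fin mulr_ge0 ?expR_ge0// trunc_powR_ge0.
rewrite inE/= in_itv/= andbT => y1; rewrite lee_fin trunc_powR_gt0 ?(lt_le_trans ltr01)//.
by rewrite ler_peMl ?expR_ge0// -[leLHS](powRr0 y) ler_powR// subr_ge0.
Qed.

(** Gamma is not monotone on [1, 2], so the integrands are compared instead: beyond 1 the powers
    increase with the exponent, and on []0, 1]] the integrand is at most 1, which costs the summand
    1. *)
Lemma eGamma_ge_fact (k : nat) x : (k.+1%:R <= x)%R -> (k`!%:R)%:E <= eGamma x + 1.
Proof.
move=> kx; rewrite -eGamma_nat.
have -> : 1 = \int[mu]_y (\1_(`]0%R, 1%R] : set R) y)%:E :> \bar R.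
  by rewrite integral_indic// setIT [RHS]lebesgue_measure_itv/= lte01 oppr0 adde0.
rewrite -ge0_integralD//; last 3 first.
- by move=> y _; rewrite lee_fin mulr_ge0 ?expR_ge0// trunc_powR_ge0.
- apply/measurable_EFinP/measurable_funM; first exact: measurable_trunc_powR.
  exact: measurable_expRN.
- by apply/measurable_EFinP; exact: measurable_indic.
apply: ge0_le_integral => //.
- by move=> y _; rewrite lee_fin mulr_ge0 ?expR_ge0// trunc_powR_ge0.
- apply/measurable_EFinP/measurable_funM; first exact: measurable_trunc_powR.
  exact: measurable_expRN.
- apply/emeasurable_funD.
    apply/measurable_EFinP/measurable_funM; first exact: measurable_trunc_powR.
    exact: measurable_expRN.
  by apply/measurable_EFinP; exact: measurable_indic.
move=> y _; rewrite -EFinD lee_fin.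
have [y0|y0] := ltP 0%R y; last by rewrite !trunc_powR_le0 // !mul0r add0r.
rewrite !trunc_powR_gt0//; have [y1|y1] := leP y 1%R.
  rewrite indicE mem_set/= ?in_itv/= ?y0//.
  rewrite (@le_trans _ _ 1%R) ?lerDr ?mulr_ge0 ?expR_ge0 ?powR_ge0//.
  rewrite mulr_ile1 ?powR_ge0 ?expR_ge0//.
    by rewrite powR_le1 ?subr_ge0 ?ler1n// y1 ltW.
  by rewrite expR_le1 oppr_le0 ltW.
rewrite (@le_trans _ _ (y `^ (x - 1) * expR (- y))%R) ?lerDl//.
rewrite ler_wpM2r ?expR_ge0//; apply: ler_powR; first exact: ltW.
by rewrite lerD2r.
Qed.

(** For n > a, [eGammaM] writes Gamma(n + 1 - a) Gamma(a) as n! times a Beta integral that is at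
    most 1 / a. The first factor is at least exp(-1), so the second cannot be infinite. *)
Lemma eGamma_fin a : (0 < a)%R -> eGamma a = (Gamma a)%:E.
Proof.
move=> a0; rewrite Gamma_fine fineK//.
pose n := (Num.truncn a).+1.
have an : (a < n%:R)%R by rewrite truncnS_gt// ltW.
have c1 : (1 <= n.+1%:R - a)%R by rewrite -natr1 lerBrDr addrC lerD2r ltW.
have := eGammaM (n.+1%:R - a)%R a; rewrite subrK eGamma_nat => H.
have H2 : eGamma (n.+1%:R - a)%R * eGamma a < +oo.
  rewrite H; apply: (@le_lt_trans _ _ (n`!%:R%:E * a^-1%:E)); last by rewrite -EFinM ltry.
  by rewrite lee_pmul2l ?trunc_conv_le// lte_fin ltr0n fact_gt0.
rewrite ge0_fin_numE ?eGamma_ge0// ltey; apply/negP => /eqP E.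
move: H2; rewrite E gt0_muley ?ltxx//.
by apply: lt_le_trans (eGamma_ge1 c1); rewrite lte_fin expR_gt0.
Qed.

Lemma GammaS b : (0 < b)%R -> Gamma (b + 1) = (b * Gamma b)%R.
Proof.
move=> b0; apply: EFin_inj; rewrite -eGamma_fin ?addr_gt0// eGammaS//.
by rewrite eGamma_fin.
Qed.

Lemma Gamma1 : Gamma 1 = 1%R :> R.
Proof. by rewrite Gamma_fine eGamma1. Qed.

Lemma Gamma_ge1 x : (1 <= x)%R -> (expR (- 1) <= Gamma x)%R.
Proof. by move=> x1; rewrite -lee_fin -eGamma_fin ?(lt_le_trans ltr01)// eGamma_ge1. Qed.

Lemma Gamma_gt0 x : (0 < x)%R -> (0 < Gamma x)%R.
Proof.
move=> x0; rewrite -(pmulr_rgt0 _ x0) -GammaS//.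
by rewrite (lt_le_trans _ (Gamma_ge1 _)) ?expR_gt0// lerDr ltW.
Qed.

(** exp(-1) is the sixth power of exp(-1/6) >= 5/6, and (5/6)^6 exceeds 1/3. *)
Lemma expRN1_ge3V : (3^-1 <= expR (- 1) :> R)%R.
Proof.
rewrite (_ : - 1 = 6%:R * - (6%:R^-1))%R; last by rewrite mulrN divff.
rewrite expRM_natl (@le_trans _ _ ((5 / 6) ^+ 6)%R)//; first by lra.
rewrite lerXn2r ?nnegrE ?expR_ge0//.
by rewrite (le_trans _ (expR_ge1Dx _))//; lra.
Qed.

(** When k! = 1 the bound exp(-1) >= 1/3 suffices; from k! = 2 on, Gamma(x) >= k! - 1 >= k! / 2. *)
Lemma Gamma_ge_fact (k : nat) x : (k.+1%:R <= x)%R -> (k`!%:R / 6 <= Gamma x)%R.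
Proof.
move=> kx; have x1 : (1 <= x)%R by rewrite (le_trans _ kx)// ler1n.
have G : (k`!%:R <= Gamma x + 1)%R.
  by rewrite -lee_fin EFinD -eGamma_fin ?(lt_le_trans ltr01)// eGamma_ge_fact.
have e3 := expRN1_ge3V.
have G1 := le_trans e3 (Gamma_ge1 x1).
have [k1|k2] := leqP k 1.
  have -> : k`! = 1%N by case: k k1 {kx G} => [|[|]].
  by lra.
have f2 : (2 <= k`!%:R :> R)%R.
  rewrite ler_nat (leq_trans k2)//; case: k k2 {kx G} => // k _.
  by rewrite factS leq_pmulr// fact_gt0.
by move: f2 G; set f := _%:R => f2 G; lra.
Qed.

Lemma trunc_convE a b z : (0 < a)%R -> (0 < b)%R -> (0 < z)%R ->
  trunc_conv a b z = (Gamma a * Gamma b / Gamma (a + b) * z `^ (a + b - 1))%:E.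
Proof.
move=> a0 b0 z0; have G : Gamma (a + b) != 0%R by rewrite gt_eqF// Gamma_gt0// addr_gt0.
rewrite trunc_conv_scale// mulrC EFinM; congr (_ * _).
have := eGammaM a b; rewrite !eGamma_fin ?addr_gt0// -EFinM => H.
have -> : trunc_conv a b 1 = (Gamma (a + b))^-1%:E * ((Gamma (a + b))%:E * trunc_conv a b 1).
  by rewrite muleA -EFinM mulVf// mul1e.
by rewrite -H -EFinM mulrC.
Qed.

Lemma integral_powR_expR a r : (0 < a)%R -> (0 < r)%R ->
  \int[mu]_x (trunc_powR a x * expR (- (r * x)))%:E = (Gamma a * r `^ (- a))%:E.
Proof. by move=> a0 r0; rewrite eGamma_scale// eGamma_fin// -EFinM mulrC. Qed.

End GammaProperties.

(** * Positivity of the form of the Abel kernel *)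

Section ExponentialKernel.
Context {R : realType}.
Notation mu := (@lebesgue_measure R).
Implicit Types (f g h e : R -> R) (r t x T : R).

Lemma is_derive_expRl r x : is_derive x 1 (fun t => expR (r * t)) (r * expR (r * x)).
Proof.
have d : is_derive x 1 (fun t => r * t) r.
  rewrite (_ : (fun t => r * t) = r *: id)//.
  by apply: is_derive_eq; rewrite /GRing.scale/= mulr1.
by apply: (is_derive_chain (is_derive_expR (r * x)) d); rewrite mulrC.
Qed.

(** The solution of y' + r y = f with y(0) = 0. *)
Definition relax r f t : R := \int[mu]_(s in `[0, t]) (expR (- r * (t - s)) * f s).

(** Convolution of f with r t exp(- r t), that is, r times two successive relaxations at rate r. *)
Definition relax2 r f t : R :=
  \int[mu]_(s in `[0, t]) (r * (t - s) * expR (- r * (t - s)) * f s).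

Let prim r f t : R := \int[mu]_(s in `[0, t]) (expR (r * s) * f s).

Let cexp r : continuous (fun s => expR (r * s)).
Proof. by move=> x; apply: continuous_comp; [exact: mulrl_continuous|exact: continuous_expR]. Qed.

Lemma relaxE r f t : continuous f -> relax r f t = expR (- r * t) * prim r f t.
Proof.
move=> cf; rewrite /relax /prim -RintegralZl//; last first.
  apply: continuous_integrable; apply: within_continuous => x; apply: cvgM; last exact: cf.
  exact: cexp.
by apply: eq_Rintegral => s _; rewrite mulrA -expRD; congr (expR _ * _); ring.
Qed.

Lemma relax2E r f t : continuous f ->
  relax2 r f t = r * (t * relax r f t - relax r (fun s => s * f s) t).
Proof.
move=> cf.
have cr : continuous (fun s => expR (- r * (t - s))).
  move=> x; apply: (@continuous_comp _ _ _ (fun s => - r * (t - s))); last exact: continuous_expR.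
  by apply: cvgM; [exact: cvg_cst|apply: cvgB; [exact: cvg_cst|exact: cvg_id]].
have i1 : mu.-integrable `[0, t] (EFin \o (fun s => expR (- r * (t - s)) * f s)).
  by apply: continuous_integrable; apply: within_continuous => x; apply: cvgM; [exact: cr|exact: cf].
have i2 : mu.-integrable `[0, t] (EFin \o (fun s => expR (- r * (t - s)) * (s * f s))).
  apply: continuous_integrable; apply: within_continuous => x; apply: cvgM; first exact: cr.
  by apply: cvgM; [exact: cvg_id|exact: cf].
rewrite /relax2 /relax -RintegralZl// -RintegralB//; last first.
  rewrite (_ : _ \o _ = fun s => (t%:E * (expR (- r * (t - s)) * f s)%:E)%E)//.
  exact: (integrableZl _ _ i1).
rewrite -RintegralZl//; last first.
  apply: continuous_integrable; apply: within_continuous => x.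
  apply: cvgB; apply: cvgM; [exact: cvg_cst| | exact: cr|].
    by apply: cvgM; [exact: cr|exact: cf].
  by apply: cvgM; [exact: cvg_id|exact: cf].
by apply: eq_Rintegral => s _; ring.
Qed.

Lemma relax0 r f : relax r f 0 = 0.
Proof. by rewrite /relax set_itv1 Rintegral_set1. Qed.

Lemma is_derive_relax r f T x : continuous f -> 0 < x < T ->
  is_derive x 1 (relax r f) (f x - r * relax r f x).
Proof.
move=> cf xT; have -> : relax r f = fun t => expR (- r * t) * prim r f t.
  by apply/funext => t; exact: relaxE.
have d1 := is_derive_expRl (- r) x.
have d2 : is_derive x 1 (prim r f) (expR (r * x) * f x).
  apply: is_derive_Rintegral xT; apply: within_continuous => y.
  by apply: cvgM; [exact: cexp|exact: cf].
apply: is_derive_eq; rewrite /GRing.scale/=.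
transitivity (expR (- r * x) * expR (r * x) * f x - r * (expR (- r * x) * prim r f x)).
  by ring.
by rewrite -expRD mulNr addNr expR0 mul1r.
Qed.

Lemma continuous_relax r f T : 0 <= T -> continuous f ->
  {within `[0, T], continuous (relax r f)}.
Proof.
move=> T0 cf; have -> : relax r f = fun t => expR (- r * t) * prim r f t.
  by apply/funext => t; exact: relaxE.
apply: withinM; first by apply: within_continuous; exact: cexp.
apply: continuous_Rintegral => //; apply: within_continuous => x.
by apply: cvgM; [exact: cexp|exact: cf].
Qed.

(* With psi the backward relaxation of h, i.e. psi' = r psi - h and psi(T) = 0,
   the integrand is the perfect square r (psi + k relax e / 2)^2 plus a
   derivative whose integral is nonnegative. *)
Lemma relax_form_ge0 r k T h e : 0 <= r -> 0 <= T -> continuous h -> continuous e ->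
  0 <= \int[mu]_(t in `[0, T])
    (h t * relax r h t + k * (h t * relax2 r e t) + k ^+ 2 / 4 * (e t * relax r e t)).
Proof.
move=> r0 T0 ch ce.
pose N t : R := \int[mu]_(s in `[0, t]) (expR (- r * s) * h s).
pose psi t := expR (r * t) * (N T - N t).
pose ph := relax r h; pose pe := relax r e; pose ps := relax r (fun s => s * e s).
pose ch2 t := r * (t * pe t - ps t).
have -> : relax2 r e = ch2 by apply/funext => t; exact: relax2E.
rewrite -/ph -/pe.
have cse : continuous (fun s : R => s * e s) by move=> x; apply: cvgM; [exact: cvg_id|exact: ce].
have cph : {within `[0, T], continuous ph} by exact: continuous_relax.
have cpe : {within `[0, T], continuous pe} by exact: continuous_relax.
have cps : {within `[0, T], continuous ps} by exact: continuous_relax.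
have wh := @within_continuous R h 0 T ch.
have we := @within_continuous R e 0 T ce.
have wid := @within_continuous R _ 0 T (fun x => @cvg_id R (nbhs x)).
have cch : {within `[0, T], continuous ch2} by apply: withinZ; apply: withinB; [exact: withinM|exact: cps].
have cN0 : {within `[0, T], continuous (fun s => expR (- r * s) * h s)}.
  by apply: withinM => //; apply: within_continuous; exact: cexp.
have cN : {within `[0, T], continuous N} by exact: continuous_Rintegral.
have cpsi : {within `[0, T], continuous psi}.
  apply: withinM; first by apply: within_continuous; exact: cexp.
  by apply: withinB; [apply: within_continuous => x; exact: cvg_cst|exact: cN].
set I := fun t => _ + _.
have cI : {within `[0, T], continuous I}.
  exact: (withinD (withinD (withinM wh cph) (withinZ (k := k) (withinM wh cch)))
    (withinZ (k := k ^+ 2 / 4) (withinM we cpe))).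
(* Phi is chosen so that Phi' = I - r (psi + k pe / 2)^2. Its boundary values have the right signs,
   since the relaxations vanish at 0 and psi vanishes at T. *)
pose Phi t := - (psi t ^+ 2 / 2) - psi t * ph t - k * (psi t * ch2 t) + k ^+ 2 / 8 * pe t ^+ 2.
have cPhi : {within `[0, T], continuous Phi}.
  have c1 : {within `[0, T], continuous (fun t => - (psi t ^+ 2 / 2))}.
    by move=> x; apply: cvgN; apply: cvgM; [apply: cvgM; exact: cpsi|exact: cvg_cst].
  exact: (withinD (withinB (withinB c1 (withinM cpsi cph)) (withinZ (k := k) (withinM cpsi cch)))
    (withinZ (k := k ^+ 2 / 8) (withinM cpe cpe))).
have -> : \int[mu]_(t in `[0, T]) I t = \int[mu]_(t in `[0, T]) I t - Phi T + Phi T by rewrite subrK.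
have PhiT : 0 <= Phi T.
  have psiT : psi T = 0 by rewrite /psi subrr mulr0.
  rewrite (_ : Phi T = k ^+ 2 / 8 * pe T ^+ 2); last by rewrite /Phi psiT; ring.
  by rewrite mulr_ge0 ?sqr_ge0// divr_ge0 ?sqr_ge0.
apply: addr_ge0 => //.
have Phi0 : Phi 0 <= 0.
  have ph0 : ph 0 = 0 by exact: relax0.
  have pe0 : pe 0 = 0 by exact: relax0.
  have ch20 : ch2 0 = 0 by rewrite /ch2 pe0 /ps relax0; ring.
  rewrite (_ : Phi 0 = - (psi 0 ^+ 2 / 2)); last by rewrite /Phi ph0 pe0 ch20; ring.
  by rewrite oppr_le0 divr_ge0 ?sqr_ge0.
apply: (@le_trans _ _ (\int[mu]_(t in `[0, 0]) I t - Phi 0)).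
  by rewrite set_itv1 Rintegral_set1 sub0r oppr_ge0.
apply: (@ge0_nondecreasing_itv R (fun t => \int[mu]_(s in `[0, t]) I s - Phi t)
  (fun t => r * (psi t + k / 2 * pe t) ^+ 2)) => //.
- by apply: withinB; [exact: continuous_Rintegral|exact: cPhi].
- move=> x xT.
  have d1 := is_derive_Rintegral cI xT.
  have d2 : is_derive x 1 ph (h x - r * ph x) by exact: is_derive_relax xT.
  have d3 : is_derive x 1 pe (e x - r * pe x) by exact: is_derive_relax xT.
  have d4 : is_derive x 1 ps (x * e x - r * ps x) by apply: (is_derive_relax r cse xT).
  have d5 : is_derive x 1 N (expR (- r * x) * h x) by exact: is_derive_Rintegral xT.
  have d6 := is_derive_expRl r x.
  have d7 : is_derive x 1 psi (r * psi x - h x).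
    apply: is_derive_eq; rewrite /psi /GRing.scale/=.
    transitivity (r * (expR (r * x) * (N T - N x)) - expR (r * x) * expR (- r * x) * h x).
      by ring.
    by rewrite -expRD mulNr subrr expR0 mul1r.
  have d8 : is_derive x 1 ch2 (r * pe x - r * ch2 x).
    by apply: is_derive_eq; rewrite /ch2 /GRing.scale/=; ring.
  by apply: is_derive_eq; rewrite /I /GRing.scale/=; field.
- by move=> x _; rewrite mulr_ge0 ?sqr_ge0.
Qed.

End ExponentialKernel.

(** * Fractional integrals and their action on power series in t^al *)

Section AbelKernel.
Context {R : realType}.
Notation mu := (@lebesgue_measure R).
Implicit Types (f g : R -> R) (a b s t x T : R) (c : R^nat).

(** Gamma(a) times the Riemann-Liouville integral J^a f, without the normalising factor. *)
Definition abel a f t : R := \int[mu]_(s in `[0, t]) ((t - s) `^ (a - 1) * f s).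

Lemma measurable_abel_kernel a t :
  measurable_fun setT (fun s : R => (t - s) `^ (a - 1)).
Proof.
have m : measurable_fun setT (fun s : R => t - s) by apply: measurable_funB.
exact: (measurableT_comp (measurable_powR (a - 1)) m).
Qed.

Lemma within_powR b T : 0 <= b -> {within `[0, T], continuous (@powR R ^~ b)}.
Proof.
rewrite le_eqVlt => /predU1P[<-|b0].
  rewrite (_ : (@powR R)^~ 0 = fun=> 1); last by apply/funext => x; rewrite powRr0.
  by apply: within_continuous => x; exact: cvg_cst.
apply: (@subspace_eq_continuous _ _ _ (fun x : R => Num.max 0 x `^ b)).
  by move=> x; rewrite inE/= in_itv/= => /andP[x0 _]; rewrite /= max_r.
by apply: within_continuous; exact: continuous_powR_max.
Qed.

(** This is [trunc_conv] with the truncations hidden: the two endpoints, where truncated and plain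
    powers may differ, form a null set. *)
Lemma integral_abel_powR a b t : 0 < a -> 0 <= b -> 0 < t ->
  (\int[mu]_(s in `[0%R, t]) ((t - s) `^ (a - 1) * s `^ b)%:E =
   (Gamma a * Gamma (b + 1) / Gamma (a + b + 1) * t `^ (a + b))%:E)%E.
Proof.
move=> a0 b0 t0.
have m : measurable_fun `]0, t[%classic (fun s : R => ((t - s) `^ (a - 1) * s `^ b)%:E).
  apply/measurable_EFinP; apply: measurable_funM; apply: measurable_funTS.
    exact: measurable_abel_kernel.
  exact: measurable_powR.
rewrite integral_itv_bndoo// [LHS]integral_mkcond.
have b1 : 0 < b + 1 by rewrite ltr_wpDl.
have := trunc_convE a0 b1 t0; rewrite !addrA addrK => <-.
apply: eq_integral => s _; rewrite patchE.
case: ifPn => [|].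
  rewrite inE/= in_itv/= => /andP[s0 st].
  by rewrite !trunc_powR_gt0 ?subr_gt0// addrK mulrC.
rewrite notin_setE/= in_itv/= => /negP; rewrite negb_and -!leNgt => /orP[s0|ts].
  by rewrite trunc_powR_le0 ?mul0r.
by rewrite [X in (_ * X)]trunc_powR_le0 ?mulr0// subr_le0.
Qed.

Lemma abel_kernel_integrable a t : 0 < a ->
  mu.-integrable `[0, t] (fun s => ((t - s) `^ (a - 1))%:E).
Proof.
move=> a0; have [t0|t0] := ltP 0 t; last first.
  have [t0'|t0'] := ltP t 0.
    by rewrite set_itv_ge ?bnd_simp -?ltNge//; exact: integrable_set0.
  rewrite (_ : t = 0) ?set_itv1; last by apply/eqP; rewrite eq_le t0 t0'.
  apply/integrableP; split; last by rewrite integral_set1.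
  by apply/measurable_EFinP; apply: measurable_funTS; exact: measurable_abel_kernel.
apply/integrableP; split.
  by apply/measurable_EFinP; apply: measurable_funTS; exact: measurable_abel_kernel.
have := integral_abel_powR a0 (lexx 0) t0.
under eq_integral do rewrite powRr0 mulr1.
under [in X in _ -> X]eq_integral do rewrite /= ger0_norm ?powR_ge0//.
by move=> ->; rewrite ltry.
Qed.

Lemma integral_abel_kernel a t : 0 < a -> 0 <= t ->
  (\int[mu]_(s in `[0%R, t]) ((t - s) `^ (a - 1))%:E = (t `^ a / a)%:E)%E.
Proof.
move=> a0; rewrite le_eqVlt => /predU1P[<-|t0].
  by rewrite set_itv1 integral_set1 powR0 ?gt_eqF// mul0r.
transitivity (\int[mu]_(s in `[0%R, t]) ((t - s) `^ (a - 1) * s `^ 0)%:E)%E.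
  by apply: eq_integral => s _; rewrite powRr0 mulr1.
rewrite integral_abel_powR// add0r addr0 GammaS// Gamma1; congr _%:E.
by field; rewrite !gt_eqF ?Gamma_gt0.
Qed.

Lemma continuous_itv_bounded f a b : {within `[a, b], continuous f} ->
  exists2 M, 0 <= M & forall x, a <= x <= b -> `|f x| <= M.
Proof.
move=> cf; have [ab|ba] := leP a b; last first.
  by exists 0 => // x /andP[ax xb]; move: (le_lt_trans (le_trans ax xb) ba); rewrite ltxx.
have cnf : {within `[a, b], continuous (fun x => `|f x|)}.
  by move=> x; apply: cvg_norm; exact: cf.
have [c _ H] := EVT_max ab cnf.
by exists `|f c| => // x xab; apply: H; rewrite in_itv.
Qed.

Lemma abel_integrable a f t : 0 < a -> {within `[0, t], continuous f} ->
  mu.-integrable `[0, t] (EFin \o (fun s => (t - s) `^ (a - 1) * f s)).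
Proof.
move=> a0 cf; have := integrableMl _ (abel_kernel_integrable t a0).
move=> /(_ (measurable_itv _) f); apply.
  apply/measurable_EFinP; apply: (measurable_int mu).
  exact: continuous_integrable.
have [M M0 H] := continuous_itv_bounded cf.
exists M; split; first exact: num_real.
by move=> x Mx s /=; rewrite in_itv/= => /H /le_trans; apply; exact: ltW.
Qed.

Lemma within_comp f g T : {within `[0, T], continuous f} -> continuous g ->
  {within `[0, T], continuous (fun x => g (f x))}.
Proof. by move=> cf cg x; apply: continuous_comp; [exact: cf|exact: cg]. Qed.

Lemma within_psum_powR al c T : 0 < al -> entire c ->
  {within `[0, T], continuous (fun s => psum c (- (s `^ al)))}.
Proof.
move=> al0 cc; apply: (@within_comp (fun s => - (s `^ al))); last exact: continuous_psum.
by move=> x; apply: cvgN; apply: within_powR; exact: ltW.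
Qed.

Lemma abelZ a f k t : 0 < a -> {within `[0, t], continuous f} ->
  abel a (fun s => k * f s) t = k * abel a f t.
Proof.
move=> a0 cf; rewrite /abel -RintegralZl//; last exact: abel_integrable.
by apply: eq_Rintegral => s _; rewrite mulrCA.
Qed.

Lemma abelD a f g t : 0 < a -> {within `[0, t], continuous f} ->
  {within `[0, t], continuous g} ->
  abel a (fun s => f s + g s) t = abel a f t + abel a g t.
Proof.
move=> a0 cf cg; rewrite /abel -RintegralD//; try exact: abel_integrable.
by apply: eq_Rintegral => s _; rewrite mulrDr.
Qed.

(* Termwise integration, by dominated convergence. *)
Lemma abel_psum al a c t : 0 < al -> 0 < a -> 0 < t -> entire c ->
  abel a (fun s => psum c (- (s `^ al))) t =
  t `^ a * psum (fun k => c k * (Gamma a * Gamma (al * k%:R + 1) / Gamma (al * k%:R + 1 + a)))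
    (- (t `^ al)).
Proof.
move=> al0 a0 t0 cc; set d := fun k => c k * _.
pose f_ n s := ((t - s) `^ (a - 1) * pseries c (- (s `^ al)) n)%:E.
pose f s := ((t - s) `^ (a - 1) * psum c (- (s `^ al)))%:E.
(* M bounds all partial sums on [[0, t]] at once, because s^al <= t^al there; M times the kernel is
   the dominating function. *)
pose M := psum (fun k => `|c k|) (t `^ al).
have mpal : measurable_fun setT (fun s : R => - (s `^ al)).
  by apply: measurable_funN; exact: measurable_powR.
have mf_ n : measurable_fun `[0, t] (f_ n).
  apply/measurable_EFinP; apply: measurable_funTS; apply: measurable_funM.
    exact: measurable_abel_kernel.
  apply: measurable_sum => k; apply: measurable_funM; first exact: measurable_cst.
  exact: (measurable_funX _ mpal).
have mf : measurable_fun `[0, t] f.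
  apply/measurable_EFinP; apply: measurable_funTS; apply: measurable_funM.
    exact: measurable_abel_kernel.
  apply: (measurable_fun_comp _ mpal).
  by apply: continuous_measurable_fun; exact: continuous_psum.
have ig : mu.-integrable `[0, t] (fun s => (M%:E * ((t - s) `^ (a - 1))%:E)%E).
  by apply: integrableZl => //; exact: abel_kernel_integrable.
have term s k : ((t - s) `^ (a - 1) * (c k * (- (s `^ al)) ^+ k))%:E =
    ((c k * (- 1) ^+ k)%:E * ((t - s) `^ (a - 1) * s `^ (al * k%:R))%:E)%E.
  by rewrite -EFinM; congr _%:E; rewrite powRrM powR_mulrn ?powR_ge0// [X in _ * (_ * X)]exprNn; ring.
have iterm k : mu.-integrable `[0, t] (EFin \o (fun s => (t - s) `^ (a - 1) * s `^ (al * k%:R))).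
  by apply: abel_integrable => //; apply: within_powR; rewrite mulr_ge0// ltW.
have If n : (\int[mu]_(s in `[0%R, t]) f_ n s)%E = (t `^ a * pseries d (- (t `^ al)) n)%:E.
  rewrite /f_ /pseries/= /series/=.
  under eq_integral do rewrite mulr_sumr -sumEFin.
  rewrite integral_sum//; last first.
    move=> k; rewrite (_ : (fun _ => _) = fun s =>
      ((c k * (- 1) ^+ k)%:E * ((t - s) `^ (a - 1) * s `^ (al * k%:R))%:E)%E); last first.
      by apply/funext => s; exact: term.
    by apply: integrableZl => //; exact: iterm.
  rewrite mulr_sumr -sumEFin; apply: eq_bigr => k _.
  under eq_integral do rewrite term.
  rewrite integralZl//; last exact: iterm.
  rewrite integral_abel_powR ?mulr_ge0 ?(ltW al0)// -EFinM; congr _%:E.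
  rewrite powRD; last by rewrite (gt_eqF t0) implybT.
  rewrite powRrM powR_mulrn ?powR_ge0// [in RHS]exprNn /d.
  rewrite (_ : a + al * k%:R + 1 = al * k%:R + 1 + a); last by ring.
  set G := (Gamma _)^-1; set q := _ ^+ k; set e := _ ^+ k.
  set G1 := Gamma a; set G2 := Gamma _; set p := t `^ a; ring.
have H : (\int[mu]_(s in `[0%R, t]) f_ n s)%E @[n --> \oo] --> (\int[mu]_(s in `[0%R, t]) f s)%E.
  apply: (@dominated_cvg _ _ _ mu _ _ f_ f (fun s => (M%:E * ((t - s) `^ (a - 1))%:E)%E)) => //.
  - move=> s _; apply: cvg_EFin; first exact: nearW.
    by apply: cvgM; [exact: cvg_cst|exact: cc].
  - move=> n s /=; rewrite in_itv/= => /andP[s0 st].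
    rewrite -EFinM lee_fin normrM ger0_norm ?powR_ge0// mulrC ler_wpM2r ?powR_ge0//.
    apply: pseries_norm_le => //; rewrite normrN ger0_norm ?powR_ge0//.
    by apply: ge0_ler_powR; rewrite ?nnegrE ?(ltW al0) ?(ltW t0).
have ff : (\int[mu]_(s in `[0%R, t]) f s)%E \is a fin_num.
  apply: integrable_fin_num => //.
  by apply: (@abel_integrable a (fun s => psum c (- (s `^ al)))) => //; exact: within_psum_powR.
move: H; under eq_fun do rewrite If.
rewrite -(fineK ff) => /fine_cvg; rewrite -/(abel a _ t); set v := abel _ _ _ => H'.
have ta : t `^ a != 0 by rewrite gt_eqF// powR_gt0.
have E : pseries d (- (t `^ al)) n @[n --> \oo] --> (t `^ a)^-1 * v.
  rewrite (_ : pseries _ _ = fun n => (t `^ a)^-1 * (t `^ a * pseries d (- (t `^ al)) n)).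
    by apply: cvgM; [exact: cvg_cst|exact: H'].
  by apply/funext => n; rewrite mulrA mulVf ?mul1r.
by rewrite /psum (cvg_lim _ E)// mulrA divff ?mul1r.
Qed.

End AbelKernel.

(** * Planar Lebesgue measure and integration over a triangle *)

Section PlanarLebesgue.
Context {R : realType}.
Notation mu := (@lebesgue_measure R).

Lemma leb2_sigma_finite : sigma_finite setT (@leb2 R).
Proof.
have /sigma_finiteP[F [TF ndF Foo]] := sigma_finiteT mu.
exists (fun n => F n `*` F n).
  rewrite -setXTT TF predeqE => -[x y]; split.
    move=> [/= [n _ Fnx] [k _ Fky]]; exists (maxn n k) => //; split.
    - by move: x Fnx; exact/subsetPset/ndF/leq_maxl.
    - by move: y Fky; exact/subsetPset/ndF/leq_maxr.
  by move=> [n _ []/= ? ?]; split; exists n.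
move=> k; have [mFk Fk] := Foo k; split; first exact: measurableX.
by rewrite /leb2 product_measure1E// lte_mul_pinfty// ge0_fin_numE.
Qed.

HB.instance Definition _ := Measure.on (@leb2 R).

(* Unification does not find the sigma-finiteness of the product measure
   through its generic instance. *)
HB.instance Definition _ := Measure_isSigmaFinite.Build _ _ _ (@leb2 R) leb2_sigma_finite.

End PlanarLebesgue.

Section Triangle.
Context {R : realType}.
Notation mu := (@lebesgue_measure R).
Implicit Types (T : R) (G : R * R -> R).
Local Open Scope ereal_scope.

(** The pair is (t, s). The strict inequality s < t keeps t - s positive, where the exponential
    representation of (t - s)^(b-1) holds. *)
Definition triangle T : set (R * R) := [set p | (0 <= p.2)%R /\ (p.2 < p.1)%R /\ (p.1 <= T)%R].

Lemma measurable_triangle T : measurable (triangle T).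
Proof.
have m1 : measurable ([set: R * R] `&` (fun p => (0 <= p.2)%R) @^-1` [set true]).
  by apply: measurable_fun_le => //; exact: measurable_cst.
have m2 : measurable ([set: R * R] `&` (fun p => (p.2 < p.1)%R) @^-1` [set true]).
  by apply: measurable_fun_ltr.
have m3 : measurable ([set: R * R] `&` (fun p => (p.1 <= T)%R) @^-1` [set true]).
  by apply: measurable_fun_le => //; exact: measurable_cst.
apply: (eq_ind _ measurable (measurableI _ _ m1 (measurableI _ _ m2 m3))).
apply/seteqP; split=> p; rewrite /triangle/=; last by move=> [-> [-> ->]].
by move=> [[_ ->] [[_ ->] [_ ->]]].
Qed.

Lemma integral_triangle_section T G t : measurable_fun setT G ->
  \int[mu]_s (\1_(triangle T) (t, s) * G (t, s))%:E =
  ((fun t => \int[mu]_(s in `[0%R, t]) (G (t, s))%:E) \_ `[0%R, T]) t.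
Proof.
move=> mG; rewrite patchE; case: ifPn => [|].
  rewrite inE/= in_itv/= => /andP[t0 tT].
  rewrite -integral_itv_bndo_bndc; last first.
    apply/measurable_EFinP; apply: measurable_funTS.
    exact: (measurableT_comp mG (measurable_pair1 t)).
  rewrite [RHS]integral_mkcond; apply: eq_integral => s _; rewrite patchE indicE.
  case: ifPn => [|].
    rewrite inE/= in_itv/= => /andP[s0 st].
    by rewrite mem_set ?mul1r//; split => //=.
  rewrite notin_setE/= in_itv/= => H; rewrite memNset ?mul0r//.
  by move=> [/= s0 [st _]]; apply: H; rewrite s0.
rewrite notin_setE/= in_itv/= => H; apply: integral0_eq => s _.
rewrite indicE memNset ?mul0r//= => -[/= s0 [st tT]]; apply: H.
by rewrite tT andbT (le_trans s0)// ltW.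
Qed.

Lemma integral_triangle T G : measurable_fun setT G ->
  leb2.-integrable setT (fun p => (\1_(triangle T) p * G p)%:E) ->
  \int[leb2]_p (\1_(triangle T) p * G p)%:E =
  \int[mu]_(t in `[0%R, T]) \int[mu]_(s in `[0%R, t]) (G (t, s))%:E.
Proof.
move=> mG iG; rewrite -(integral12_prod_meas1 iG) [RHS]integral_mkcond.
by apply: eq_integral => t _; exact: integral_triangle_section.
Qed.

Lemma ge0_integral_triangle T G : measurable_fun setT G -> (forall p, (0 <= G p)%R) ->
  \int[leb2]_p (\1_(triangle T) p * G p)%:E =
  \int[mu]_(t in `[0%R, T]) \int[mu]_(s in `[0%R, t]) (G (t, s))%:E.
Proof.
move=> mG G0; rewrite (@fubini_tonelli1 _ _ _ _ R mu mu); last 2 first.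
- apply/measurable_EFinP/measurable_funM => //.
  by apply: measurable_indic; exact: measurable_triangle.
- by move=> p; rewrite lee_fin mulr_ge0.
rewrite [RHS]integral_mkcond.
by apply: eq_integral => t _; exact: integral_triangle_section.
Qed.

Lemma triangle_finite T : leb2 (triangle T) < +oo.
Proof.
have H : triangle T `<=` `[0%R, T] `*` `[0%R, T].
  move=> [t s] [/= s0 [st tT]]; split; rewrite /= in_itv/=.
    by rewrite tT (le_trans s0)// ltW.
  by rewrite s0 (le_trans _ tT)// ltW.
apply: (@le_lt_trans _ _ (leb2 (`[0%R, T] `*` `[0%R, T]))).
  apply: le_measure => //; rewrite inE.
    exact: measurable_triangle.
  by apply: measurableX.
rewrite /leb2 product_measure1E//.
have [c Ec] : exists c : R, mu `[0%R, T]%classic = c%:E.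
  by rewrite lebesgue_measure_itv/=; case: ifPn => _; eexists; rewrite -?EFinB.
by rewrite [X in X * _]Ec [X in _ * X]Ec -EFinM ltry.
Qed.

End Triangle.

(** * The Abel kernel as a superposition of exponentials *)

Section AbelPositivity.
Context {R : realType}.
Notation mu := (@lebesgue_measure R).
Notation mR := (measurableTypeR R).
Notation mu2 := (@leb2 R).
Variables (b T k : R) (h e : R -> R).
Hypotheses (b01 : 0 < b < 1) (T0 : 0 <= T) (ch : continuous h) (ce : continuous e).

Let K1 (p : mR * mR) := h p.1 * h p.2 + k ^+ 2 / 4 * (e p.1 * e p.2).
Let K2 (p : mR * mR) := k * (h p.1 * e p.2).
Let D (p : mR * mR) : R := p.1 - p.2.
Let tr : set (mR * mR) := @triangle R T.

(** The integrand of the superposition, in the variables ((t, s), r). Integrating in r first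
    produces the kernel (t - s)^(b-1) on the triangle; integrating in (t, s) first produces a
    nonnegative multiple of the form at rate r. *)
Let F (q : (mR * mR) * mR) : R := \1_tr q.1 *
  (trunc_powR (1 - b) q.2 * expR (- (D q.1 * q.2)) * K1 q.1 +
   trunc_powR (2 - b) q.2 * expR (- (D q.1 * q.2)) * (D q.1 * K2 q.1)).

Let mh : measurable_fun [set: mR] h. Proof. exact: continuous_measurable_fun. Qed.
Let me : measurable_fun [set: mR] e. Proof. exact: continuous_measurable_fun. Qed.

Let mprod (f g : mR -> R) : measurable_fun setT f -> measurable_fun setT g ->
  measurable_fun setT (fun p : mR * mR => f p.1 * g p.2).
Proof.
move=> mf mg; apply: measurable_funM.
  exact: (measurable_fun_comp_fst mf).
exact: (measurable_fun_comp_snd mg).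
Qed.

Let mK1 : measurable_fun setT K1.
Proof.
apply: measurable_funD; first exact: mprod.
by apply: measurable_funM; [exact: measurable_cst|exact: mprod].
Qed.

Let mK2 : measurable_fun setT K2.
Proof. by apply: measurable_funM; [exact: measurable_cst|exact: mprod]. Qed.

Let mD : measurable_fun setT D.
Proof. by apply: measurable_funB; [exact: measurable_fst|exact: measurable_snd]. Qed.

Let mtr : measurable_fun setT (\1_tr : mR * mR -> R).
Proof. by apply: measurable_indic; exact: measurable_triangle. Qed.

Let mexpDr : measurable_fun setT (fun q : (mR * mR) * mR => expR (- (D q.1 * q.2))).
Proof.
have m : measurable_fun setT (fun q : (mR * mR) * mR => D q.1 * q.2).
  by apply: measurable_funM; [exact: (measurable_fun_comp_fst mD)|exact: measurable_snd].
exact: (measurableT_comp (@measurable_expRN R) m).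
Qed.

Let mF : measurable_fun setT F.
Proof.
apply: measurable_funM; first exact: (measurable_fun_comp_fst mtr).
apply: measurable_funD.
  apply: measurable_funM; last exact: (measurable_fun_comp_fst mK1).
  apply: measurable_funM => //.
  exact: (measurable_fun_comp_snd (@measurable_trunc_powR R (1 - b))).
apply: measurable_funM; last first.
  by apply: (@measurable_fun_comp_fst _ _ _ _ _ _ (fun p => D p * K2 p)); exact: measurable_funM.
apply: measurable_funM => //.
exact: (measurable_fun_comp_snd (@measurable_trunc_powR R (2 - b))).
Qed.

Let exM : exists2 M : R, 0 <= M & forall p, tr p -> `|K1 p| <= M /\ `|K2 p| <= M.
Proof.
have [Mh Mh0 Hh] := @continuous_itv_bounded R h 0 T (within_continuous ch).
have [Me Me0 He] := @continuous_itv_bounded R e 0 T (within_continuous ce).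
exists ((Mh * Mh + k ^+ 2 / 4 * (Me * Me)) + `|k| * (Mh * Me)).
  rewrite addr_ge0//; last by rewrite mulr_ge0// mulr_ge0.
  have k0 : 0 <= k ^+ 2 / 4 by rewrite divr_ge0 ?sqr_ge0.
  by apply: addr_ge0; [exact: mulr_ge0|apply: mulr_ge0 => //; exact: mulr_ge0].
move=> [t s] [/= s0 [st tT]].
set M1 := Mh * Mh + _; set M2 := `|k| * _.
have M10 : 0 <= M1 by apply: addr_ge0; [exact: mulr_ge0|rewrite mulr_ge0 ?divr_ge0 ?sqr_ge0 ?mulr_ge0].
have M20 : 0 <= M2 by rewrite mulr_ge0 ?mulr_ge0.
have tI : 0 <= t <= T by rewrite tT (le_trans s0)// ltW.
have sI : 0 <= s <= T by rewrite s0 (le_trans _ tT)// ltW.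
have k0 : 0 <= k ^+ 2 / 4 by rewrite divr_ge0 ?sqr_ge0.
split.
  rewrite (@le_trans _ _ M1)// ?lerDl//.
  rewrite /K1/= (le_trans (ler_normD _ _))// lerD//.
    by rewrite normrM ler_pM// ?Hh.
  by rewrite normrM (ger0_norm k0) ler_wpM2l// normrM ler_pM// ?He.
rewrite (@le_trans _ _ M2)// ?lerDr//.
by rewrite /K2 normrM ler_wpM2l// normrM ler_pM ?Hh ?He.
Qed.

Let b0 : 0 < b. Proof. by have /andP[] := b01. Qed.
Let b1 : 0 < 1 - b. Proof. by have /andP[_] := b01; rewrite subr_gt0. Qed.
Let b2 : 0 < 2 - b. Proof. by move: b01 => /andP[_ ?]; lra. Qed.

Let Lap1 p : tr p ->
  (\int[mu]_r (trunc_powR (1 - b) r * expR (- (D p * r)))%:E =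
  (Gamma (1 - b) * D p `^ (b - 1))%:E)%E.
Proof.
move=> [_ [st _]]; have D0 : 0 < D p by rewrite subr_gt0.
rewrite (integral_powR_expR b1 D0).
by congr (_ * powR _ _)%:E; ring.
Qed.

Let Lap2 p : tr p ->
  (\int[mu]_r (trunc_powR (2 - b) r * expR (- (D p * r)))%:E =
  (Gamma (2 - b) * D p `^ (b - 2))%:E)%E.
Proof.
move=> [_ [st _]]; have D0 : 0 < D p by rewrite subr_gt0.
rewrite (integral_powR_expR b2 D0).
by congr (_ * powR _ _)%:E; ring.
Qed.

(** Gamma(2 - b) = (1 - b) Gamma(1 - b): this is where the factor 1 - b in the cross term of the
    form comes from. *)
Let GammaD p : tr p -> Gamma (2 - b) * D p `^ (b - 2) * D p = (1 - b) * (Gamma (1 - b) * D p `^ (b - 1)).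
Proof.
move=> [_ [st _]]; have D0 : 0 < D p by rewrite subr_gt0.
rewrite (_ : 2 - b = 1 - b + 1); last by ring.
rewrite GammaS// -!mulrA; congr (_ * (_ * _)).
rewrite -[X in _ * X = _](powRr1 (ltW D0)) -powRD; last by rewrite (gt_eqF D0) implybT.
by congr powR; ring.
Qed.

Let ik a p : 0 < a -> tr p ->
  mu.-integrable setT (fun r => (trunc_powR a r * expR (- (D p * r)))%:E).
Proof.
move=> a0 [_ [st _]]; have D0 : 0 < D p by rewrite subr_gt0.
apply/integrableP; split.
  apply/measurable_EFinP/measurable_funM; first exact: measurable_trunc_powR.
  have m : measurable_fun setT (fun r : R => D p * r).
    by apply: measurable_funM; [exact: measurable_cst|exact: measurable_id].
  exact: (measurableT_comp (@measurable_expRN R) m).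
under eq_integral do rewrite gee0_abs ?lee_fin ?mulr_ge0 ?expR_ge0 ?trunc_powR_ge0//.
by rewrite integral_powR_expR// ltry.
Qed.

Let intFr p : (\int[mu]_r (F (p, r))%:E =
  (\1_tr p * (Gamma (1 - b) * (D p `^ (b - 1) * (K1 p + (1 - b) * K2 p))))%:E)%E.
Proof.
rewrite /F/= indicE; have [ptr|ptr] := pselect (tr p); last first.
  rewrite memNset// mul0r; under eq_integral do rewrite mul0r.
  by rewrite integral0.
rewrite mem_set// mul1r; under eq_integral do rewrite mul1r.
have i1 := ik b1 ptr; have i2 := ik b2 ptr.
under eq_integral do rewrite EFinD (EFinM _ (K1 p)) (EFinM _ (D p * K2 p)) (muleC _ (K1 p)%:E) (muleC _ (D p * K2 p)%:E).
rewrite integralD//; try exact: integrableZl.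
rewrite !integralZl// Lap1// Lap2// -!EFinM -EFinD; congr _%:E.
by rewrite (mulrC (D p)) -mulrA (mulrC (D p)) GammaD//; ring.
Qed.

(** F changes sign, so Fubini's theorem needs absolute integrability. Bounding K1 and K2 by M leaves
    the kernel (t - s)^(b-1), whose integral over the triangle is finite. *)
Let Fint : (mu2 \x mu)%E.-integrable setT (EFin \o F).
Proof.
have mEF : measurable_fun setT (EFin \o F) by exact/measurable_EFinP.
have [_ Hlty] := @integrable12ltyP _ _ (mR * mR)%type mR R mu2 mu (EFin \o F) mEF.
apply: Hlty.
have [M M0 HM] := exM.
(* 2 - b = 1 + (1 - b): the two Laplace transforms contribute Gamma(1 - b) and Gamma(2 - b) = (1 -
   b) Gamma(1 - b). *)
pose C := M * (2 - b) * Gamma (1 - b).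
have C0 : 0 <= C by exact: mulr_ge0 (mulr_ge0 M0 (ltW b2)) (ltW (Gamma_gt0 b1)).
apply: (@le_lt_trans _ _ (\int[mu2]_p (\1_tr p * (C * D p `^ (b - 1)))%:E)%E).
  apply: ge0_le_integral => //.
  - by move=> p _; apply: integral_ge0.
  - apply: (@measurable_fun_fubini_tonelli_F _ _ (mR * mR)%type mR R mu (fun q => `|(F q)%:E|%E)) => //.
    by apply: measurableT_comp.
  - apply/measurable_EFinP/measurable_funM => //; apply: measurable_funM; first exact: measurable_cst.
    exact: (measurableT_comp (measurable_powR (b - 1)) mD).
  move=> p _; rewrite indicE; have [ptr|ptr] := pselect (tr p); last first.
    rewrite memNset// mul0r integral0_eq// => r _.
    by rewrite /F/= indicE memNset// mul0r normr0.
  have D0 : 0 < D p by case: ptr => _ [st _]; rewrite subr_gt0.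
  have [HK1 HK2] := HM p ptr.
  have i1 := ik b1 ptr; have i2 := ik b2 ptr.
  rewrite mem_set// mul1r.
  apply: (@le_trans _ _ (\int[mu]_r ((M%:E * (trunc_powR (1 - b) r * expR (- (D p * r)))%:E) +
     ((M * D p)%:E * (trunc_powR (2 - b) r * expR (- (D p * r)))%:E)))%E).
    apply: ge0_le_integral => //.
    - apply: measurableT_comp => //; apply/measurable_EFinP.
      exact: (measurableT_comp mF (measurable_pair1 p)).
    - apply: (measurable_int mu); apply: integrableD => //; exact: integrableZl.
    move=> r _; rewrite /F/= indicE mem_set// mul1r -!EFinM -EFinD lee_fin.
    rewrite (le_trans (ler_normD _ _))// lerD//.
      rewrite normrM mulrC (ger0_norm (mulr_ge0 (trunc_powR_ge0 _ _) (expR_ge0 _))).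
      by rewrite ler_wpM2r// mulr_ge0 ?trunc_powR_ge0 ?expR_ge0.
    rewrite normrM mulrC (ger0_norm (mulr_ge0 (trunc_powR_ge0 _ _) (expR_ge0 _))).
    rewrite ler_wpM2r// ?mulr_ge0 ?trunc_powR_ge0 ?expR_ge0//.
    by rewrite normrM (gtr0_norm D0) mulrC ler_wpM2r// ltW.
  rewrite integralD//; try exact: integrableZl.
  rewrite !integralZl// Lap1// Lap2// -!EFinM -EFinD lee_fin.
  rewrite (_ : M * D p * (Gamma (2 - b) * D p `^ (b - 2)) =
    M * (Gamma (2 - b) * D p `^ (b - 2) * D p)); last by ring.
  by rewrite GammaD// /C le_eqVlt; apply/orP; left; apply/eqP; ring.
rewrite ge0_integral_triangle; last 2 first.
- apply: measurable_funM; first exact: measurable_cst.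
  exact: (measurableT_comp (measurable_powR (b - 1)) mD).
- by move=> p; rewrite mulr_ge0 ?powR_ge0.
have -> : (\int[mu]_(t in `[0%R, T]) \int[mu]_(s in `[0%R, t]) (C * D (t, s) `^ (b - 1))%:E =
    \int[mu]_(t in `[0%R, T]) (C * (t `^ b / b))%:E)%E.
  apply: eq_integral => t; rewrite inE/= in_itv/= => /andP[t0 _].
  under eq_integral do rewrite EFinM.
  by rewrite integralZl//; [rewrite integral_abel_kernel|exact: abel_kernel_integrable].
have cT : {within `[0, T], continuous (fun t => C * (t `^ b / b))}.
  apply: withinZ => x; apply: cvgM; last exact: cvg_cst.
  by apply: within_powR; exact: ltW.
have /integrableP[_] := continuous_integrable cT.
apply: le_lt_trans; rewrite le_eqVlt; apply/orP; left; apply/eqP.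
apply: eq_integral => t _; rewrite /= ger0_norm// mulr_ge0// divr_ge0 ?powR_ge0//.
exact: ltW.
Qed.

Let H r (p : mR * mR) := expR (- (D p * r)) * K1 p + r * D p * expR (- (D p * r)) * K2 p.

Let mH r : measurable_fun setT (H r).
Proof.
have m : measurable_fun setT (fun p : mR * mR => expR (- (D p * r))).
  apply: (measurableT_comp (@measurable_expRN R) _).
  by apply: measurable_funM => //; exact: measurable_cst.
apply: measurable_funD; apply: measurable_funM => //.
apply: measurable_funM => //; apply: measurable_funM => //; exact: measurable_cst.
Qed.

Let FH r p : 0 < r -> F (p, r) = \1_tr p * (trunc_powR (1 - b) r * H r p).
Proof.
move=> r0; rewrite /F/= (_ : trunc_powR (2 - b) r = r * trunc_powR (1 - b) r).
  by congr (_ * _); rewrite /H; ring.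
rewrite !trunc_powR_gt0// -[X in _ = X * _](powRr1 (ltW r0)) -powRD; last first.
  by rewrite (gt_eqF r0) implybT.
by congr powR; ring.
Qed.

Let iH r : 0 < r ->
  mu2.-integrable setT (fun p => (\1_tr p * (trunc_powR (1 - b) r * H r p))%:E).
Proof.
move=> r0; have [M M0 HM] := exM; set w := trunc_powR _ r.
have w0 : 0 <= w by exact: trunc_powR_ge0.
pose C := w * (M + r * T * M).
have C0 : 0 <= C by rewrite mulr_ge0// addr_ge0// !mulr_ge0// ltW.
have mC : measurable_fun setT (fun p : mR * mR => (\1_tr p * C)%:E).
  by apply/measurable_EFinP/measurable_funM => //; exact: measurable_cst.
apply: (@le_integrable _ _ _ mu2 setT _ _ (fun p => (\1_tr p * C)%:E)) => //.
- apply/measurable_EFinP/measurable_funM => //; apply: measurable_funM => //; exact: measurable_cst.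
- move=> p _; rewrite lee_fin indicE; have [ptr|ptr] := pselect (tr p); last first.
    by rewrite memNset// !mul0r normr0.
  rewrite mem_set// !mul1r normrM (ger0_norm w0) (ger0_norm C0) ler_wpM2l//.
  have [HK1 HK2] := HM p ptr; have D0 : 0 <= D p by case: ptr => _ [st _]; rewrite subr_ge0 ltW.
  have DT : D p <= T.
    case: ptr => [s0 [_ tT]]; rewrite /D lerBlDr (le_trans tT)// lerDl//.
  have e1 : expR (- (D p * r)) <= 1 by rewrite expR_le1 oppr_le0 mulr_ge0// ltW.
  rewrite (le_trans (ler_normD _ _))// lerD//.
    rewrite normrM (ger0_norm (expR_ge0 _)) -[leRHS]mul1r ler_pM// expR_ge0//.
  move: (K2 p) HK2 => K HK2.
  rewrite !normrM (gtr0_norm r0) (ger0_norm D0) (ger0_norm (expR_ge0 _)).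
  rewrite ler_pM ?mulr_ge0 ?(ltW r0) ?expR_ge0//.
  rewrite -[leRHS]mulr1 ler_pM ?mulr_ge0 ?(ltW r0) ?expR_ge0//.
  by rewrite ler_wpM2l// ltW.
- rewrite (_ : (fun p => _) = fun p => (C%:E * (\1_tr p)%:E)%E); last first.
    by apply/funext => p; rewrite -EFinM mulrC.
  apply: integrableZl => //; apply/integrableP; split; first exact/measurable_EFinP.
  rewrite (eq_integral (fun p => (\1_tr p)%:E)); last first.
    by move=> p _; rewrite gee0_abs// lee_fin.
  rewrite integral_indic ?setIT//; last exact: measurable_triangle.
  exact: triangle_finite.
Qed.

Let I r t := h t * relax r h t + k * (h t * relax2 r e t) + k ^+ 2 / 4 * (e t * relax r e t).

Let wh : {within `[0, T], continuous h}. Proof. exact: within_continuous. Qed.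
Let we : {within `[0, T], continuous e}. Proof. exact: within_continuous. Qed.

Let cI r : {within `[0, T], continuous (I r)}.
Proof.
have cse : continuous (fun s : R => s * e s).
  by move=> x; apply: cvgM; [exact: cvg_id|exact: ce].
have c1 := @continuous_relax R r h T T0 ch.
have c2 := @continuous_relax R r e T T0 ce.
have c3 := @continuous_relax R r _ T T0 cse.
have wid := @within_continuous R _ 0 T (fun x => @cvg_id R (nbhs x)).
have c4 : {within `[0, T], continuous (relax2 r e)}.
  have -> : relax2 r e = fun t => r * (t * relax r e t - relax r (fun s => s * e s) t).
    by apply/funext => t; exact: relax2E.
  exact: (withinZ (withinB (withinM wid c2) c3)).
exact: (withinD (withinD (withinM wh c1) (withinZ (withinM wh c4))) (withinZ (withinM we c2))).
Qed.

Let Hsection r t : 0 < r -> 0 <= t <= T ->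
  (\int[mu]_(s in `[0%R, t]) (trunc_powR (1 - b) r * H r (t, s))%:E =
  (trunc_powR (1 - b) r * I r t)%:E)%E.
Proof.
move=> r0 /andP[t0 tT].
have cexpD : continuous (fun s : R => expR (- r * (t - s))).
  move=> x; apply: (@continuous_comp _ _ _ (fun s : R => - r * (t - s))); last exact: continuous_expR.
  by apply: cvgM; [exact: cvg_cst|apply: cvgB; [exact: cvg_cst|exact: cvg_id]].
have crD : continuous (fun s : R => r * (t - s) * expR (- r * (t - s))).
  move=> x; apply: cvgM; last exact: cexpD.
  by apply: cvgM; [exact: cvg_cst|apply: cvgB; [exact: cvg_cst|exact: cvg_id]].
have i1 : mu.-integrable `[0, t] (EFin \o (fun s => expR (- r * (t - s)) * h s)).
  by apply: continuous_integrable; apply: within_continuous => x; apply: cvgM; [exact: cexpD|exact: ch].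
have i2 : mu.-integrable `[0, t] (EFin \o (fun s => r * (t - s) * expR (- r * (t - s)) * e s)).
  by apply: continuous_integrable; apply: within_continuous => x; apply: cvgM; [exact: crD|exact: ce].
have i3 : mu.-integrable `[0, t] (EFin \o (fun s => expR (- r * (t - s)) * e s)).
  by apply: continuous_integrable; apply: within_continuous => x; apply: cvgM; [exact: cexpD|exact: ce].
set w := trunc_powR _ r.
transitivity (\int[mu]_(s in `[0%R, t]) ((w * h t)%:E * (expR (- r * (t - s)) * h s)%:E +
   ((w * k * h t)%:E * (r * (t - s) * expR (- r * (t - s)) * e s)%:E +
    (w * (k ^+ 2 / 4) * e t)%:E * (expR (- r * (t - s)) * e s)%:E)))%E.
  apply: eq_integral => s _; rewrite -!EFinM -!EFinD; congr _%:E.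
  rewrite /H /K1 /K2 /D/= (_ : - ((t - s) * r) = - r * (t - s)); last by ring.
  by field.
rewrite integralD//; [|exact: integrableZl|by apply: integrableD => //; exact: integrableZl].
rewrite integralD//; try exact: integrableZl.
rewrite !integralZl// -(fineK (integrable_fin_num _ i1))// -(fineK (integrable_fin_num _ i2))//.
rewrite -(fineK (integrable_fin_num _ i3))// -!EFinM -!EFinD; congr _%:E.
rewrite -[fine _]/(relax r h t) -[X in _ + (_ * X + _)]/(relax2 r e t) -[X in _ + (_ + _ * X)]/(relax r e t).
by rewrite /I; field.
Qed.

Let intF_ge0 r : (0 <= \int[mu2]_p (F (p, r))%:E)%E.
Proof.
have [r0|r0] := ltP 0 r; last first.
  apply: integral_ge0 => p _; rewrite /F/= !trunc_powR_le0//.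
  by rewrite !mul0r addr0 mulr0.
have w0 : 0 <= trunc_powR (1 - b) r by exact: trunc_powR_ge0.
under eq_integral do rewrite FH//.
have mw : measurable_fun setT (fun p => trunc_powR (1 - b) r * H r p).
  by apply: measurable_funM => //; exact: measurable_cst.
rewrite (integral_triangle mw (iH r0)).
have -> : (\int[mu]_(t in `[0%R, T]) \int[mu]_(s in `[0%R, t]) (trunc_powR (1 - b) r * H r (t, s))%:E =
    \int[mu]_(t in `[0%R, T]) ((trunc_powR (1 - b) r)%:E * (I r t)%:E))%E.
  by apply: eq_integral => t; rewrite inE/= in_itv/= => tT; rewrite Hsection// EFinM.
have iI := continuous_integrable (@cI r).
rewrite integralZl// mule_ge0// -(fineK (integrable_fin_num _ iI))// lee_fin.
exact: relax_form_ge0 (ltW r0) T0 ch ce.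
Qed.

Let J t := h t * abel b h t + (1 - b) * k * (h t * abel b e t) + k ^+ 2 / 4 * (e t * abel b e t).

Let G (p : mR * mR) := Gamma (1 - b) * (D p `^ (b - 1) * (K1 p + (1 - b) * K2 p)).

Let mG : measurable_fun setT G.
Proof.
apply: measurable_funM; first exact: measurable_cst.
apply: measurable_funM; first exact: (measurableT_comp (measurable_powR (b - 1)) mD).
apply: measurable_funD => //; apply: measurable_funM => //; exact: measurable_cst.
Qed.

Let iG : mu2.-integrable setT (fun p => (\1_tr p * G p)%:E).
Proof.
have := @integrable_fubini_F _ _ (mR * mR)%type mR R mu2 mu _ Fint.
by rewrite (_ : fubini_F _ _ = fun p => (\1_tr p * G p)%:E)//; apply/funext => p; exact: intFr.
Qed.

Let Gsection t : 0 <= t <= T ->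
  (\int[mu]_(s in `[0%R, t]) (G (t, s))%:E = (Gamma (1 - b) * J t)%:E)%E.
Proof.
move=> /andP[t0 tT].
have wht : {within `[0, t], continuous h} by exact: within_continuous.
have wet : {within `[0, t], continuous e} by exact: within_continuous.
have i1 := abel_integrable b0 wht; have i2 := abel_integrable b0 wet.
transitivity (\int[mu]_(s in `[0%R, t]) ((Gamma (1 - b) * h t)%:E * ((t - s) `^ (b - 1) * h s)%:E +
  (Gamma (1 - b) * ((1 - b) * k * h t + k ^+ 2 / 4 * e t))%:E * ((t - s) `^ (b - 1) * e s)%:E))%E.
  apply: eq_integral => s _; rewrite -!EFinM -!EFinD; congr _%:E.
  by rewrite /G /K1 /K2 /D/=; field.
rewrite integralD//; try exact: integrableZl.
rewrite !integralZl// -(fineK (integrable_fin_num _ i1))// -(fineK (integrable_fin_num _ i2))//.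
rewrite -!EFinM -!EFinD; congr _%:E.
by rewrite -[fine _]/(abel b h t) -[X in _ + _ * X]/(abel b e t) /J; field.
Qed.

(* Sectoriality of the Volterra form of the kernel x^(b-1): by
   Gamma(1-b) x^(b-1) = int r^(-b) e^(-r x) dr and
   Gamma(2-b) x^(b-1) = int r^(1-b) x e^(-r x) dr it is a superposition of the forms of
   [relax_form_ge0]. *)
Lemma abel_form_ge0 : 0 <= \int[mu]_(t in `[0, T]) J t.
Proof.
have g0 : 0 < Gamma (1 - b) by exact: Gamma_gt0.
have iJ : mu.-integrable `[0, T] (fun t => (Gamma (1 - b) * J t)%:E).
  have := @integrable_fubini_F _ _ mR mR R mu mu _ iG.
  move=> iJ; apply/(integrable_mkcond _ _).2 => //; apply: eq_integrable iJ => // t _.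
  rewrite /fubini_F integral_triangle_section// !patchE.
  by case: ifPn => //; rewrite inE/= in_itv/= => tT; rewrite Gsection.
have /(fine_ge0) : (0 <= \int[mu]_(t in `[0%R, T]) (Gamma (1 - b) * J t)%:E)%E.
  have -> : (\int[mu]_(t in `[0%R, T]) (Gamma (1 - b) * J t)%:E =
    \int[mu2]_p (\1_tr p * G p)%:E)%E.
    rewrite integral_triangle//; apply: eq_integral => t.
    by rewrite inE/= in_itv/= => tT; rewrite Gsection.
  have -> : (\int[mu2]_p (\1_tr p * G p)%:E = \int[mu2]_p \int[mu]_r (F (p, r))%:E)%E.
    by apply: eq_integral => p _; rewrite intFr.
  rewrite (@integral12_prod_meas1 _ _ (mR * mR)%type mR R mu2 mu _ Fint).
  rewrite -(@integral21_prod_meas1 _ _ (mR * mR)%type mR R mu2 mu _ Fint).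
  by apply: integral_ge0 => r _; exact: intF_ge0.
have -> : fine (\int[mu]_(t in `[0%R, T]) (Gamma (1 - b) * J t)%:E) =
    Gamma (1 - b) * \int[mu]_(t in `[0, T]) J t.
  rewrite -RintegralZl//.
  have iJ' : mu.-integrable `[0, T] (fun t => ((Gamma (1 - b))^-1%:E * (Gamma (1 - b) * J t)%:E)%E).
    exact: integrableZl.
  apply: eq_integrable iJ' => // t _; rewrite -EFinM; congr _%:E.
  by rewrite mulrA mulVf ?mul1r// gt_eqF.
by rewrite pmulr_rge0.
Qed.

End AbelPositivity.

(** * Mittag-Leffler functions on the negative axis *)

Section AbelIncrement.
Context {R : realType}.
Notation mu := (@lebesgue_measure R).
Implicit Types (v : R -> R) (a t L T : R).

(** As a <= 1 the kernel (t - s)^(a-1) decreases in t, so the part of the integral over [[0, T - L]]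
    can only drop; the gain comes from []T - L, T]], where v <= 2. *)
Let abel_increment_ub a v T L : 0 < a <= 1 -> 0 < L <= T ->
  {within `[0, T], continuous v} -> (forall s, 0 <= s <= T -> 0 <= v s <= 2) ->
  abel a v T - abel a v (T - L) <= 2 * (L `^ a / a).
Proof.
move=> /andP[a0 a1] /andP[L0 LT] cv v2.
have T0 : 0 < T by exact: lt_le_trans LT.
have r0 : 0 <= T - L by rewrite subr_ge0.
have rT : T - L <= T by rewrite gerBl ltW.
have sub : `[0, T - L] `<=` `[0, T] by apply: subset_itvl; rewrite bnd_simp.
have cvr : {within `[0, T - L], continuous v} by exact: continuous_subspaceW cv.
have iT := abel_integrable a0 cv; have ir := abel_integrable a0 cvr.
have iTr : mu.-integrable `[0, T - L] (EFin \o (fun s => (T - s) `^ (a - 1) * v s)).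
  exact: integrableS iT.
have sub2 : `]T - L, T] `<=` `[0, T].
  by move=> s /=; rewrite !in_itv/= => /andP[sr ->]; rewrite andbT (le_trans r0)// ltW.
have iK : mu.-integrable `[0, T] (EFin \o (fun s => (T - s) `^ (a - 1))) by exact: abel_kernel_integrable.
have bo : (BLeft 0 <= BRight (T - L))%O by rewrite bnd_simp.
have bo2 : (BRight (T - L) <= BRight T)%O by rewrite bnd_simp.
have sp := Rintegral_itvB iT bo bo2.
have spK := Rintegral_itvB iK bo bo2.
have kT : \int[mu]_(s in `[0, T]) (T - s) `^ (a - 1) = T `^ a / a.
  by rewrite /Rintegral integral_abel_kernel// ltW.
have H1 : \int[mu]_(s in `[0, T - L]) ((T - s) `^ (a - 1) * v s) <= abel a v (T - L).
  have io : mu.-integrable `[0, T - L[ (EFin \o (fun s => (T - s) `^ (a - 1) * v s)).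
    by apply: integrableS iTr => //; apply: subset_itvl; rewrite bnd_simp.
  have ior : mu.-integrable `[0, T - L[ (EFin \o (fun s => (T - L - s) `^ (a - 1) * v s)).
    by apply: integrableS ir => //; apply: subset_itvl; rewrite bnd_simp.
  rewrite /abel -!Rintegral_itv_bndo_bndc//; apply: le_Rintegral => // s /=.
  rewrite in_itv/= => /andP[s0 sr]; have sT : s <= T by rewrite (le_trans (ltW sr)).
  have /andP[vs _] := v2 s (introT andP (conj s0 sT)).
  rewrite ler_wpM2r// (_ : a - 1 = - (1 - a)); last by rewrite opprB.
  rewrite !powRN lef_pV2 ?posrE ?powR_gt0 ?subr_gt0//; last by rewrite (lt_le_trans sr).
  by apply: ge0_ler_powR; rewrite ?nnegrE ?subr_ge0 ?lerB// ltW.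
have i2 : mu.-integrable `]T - L, T] (EFin \o (fun s => (T - s) `^ (a - 1) * v s)).
  exact: integrableS iT.
have iK2 : mu.-integrable `]T - L, T] (EFin \o (fun s => (T - s) `^ (a - 1))).
  exact: integrableS iK.
have H2 : \int[mu]_(s in `]T - L, T]) ((T - s) `^ (a - 1) * v s) <=
    2 * \int[mu]_(s in `]T - L, T]) (T - s) `^ (a - 1).
  rewrite -RintegralZl//; apply: le_Rintegral => //.
    rewrite (_ : EFin \o _ = fun s : R => (2%:E * (EFin \o (fun s : R => ((T - s) `^ (a - 1))%R)) s)%E)//.
    exact: integrableZl.
  move=> s /sub2 /=; rewrite in_itv/= => /v2 /andP[_ vs].
  by rewrite [2 * _]mulrC ler_wpM2l// powR_ge0.
have H3 : \int[mu]_(s in `]T - L, T]) (T - s) `^ (a - 1) = L `^ a / a.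
  rewrite -spK kT.
  have -> : \int[mu]_(s in `[0, T - L]) (T - s) `^ (a - 1) = (- (T - (T - L)) `^ a / a) - (- (T - 0) `^ a / a).
    apply: (@Rintegral_FTC2 R (fun s => - (T - s) `^ a / a)) => //.
    - apply: (@subspace_eq_continuous _ _ _ (fun x : R => - (Num.max 0 (T - x) `^ a) / a)).
        move=> x; rewrite inE/= in_itv/= => /andP[_ xr].
        by rewrite /= max_r// subr_ge0 (le_trans xr).
      apply: within_continuous => x; apply: cvgM; last exact: cvg_cst.
      apply: (@cvgN _ _ _ _ _ (fun x : R => Num.max 0 (T - x) `^ a)).
      apply: (@continuous_comp _ _ _ (fun x : R => T - x) (fun x => Num.max 0 x `^ a)).
        by apply: cvgB; [exact: cvg_cst|exact: cvg_id].
      exact: continuous_powR_max.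
    (* Here T - s >= L, and truncating at L > 0 keeps the power continuous although its exponent a -
       1 may be negative. *)
    - apply: (@subspace_eq_continuous _ _ _ (fun x : R => (Num.max L (T - x)) `^ (a - 1))).
        move=> x; rewrite inE/= in_itv/= => /andP[_ xr].
        by rewrite /= max_r// lerBrDl -lerBrDr.
      apply: within_continuous => x.
      apply: (@continuous_comp _ _ _ (fun x : R => Num.max L (T - x)) (fun x => x `^ (a - 1))).
        apply: continuous_max; first exact: cst_continuous.
        by apply: cvgB; [exact: cvg_cst|exact: cvg_id].
      apply/differentiable_continuous/derivable1_diffP; have /= := @is_derive1_powR R (a - 1) (Num.max L (T - x)).
      by case=> //; rewrite lt_max L0.
    move=> x /andP[x0 xr]; have Tx : 0 < T - x by rewrite subr_gt0 (lt_le_trans xr).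
    have d := is_derive1_powR a Tx.
    have dT : is_derive x 1 (fun x => T - x) (- 1).
      rewrite (_ : -1 = 0 - 1); last by rewrite sub0r.
      by apply: is_deriveB.
    have dd := @is_derive_chain R (fun x => T - x) _ x _ _ _ d dT (erefl _).
    apply: is_derive_eq; rewrite /GRing.scale/=.
    by move: (_ `^ (a - 1)) => u; field; rewrite gt_eqF.
  rewrite subr0 (_ : T - (T - L) = L); last by ring.
  by move: (T `^ a) (L `^ a) => p q; field; rewrite gt_eqF.
rewrite -sp in H2; rewrite -/(abel a v T) in H2; move: H1 H2; rewrite H3.
move: (abel a v T) (abel a v (T - L)) (Rintegral _ _ _) (L `^ a / a) => p q r w; lra.
Qed.

(** The lower bound is the upper bound applied to 2 - v, because the fractional integral of the
    constant 2 increases with time. *)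
Lemma abel_increment a v T L : 0 < a <= 1 -> 0 < L <= T ->
  {within `[0, T], continuous v} -> (forall s, 0 <= s <= T -> 0 <= v s <= 2) ->
  `|abel a v T - abel a v (T - L)| <= 2 * (L `^ a / a).
Proof.
move=> a01 LT cv v2; have /andP[a0 a1] := a01; have /andP[L0 LT'] := LT.
have T0 : 0 < T by exact: lt_le_trans LT'.
have r0 : 0 <= T - L by rewrite subr_ge0.
have rT : T - L <= T by rewrite gerBl ltW.
have cvr : {within `[0, T - L], continuous v}.
  by apply: continuous_subspaceW cv; apply: subset_itvl; rewrite bnd_simp.
rewrite ler_norml; apply/andP; split; last exact: abel_increment_ub.
have c2 t : {within `[0, t], continuous (fun=> 2 : R)}.
  by apply: within_continuous => x; exact: cvg_cst.
have cw : {within `[0, T], continuous (fun s => 2 + - 1 * v s)}.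
  by apply: withinD; [exact: c2|exact: withinZ].
have w2 s : 0 <= s <= T -> 0 <= 2 + - 1 * v s <= 2.
  by move=> /v2; move: (v s) => x; lra.
have := abel_increment_ub a01 LT cw w2.
have E t : 0 <= t -> {within `[0, t], continuous v} ->
    abel a (fun s => 2 + - 1 * v s) t = 2 * (t `^ a / a) - abel a v t.
  move=> t0 ct; rewrite abelD//; last exact: withinZ.
  rewrite abelZ// mulN1r; congr (_ - _).
  transitivity (abel a (fun s => 2 * 1) t); first by rewrite mulr1.
  rewrite (@abelZ R a (fun=> 1))//; last by apply: within_continuous => x; exact: cvg_cst.
  congr (_ * _); rewrite /abel.
  transitivity (\int[mu]_(s in `[0, t]) (t - s) `^ (a - 1)).
    by apply: eq_Rintegral => s _; rewrite mulr1.
  by rewrite /Rintegral integral_abel_kernel.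
rewrite !E// ?(ltW T0)//.
have : (T - L) `^ a / a <= T `^ a / a.
  rewrite ler_wpM2r ?invr_ge0 ?(ltW a0)//; apply: ge0_ler_powR; rewrite ?nnegrE//; exact: ltW.
move: (_ / a) (_ / a) (_ / a) (abel _ _ _) (abel _ _ _) => p q r u w; lra.
Qed.

End AbelIncrement.

(** * Energy bounds for E_(al,1) and E_(al,al), Taylor bound for t E_(al,2) *)

Section MittagLeffler.
Context {R : realType}.
Notation mu := (@lebesgue_measure R).
Variables al b : R.
Hypotheses (b01 : 0 < b < 1) (alE : al = b + 1).
Implicit Types (t x y T L : R).

Let b0 : 0 < b. Proof. by case/andP: b01. Qed.
Let b1 : 0 < 1 - b. Proof. by case/andP: b01 => _; rewrite subr_gt0. Qed.
Let al1 : 1 < al. Proof. by rewrite alE ltrDr. Qed.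
Let al0 : 0 < al. Proof. exact: lt_trans al1. Qed.

Definition ml_coef be (k : nat) : R := (Gamma (al * k%:R + be))^-1.

Lemma mittag_lefflerE be z : mittag_leffler al be z = psum (ml_coef be) z.
Proof.
by congr (limn (series _)); apply/funext => k; rewrite /ml_coef mulrC.
Qed.

Let argk_gt0 be (k : nat) : 0 < be -> 0 < al * k%:R + be.
Proof. by move=> be0; rewrite ltr_wpDl// mulr_ge0// ltW. Qed.

(** By [Gamma_ge_fact] the coefficients are at most 6 / k!, since al k + be >= k + 1. *)
Lemma ml_entire be : 1 <= be -> entire (ml_coef be).
Proof.
move=> be1; apply: (@le_entire _ _ _ 6 1 _ _ _ entire_invfact) => // k.
have G0 : 0 < Gamma (al * k%:R + be) by rewrite Gamma_gt0 ?argk_gt0 ?(lt_le_trans ltr01).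
rewrite expr1n mulr1 /ml_coef !ger0_norm ?invr_ge0 ?(ltW G0)//.
rewrite -[6]invrK -invfM lef_pV2 ?posrE ?mulr_gt0 ?invr_gt0 ?ltr0n ?fact_gt0//.
rewrite mulrC; apply: Gamma_ge_fact; rewrite -natr1 lerD//.
by rewrite ler_peMl// ltW.
Qed.

Let GS x : 0 < x -> (Gamma (x + 1))^-1 = x^-1 * (Gamma x)^-1.
Proof. by move=> x0; rewrite GammaS// invfM. Qed.

Lemma ml_coefS k be : 0 < be ->
  ml_coef be k = (al * k%:R + be) * ml_coef (be + 1) k.
Proof.
move=> be0; have x0 := argk_gt0 k be0; rewrite /ml_coef addrA.
by move: (_ + _) x0 => x x0; rewrite (GS x0) mulVKf ?gt_eqF.
Qed.

Let is_derive_npow t : 0 < t ->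
  is_derive t 1 (fun t => - (t `^ al)) (- (al * t `^ (al - 1))).
Proof. by move=> t0; have := is_derive1_powR al t0 => d; apply: is_deriveN. Qed.

Let is_derive_comp c t : entire c -> 0 < t ->
  is_derive t 1 (fun t => psum c (- (t `^ al)))
    (- (al * t `^ (al - 1) * psum (pseries_diffs c) (- (t `^ al)))).
Proof.
move=> cc t0; apply: (@is_derive_chain R (fun t => - (t `^ al)) (psum c) t _ _ _
  (is_derive_psum (- (t `^ al)) cc) (is_derive_npow t0)).
by set p := psum _ _; ring.
Qed.

Let powRal t : 0 < t -> t `^ al = t * t `^ b.
Proof. by move=> t0; rewrite -(mulr_powRB1 (ltW t0) al0) alE addrK. Qed.

(* t^be E_{al,be+1}(-t^al) is a primitive of t^(be-1) E_{al,be}(-t^al). *)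
Lemma is_derive_ml be t : 1 <= be -> 0 < t ->
  is_derive t 1 (fun t => t `^ be * psum (ml_coef (be + 1)) (- (t `^ al)))
    (t `^ (be - 1) * psum (ml_coef be) (- (t `^ al))).
Proof.
move=> be1 t0; have be0 : 0 < be by exact: lt_le_trans be1.
have cc : entire (ml_coef (be + 1)) by apply: ml_entire; rewrite lerDr ltW.
have d1 := is_derive1_powR be t0; have d2 := is_derive_comp cc t0.
apply: is_derive_eq; rewrite /GRing.scale/=.
set y := - (t `^ al).
(* On coefficients this is [ml_coefS]: the Euler operator contributes the summand al k of the factor
   al k + be. *)
have E : psum (ml_coef be) y = be * psum (ml_coef (be + 1)) y + al * (y * psum (pseries_diffs (ml_coef (be + 1))) y).
  rewrite psum_scale_diffs//.
  have ck : entire (fun k => k%:R * ml_coef (be + 1) k).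
    apply: (@le_entire _ (ml_coef (be + 1)) _ 1 2) => // k.
    by rewrite normrM mul1r ger0_norm// ler_wpM2r// -natrX ler_nat ltnW// ltn_expl.
  have ce1 : entire (fun k => be * ml_coef (be + 1) k).
    by apply: (@le_entire _ (ml_coef (be + 1)) _ be 1 (ltW be0)) => // k; rewrite expr1n mulr1 normrM gtr0_norm.
  have ce2 : entire (fun k => al * (k%:R * ml_coef (be + 1) k)).
    by apply: (@le_entire _ _ _ al 1 (ltW al0) ler01 _ ck) => // k; rewrite expr1n mulr1 normrM gtr0_norm.
  rewrite -!psumZ// -psumD//; congr (psum _ y); apply/funext => k.
  by rewrite (ml_coefS k be0); move: (ml_coef _ _) (k%:R) => p q; ring.
have tb : t `^ be = t * t `^ (be - 1) by rewrite mulr_powRB1// ltW.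
have -> : al - 1 = b by rewrite alE addrK.
have yE : y = - (t * t `^ b) by rewrite /y powRal.
rewrite E tb; move: (psum (ml_coef (be + 1)) y) (psum (pseries_diffs _) y) => p q.
by rewrite yE; move: (t `^ (be - 1)) (t `^ b) => u v; ring.
Qed.

(** For be = 1 this is e(t) = E_(al,1)(- t^al). The truncation at 0 makes it continuous on the whole
    line, as [abel_form_ge0] requires. *)
Let mlt be t := psum (ml_coef be) (- ((Num.max 0 t) `^ al)).

Let mltE be t : 0 <= t -> mlt be t = psum (ml_coef be) (- (t `^ al)).
Proof. by move=> t0; rewrite /mlt max_r. Qed.

Let cmax : continuous (fun t : R => - (Num.max 0 t `^ al)).
Proof. by move=> x; apply: cvgN; exact: continuous_powR_max. Qed.

Let cpmax c : entire c -> continuous (fun t => psum c (- (Num.max 0 t `^ al))).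
Proof.
move=> cc x; apply: (@continuous_comp _ _ _ (fun t : R => - (Num.max 0 t `^ al))).
  exact: cmax.
exact: continuous_psum.
Qed.

Let abel_max a c t : 0 < a -> entire c -> 0 < t ->
  abel a (fun t => psum c (- (Num.max 0 t `^ al))) t =
  t `^ a * psum (fun k => c k * (Gamma a * Gamma (al * k%:R + 1) / Gamma (al * k%:R + 1 + a)))
    (- (t `^ al)).
Proof.
move=> a0 cc t0; transitivity (abel a (fun s => psum c (- (s `^ al))) t); last exact: abel_psum.
apply: eq_Rintegral => s.
by rewrite inE/= in_itv/= => /andP[s0 _]; rewrite max_r.
Qed.

(** Gamma(al (k + 1) + 1) = al (k + 1) Gamma(al k + al), so the factor k + 1 of the derivative
    cancels: E_(al,1)' = E_(al,al) / al. *)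
Let diffs1 k : pseries_diffs (ml_coef 1) k = al^-1 * ml_coef al k.
Proof.
have E : ml_coef 1 k.+1 = (Gamma ((al * k%:R + al) + 1))^-1.
  by rewrite /ml_coef -[k.+1%:R]natr1; congr (Gamma _)^-1; ring.
have x0 := argk_gt0 k al0.
rewrite /pseries_diffs E (GS x0) -/(ml_coef al k) -[k.+1%:R]natr1.
have k0 : k%:R + 1 != 0 :> R by rewrite gt_eqF// ltr_wpDl.
have xE : al * k%:R + al = al * (k%:R + 1) by ring.
have a0 : al != 0 by rewrite gt_eqF.
rewrite xE; move: (ml_coef al k) => G; move: (k%:R + 1) k0 => q q0.
by rewrite invfM; field; rewrite a0 q0.
Qed.

Let is_derive_max0 t : 0 < t -> is_derive t 1 (fun t : R => Num.max 0 t) 1.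
Proof.
move=> t0; have E : {near t, id =1 (fun t : R => Num.max 0 t)}.
  near=> s; rewrite max_r//.
  by near: s; apply: filterS (lt_nbhsr t0) => x /ltW.
apply: (near_eq_is_derive E).
Unshelve. all: by end_near. Qed.

Let is_derive_ml1 t : 0 < t ->
  is_derive t 1 (mlt 1) (- (t `^ b * psum (ml_coef al) (- (t `^ al)))).
Proof.
move=> t0; have cc := @ml_entire 1 (lexx 1).
have d := is_derive_comp cc t0.
have dm := is_derive_max0 t0.
apply: (@is_derive_chain R (fun t => Num.max 0 t) (fun t => psum (ml_coef 1) (- (t `^ al))) t
  (- (al * t `^ (al - 1) * psum (pseries_diffs (ml_coef 1)) (- (t `^ al)))) 1) => //.
  by rewrite max_r// ltW.
rewrite mulr1 (_ : pseries_diffs _ = fun k => al^-1 * ml_coef al k); last exact/funext/diffs1.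
rewrite psumZ; last by apply: ml_entire; exact: ltW.
rewrite (_ : al - 1 = b); last by rewrite alE addrK.
by congr (- _); move: (psum _ _) (t `^ b) => p q; field; rewrite gt_eqF.
Qed.

(** Together with [is_derive_ml1] this is the equation e' = - J^b e. *)
Let abel_ml1 t : 0 < t -> abel b (mlt 1) t = Gamma b * (t `^ b * psum (ml_coef al) (- (t `^ al))).
Proof.
move=> t0; rewrite /mlt abel_max//; last exact: ml_entire.
rewrite mulrCA; congr (_ * _); rewrite -psumZ; last by apply: ml_entire; exact: ltW.
congr (psum _ _); apply/funext => k; rewrite /ml_coef.
rewrite (_ : al * k%:R + 1 + b = al * k%:R + al); last by rewrite -addrA [1 + b]addrC -alE.
have g0 := Gamma_gt0 (argk_gt0 k ltr01); move: (Gamma (al * k%:R + 1)) g0 => G1 g0.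
move: (Gamma b) (Gamma (al * k%:R + al))^-1 => G2 G3.
by field; rewrite gt_eqF.
Qed.

Let square_primitive (F f : R -> R) T : 0 <= T -> {within `[0, T], continuous F} ->
  {within `[0, T], continuous f} -> (forall t, 0 < t < T -> is_derive t 1 F (f t)) ->
  \int[mu]_(t in `[0, T]) (F t * f t) = (F T ^+ 2 - F 0 ^+ 2) / 2.
Proof.
move=> T0 cF cf dF.
transitivity (F T ^+ 2 / 2 - F 0 ^+ 2 / 2); last by rewrite mulrBl.
apply: (@Rintegral_FTC2 R (fun t => F t ^+ 2 / 2) (fun t => F t * f t) 0 T T0).
- by move=> x; apply: cvgM; [apply: cvgM; exact: cF|exact: cvg_cst].
- exact: withinM.
move=> t tT; have d := dF t tT; apply: is_derive_eq; rewrite /GRing.scale/=.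
by move: (F t) (f t) => u v; field.
Qed.

(** For t > 0 this is - e'(t), that is, J^b e. *)
Let kal t := t `^ b * psum (ml_coef al) (- (t `^ al)).

Let ckal T : {within `[0, T], continuous kal}.
Proof.
apply: withinM; first by apply: within_powR; exact: ltW.
by apply: within_psum_powR => //; apply: ml_entire; exact: ltW.
Qed.

Let mlt10 : mlt 1 0 = 1.
Proof.
rewrite /mlt maxxx powR0 ?gt_eqF// oppr0 psum0; last exact: ml_entire.
by rewrite /ml_coef mulr0 add0r Gamma1 invr1.
Qed.

Let cmlt1 : continuous (mlt 1). Proof. by apply: cpmax; exact: ml_entire. Qed.

Let abel0 a (f : R -> R) : abel a f 0 = 0.
Proof. by rewrite /abel set_itv1 Rintegral_set1. Qed.

Let abel_ml1' t : 0 <= t -> abel b (mlt 1) t = Gamma b * kal t.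
Proof.
rewrite le_eqVlt => /predU1P[<-|t0]; last exact: abel_ml1.
by rewrite abel0 /kal powR0 ?gt_eqF// mul0r mulr0.
Qed.

Let energy1 T : 0 <= T ->
  \int[mu]_(t in `[0, T]) (mlt 1 t * kal t) = (1 - mlt 1 T ^+ 2) / 2.
Proof.
move=> T0.
have nck : {within `[0, T], continuous (fun t => - kal t)} by move=> x; apply: cvgN; exact: ckal.
have wm : {within `[0, T], continuous (mlt 1)} by exact: within_continuous.
have dm t : 0 < t < T -> is_derive t 1 (mlt 1) (- kal t).
  by move=> /andP[t0 _]; exact: is_derive_ml1.
have := square_primitive T0 wm nck dm.
rewrite mlt10 expr1n => E.
have -> : \int[mu]_(t in `[0, T]) (mlt 1 t * kal t) = - 1 * \int[mu]_(t in `[0, T]) (mlt 1 t * - kal t).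
  rewrite -RintegralZl//; last by apply: continuous_integrable; exact: withinM.
  by apply: eq_Rintegral => t _; ring.
by rewrite E; field.
Qed.

Lemma ml1_le1 x : 0 <= x -> `|mittag_leffler al 1 (- x)| <= 1.
Proof.
move=> x0; rewrite mittag_lefflerE; pose T := x `^ al^-1.
have T0 : 0 <= T by exact: powR_ge0.
have TE : T `^ al = x by rewrite -powRrM mulVf ?gt_eqF// powRr1.
(* With k = 0 and h = e only the integral of e J^b e = - e e' remains, which is (1 - e(T)^2) / 2. *)
have := @abel_form_ge0 R b T 0 (mlt 1) (mlt 1) b01 T0 cmlt1 cmlt1.
set J := (X in 0 <= X); have -> : J = Gamma b * \int[mu]_(t in `[0, T]) (mlt 1 t * kal t).
  rewrite -RintegralZl//; last first.
    by apply: continuous_integrable; apply: withinM; [exact: within_continuous|exact: ckal].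
  apply: eq_Rintegral => t; rewrite inE/= in_itv/= => /andP[t0 _].
  by rewrite abel_ml1'//; move: (mlt 1 t) (kal t) (Gamma b) => p q r; ring.
rewrite pmulr_rge0 ?Gamma_gt0// energy1// mltE// TE.
rewrite pmulr_lge0 ?invr_gt0// subr_ge0 => H.
by rewrite -(@ler_pXn2r _ 2)// ?nnegrE// expr1n real_normK ?num_real.
Qed.

Let cH : R^nat := fun k => k%:R * ml_coef 1 k.

Let entire_cH : entire cH.
Proof.
apply: (@le_entire _ (ml_coef 1) _ 1 2) => //; last exact: ml_entire.
by move=> k; rewrite normrM mul1r ger0_norm// ler_wpM2r// -natrX ler_nat ltnW// ltn_expl.
Qed.

(** h(t) = t e'(t) / al, written as a power series in t^al so that continuity at 0 is immediate. *)
Let h t := psum cH (- (Num.max 0 t `^ al)).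

Let ch : continuous h. Proof. exact: cpmax entire_cH. Qed.

Let h0 : h 0 = 0.
Proof. by rewrite /h maxxx powR0 ?gt_eqF// oppr0 psum0// /cH mul0r. Qed.

Let cHE y : al * psum cH y = y * psum (ml_coef al) y.
Proof.
have c1 := @ml_entire 1 (lexx 1); rewrite /cH -psum_scale_diffs//.
rewrite (_ : pseries_diffs _ = fun k => al^-1 * ml_coef al k); last exact/funext/diffs1.
rewrite psumZ; last by apply: ml_entire; exact: ltW.
by move: (psum _ _) => p; field; rewrite gt_eqF.
Qed.

Let dH : R^nat := fun k => k%:R * ml_coef al k + ml_coef al k.

Let cal : entire (ml_coef al). Proof. by apply: ml_entire; exact: ltW. Qed.

Let entire_kal : entire (fun k => k%:R * ml_coef al k).
Proof.
apply: (@le_entire _ (ml_coef al) _ 1 2) => // k.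
by rewrite normrM mul1r ger0_norm// ler_wpM2r// -natrX ler_nat ltnW// ltn_expl.
Qed.

Let entire_dH : entire dH.
Proof.
apply: (@le_entire _ (ml_coef al) _ 1 2) => // k.
rewrite mul1r /dH -{2}[ml_coef al k]mul1r -mulrDl normrM ler_wpM2r// natr1 ger0_norm//.
by rewrite -natrX ler_nat ltn_expl.
Qed.

(** Termwise, J^b turns k / Gamma(al k + 1) into k / Gamma(al k + al); adding J^b e replaces the
    factor k by k + 1, which is the factor produced by differentiating h. *)
Let abel_hE t : 0 <= t ->
  abel b h t + abel b (mlt 1) t = Gamma b * (t `^ b * psum dH (- (t `^ al))).
Proof.
rewrite le_eqVlt => /predU1P[<-|t0].
  by rewrite !abel0 powR0 ?gt_eqF// mul0r mulr0 addr0.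
have E k : cH k * (Gamma b * Gamma (al * k%:R + 1) / Gamma (al * k%:R + 1 + b)) =
    Gamma b * (k%:R * ml_coef al k).
  have g0 := Gamma_gt0 (argk_gt0 k ltr01).
  rewrite /cH /ml_coef -(addrA _ 1 b) [1 + b]addrC -alE.
  move: (Gamma (al * k%:R + 1)) (Gamma (al * k%:R + al))^-1 g0 => G1 G3 g0.
  by move: (Gamma b) => G2; field; rewrite gt_eqF.
rewrite {1}/h abel_max//; rewrite abel_ml1//.
rewrite (_ : (fun k => cH k * _) = fun k => Gamma b * (k%:R * ml_coef al k)); last first.
  by apply/funext => k; exact: E.
rewrite psumZ// psumD//; set p := psum _ _; set r := psum _ _.
by move: p r (Gamma b) => p r G; ring.
Qed.

(* Gamma b h' = - (J^b h + al J^b e / al), for h(t) = t e'(t) / al. *)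
Let is_derive_h t : 0 < t ->
  is_derive t 1 h (- ((abel b h t + abel b (mlt 1) t) / Gamma b)).
Proof.
move=> t0; have d := is_derive_comp entire_cH t0.
have dm := is_derive_max0 t0.
have G0 := Gamma_gt0 b0.
apply: (@is_derive_chain R (fun t => Num.max 0 t) (fun t => psum cH (- (t `^ al))) t
  (- (al * t `^ (al - 1) * psum (pseries_diffs cH) (- (t `^ al)))) 1) => //.
  by rewrite max_r// ltW.
rewrite mulr1 abel_hE ?(ltW t0)// (_ : al - 1 = b); last by rewrite alE addrK.
rewrite (_ : pseries_diffs cH = fun k => al^-1 * dH k); last first.
  apply/funext => k; have := diffs1 k; rewrite /pseries_diffs /cH => ->.
  rewrite -natr1 /dH; move: (ml_coef al k) (k%:R) => p q; ring.
rewrite psumZ//.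
move: (psum _ _) (t `^ b) (Gamma b) G0 => p r G G0.
by field; rewrite !gt_eqF.
Qed.

Let cabelh T : {within `[0, T], continuous (fun t => abel b h t + abel b (mlt 1) t)}.
Proof.
apply: (@subspace_eq_continuous _ _ _ (fun t => Gamma b * (t `^ b * psum dH (- (t `^ al))))).
  move=> x; rewrite inE/= in_itv/= => /andP[x0 xr].
  by rewrite /from_subspace abel_hE.
apply: withinZ; apply: withinM; first by apply: within_powR; exact: ltW.
exact: within_psum_powR.
Qed.

Let energyh T : 0 <= T ->
  \int[mu]_(t in `[0, T]) (h t * (abel b h t + abel b (mlt 1) t)) = - Gamma b * (h T ^+ 2 / 2).
Proof.
move=> T0; have G0 := Gamma_gt0 b0.
pose g t := - ((abel b h t + abel b (mlt 1) t) / Gamma b).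
have cg : {within `[0, T], continuous g}.
  by move=> x; apply: cvgN; apply: cvgM; [exact: cabelh|exact: cvg_cst].
have wh : {within `[0, T], continuous h} by exact: within_continuous.
have dh t : 0 < t < T -> is_derive t 1 h (g t).
  by move=> /andP[t0 _]; exact: is_derive_h.
have := square_primitive T0 wh cg dh.
rewrite h0 expr0n/= subr0 => <-.
rewrite -RintegralZl//; last by apply: continuous_integrable; exact: withinM.
apply: eq_Rintegral => t _; rewrite /g.
move: (h t) (abel _ _ _) (abel _ _ _) => p q r.
by move: (Gamma b) G0 => G G0; field; rewrite gt_eqF.
Qed.

(** For k = 1 / (1 - b) the first two terms of the form add up to h (J^b h + J^b e) = - h h', so
    positivity reads h(T)^2 <= (k^2 / 4) (1 - e(T)^2). At T^al = x the quantity to be bounded is -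
    al h(T). *)
Lemma ml_al_le x : 0 <= x -> `|x * mittag_leffler al al (- x)| <= al / (2 * (1 - b)).
Proof.
move=> x0; pose T := x `^ al^-1.
have T0 : 0 <= T by exact: powR_ge0.
have TE : T `^ al = x by rewrite -powRrM mulVf ?gt_eqF// powRr1.
have G0 := Gamma_gt0 b0.
have := @abel_form_ge0 R b T (1 - b)^-1 h (mlt 1) b01 T0 ch cmlt1.
set J := (X in 0 <= X).
have wh : {within `[0, T], continuous h} by exact: within_continuous.
have wm : {within `[0, T], continuous (mlt 1)} by exact: within_continuous.
have i1 : mu.-integrable `[0, T] (EFin \o (fun t => h t * (abel b h t + abel b (mlt 1) t))).
  by apply: continuous_integrable; apply: withinM; [exact: wh|exact: cabelh].
have i2 : mu.-integrable `[0, T] (EFin \o (fun t => mlt 1 t * kal t)).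
  by apply: continuous_integrable; apply: withinM; [exact: wm|exact: ckal].
pose q := (1 - b)^-1 ^+ 2 / 4 * Gamma b.
have i3 : mu.-integrable `[0, T] (EFin \o (fun t => q * (mlt 1 t * kal t))).
  by apply: continuous_integrable; apply: withinZ; apply: withinM; [exact: wm|exact: ckal].
have -> : J = \int[mu]_(t in `[0, T]) (h t * (abel b h t + abel b (mlt 1) t)) +
    q * \int[mu]_(t in `[0, T]) (mlt 1 t * kal t).
  rewrite -RintegralZl// -RintegralD//.
  apply: eq_Rintegral => t; rewrite inE/= in_itv/= => /andP[t0 _].
  rewrite divff ?gt_eqF// mul1r abel_ml1'// /q.
  by move: (h t) (mlt 1 t) (kal t) (Gamma b) (abel b h t) ((1 - b)^-1) => p1 p2 p3 p4 p5 p6; ring.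
rewrite energyh// energy1//.
have hE : x * mittag_leffler al al (- x) = - (al * h T).
  by rewrite /h max_r// TE cHE mittag_lefflerE mulNr opprK.
rewrite hE normrN normrM gtr0_norm// => H.
have H2 : h T ^+ 2 <= ((1 - b)^-1 / 2) ^+ 2.
  have e2 := sqr_ge0 (mlt 1 T).
  have H' : 0 <= Gamma b * ((1 - b)^-1 ^+ 2 / 4 * (1 - mlt 1 T ^+ 2) - h T ^+ 2).
    move: H; rewrite /q; move: (h T ^+ 2) (mlt 1 T ^+ 2) (Gamma b) (_^-1 ^+ 2) => p1 p2 p3 p4; lra.
  rewrite pmulr_rge0// subr_ge0 in H'; apply: le_trans H' _.
  rewrite exprMn; have := sqr_ge0 (1 - b)^-1.
  move: (_ ^+ 2) (_^-1 ^+ 2) e2 => p1 p2 e2 e3.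
  rewrite (_ : (2^-1 : R) ^+ 2 = 4^-1); last by field.
  by rewrite -mulrA ler_wpM2l// ler_piMr ?invr_ge0// gerBl.
rewrite invfM ler_pM2l// -(@ler_pXn2r _ 2) ?nnegrE ?mulr_ge0 ?invr_ge0 ?(ltW b1)//.
by rewrite real_normK ?num_real// mulrC.
Qed.

(** For x <= 1 the power series bounds the function and x^(-7/8) >= 1; for x > 1 the decay in 1 / x
    is stronger than x^(-7/8). *)
Lemma ml_al_decay : exists2 C, 0 < C & forall x, 0 < x ->
  `|mittag_leffler al al (- x)| <= C * x `^ (- (7 / 8)).
Proof.
pose M := psum (fun k => `|ml_coef al k|) 1.
pose K := al / (2 * (1 - b)).
have K0 : 0 < K by rewrite divr_gt0// mulr_gt0.
have M0 : 0 <= M.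
  by apply: le_trans (psum_norm_le cal (_ : `|0| <= 1)); rewrite ?normr_ge0 ?normr0.
exists (K + M); first by rewrite ltr_wpDr.
move=> x x0; have p0 : 0 < x `^ (- (7 / 8)) by rewrite powR_gt0.
have [x1|x1] := leP x 1.
  apply: (@le_trans _ _ M).
    rewrite mittag_lefflerE; apply: psum_norm_le => //.
    by rewrite normrN ger0_norm// ltW.
  rewrite -[leLHS]mulr1; apply: ler_pM => //; first by rewrite lerDr ltW.
  rewrite powRN -[leLHS]invr1 lef_pV2 ?posrE ?powR_gt0//.
  by apply: powR_le1; [rewrite ltW|lra].
have := ml_al_le (ltW x0); rewrite normrM gtr0_norm// mulrC -ler_pdivlMr// => /le_trans; apply.
apply: ler_pM; rewrite ?invr_ge0 ?(ltW x0) ?(ltW K0)//; first by rewrite lerDl.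
rewrite powRN lef_pV2 ?posrE ?powR_gt0// -[leRHS]powRr1 ?(ltW x0)//.
by apply: ler_powR; [exact: ltW|lra].
Qed.

(** u(t) = t E_(al,2)(- t^al) is a primitive of e, and U(t) = t^2 E_(al,3)(- t^al) is a primitive of
    u. *)
Let u t := t `^ 1 * psum (ml_coef (1 + 1)) (- (t `^ al)).
Let U t := t `^ (1 + 1) * psum (ml_coef (1 + 1 + 1)) (- (t `^ al)).

Let c2 : entire (ml_coef (1 + 1)). Proof. by apply: ml_entire; rewrite lerDl. Qed.
Let c3 : entire (ml_coef (1 + 1 + 1)). Proof. by apply: ml_entire; rewrite lerDr addr_ge0. Qed.

Let cu T : {within `[0, T], continuous u}.
Proof. by apply: withinM; [exact: within_powR|exact: within_psum_powR]. Qed.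

Let cU T : {within `[0, T], continuous U}.
Proof. by apply: withinM; [apply: within_powR; rewrite addr_ge0|exact: within_psum_powR]. Qed.

Let is_derive_u t : 0 < t -> is_derive t 1 u (mlt 1 t).
Proof.
move=> t0; have := is_derive_ml (lexx 1) t0.
by rewrite subrr powRr0 mul1r mltE// ltW.
Qed.

Let is_derive_U t : 0 < t -> is_derive t 1 U (u t).
Proof.
move=> t0; have h2 : 1 <= 1 + 1 :> R by rewrite lerDl.
by have := is_derive_ml h2 t0; rewrite addrK.
Qed.

Let mlt_le1 t : `|mlt 1 t| <= 1.
Proof. by rewrite /mlt -mittag_lefflerE; apply: ml1_le1; exact: powR_ge0. Qed.

(** In 1 - e the term k = 0 cancels; in the others al (k + 1) + 1 + (1 - b) = al k + 3, the argument
    of Gamma in U. Thus U = J^(1-b) (1 - e). *)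
Let abel_1e t : 0 <= t -> abel (1 - b) (fun t => 1 - mlt 1 t) t = Gamma (1 - b) * U t.
Proof.
rewrite le_eqVlt => /predU1P[<-|t0].
  by rewrite abel0 /U powR0 ?mul0r ?mulr0// gt_eqF// addr_gt0.
have c1 := @ml_entire 1 (lexx 1).
pose d k := if k is k'.+1 then - ml_coef 1 k'.+1 else 0.
have cd : entire d.
  apply: (@le_entire _ (ml_coef 1) _ 1 1) => // -[|k]; rewrite expr1n !mul1r/=.
    by rewrite normr0.
  by rewrite normrN.
have E s : 1 - mlt 1 s = psum d (- (Num.max 0 s `^ al)).
  rewrite /mlt (psum_recl _ c1) (psum_recl _ cd)/=.
  rewrite (_ : ml_coef 1 0 = 1); last by rewrite /ml_coef mulr0 add0r Gamma1 invr1.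
  rewrite (_ : (fun k => - ml_coef 1 k.+1) = fun k => -1 * ml_coef 1 k.+1); last first.
    by apply/funext => k; rewrite mulN1r.
  rewrite psumZ; last exact: entire_shift.
  by move: (psum _ _) => p; ring.
rewrite (_ : (fun t => 1 - mlt 1 t) = fun t => psum d (- (Num.max 0 t `^ al))); last exact/funext.
rewrite abel_max//.
pose c' k := d k * (Gamma (1 - b) * Gamma (al * k%:R + 1) / Gamma (al * k%:R + 1 + (1 - b))).
have c'S k : c' k.+1 = - (Gamma (1 - b)) * ml_coef (1 + 1 + 1) k.
  rewrite /c' /d /ml_coef.
  have -> : al * k.+1%:R + 1 + (1 - b) = al * k%:R + (1 + 1 + 1) by rewrite -natr1 alE; ring.
  have g0 := Gamma_gt0 (argk_gt0 k.+1 ltr01).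
  move: (Gamma (al * k.+1%:R + 1)) (Gamma (al * k%:R + _))^-1 g0 => G1 G3 g0.
  by move: (Gamma _) => G2; field; rewrite gt_eqF.
have cc' : entire c'.
  have c2b : entire (ml_coef (2 - b)) by apply: ml_entire; move: (ltW b1); lra.
  apply: (@le_entire _ (ml_coef (2 - b)) _ (Gamma (1 - b)) 1) => //.
    exact/ltW/Gamma_gt0.
  move=> -[|k]; rewrite expr1n mulr1/c'.
    by rewrite mul0r normr0 mulr_ge0// ltW// Gamma_gt0.
  rewrite /d /ml_coef.
  have -> : al * k.+1%:R + 1 + (1 - b) = al * k.+1%:R + (2 - b) by ring.
  have g0 := Gamma_gt0 (argk_gt0 k.+1 ltr01).
  have G20 := Gamma_gt0 b1.
  rewrite -[X in _ <= X * _](gtr0_norm G20) -normrM -[leRHS]normrN.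
  move: (Gamma (al * k.+1%:R + (2 - b)))^-1 => G3; move: (Gamma (1 - b)) => G2.
  move: (Gamma (al * k.+1%:R + 1)) g0 => G1 g0.
  rewrite (_ : - G1^-1 * _ = - (G2 * G3))//.
  by field; rewrite gt_eqF.
rewrite -/c' (psum_recl _ cc') {1}/c'/= mul0r add0r.
rewrite (_ : (fun k => c' k.+1) = fun k => - Gamma (1 - b) * ml_coef (1 + 1 + 1) k); last exact/funext.
rewrite psumZ// /U.
have -> : t `^ (1 + 1) = t `^ (1 - b) * t `^ al.
  by rewrite -powRD ?(gt_eqF t0) ?implybT// alE; congr (_ `^ _); ring.
rewrite !mulNr !mulrN opprK; set p := psum (ml_coef _) _.
by move: p (Gamma (1 - b)) (t `^ (1 - b)) (t `^ al) => p q r w; ring.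
Qed.

Let lip_u s t : 0 <= s <= t -> `|u t - u s| <= t - s.
Proof.
move=> /andP[s0 st]; have m x := mlt_le1 x; rewrite ler_norml.
have wu : {within `[s, t], continuous u}.
  by apply: continuous_subspaceW (@cu t); apply: subset_itvr; rewrite bnd_simp.
have H1 : u s + s <= u t + t.
  apply: (@ge0_nondecreasing_itv R (fun t => u t + t) (fun t => mlt 1 t + 1) s t st).
  - by apply: withinD => //; apply: within_continuous => x; exact: cvg_id.
  - move=> x /andP[x0 _]; have d := is_derive_u (le_lt_trans s0 x0).
    by apply: is_deriveD.
  - by move=> x _; have := m x; rewrite ler_norml => /andP[+ _]; rewrite -subr_ge0 opprK.
have H2 : s - u s <= t - u t.
  apply: (@ge0_nondecreasing_itv R (fun t => t - u t) (fun t => 1 - mlt 1 t) s t st).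
  - by apply: withinB => //; apply: within_continuous => x; exact: cvg_id.
  - move=> x /andP[x0 _]; have d := is_derive_u (le_lt_trans s0 x0).
    by apply: is_deriveB.
  - by move=> x _; have := m x; rewrite ler_norml subr_ge0 => /andP[].
by move: H1 H2; move: (u s) (u t) => p q; lra.
Qed.

Let u_at0 : u 0 = 0.
Proof. by rewrite /u powR0 ?mul0r// oner_neq0. Qed.

Let le_u t : 0 <= t -> `|u t| <= t.
Proof. by move=> t0; have := @lip_u 0 t; rewrite lexx t0 u_at0 !subr0; apply. Qed.

(** [abel_increment] applies to 1 - e, which takes its values in [[0, 2]] because |e| <= 1. *)
Let U_increment T L : 0 < L <= T -> `|U T - U (T - L)| <= 2 * (L `^ (1 - b) / Gamma (1 - b + 1)).
Proof.
move=> /andP[L0 LT]; have T0 : 0 <= T by rewrite (le_trans (ltW L0)).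
have G0 := Gamma_gt0 b1; have r0 : 0 <= T - L by rewrite subr_ge0.
have a01 : 0 < 1 - b <= 1 by rewrite b1 gerBl ltW.
have LT' : 0 < L <= T by rewrite L0.
have := @abel_increment R (1 - b) (fun t => 1 - mlt 1 t) T L a01 LT'.
rewrite !abel_1e// -mulrBr normrM gtr0_norm// => H.
have {}H : Gamma (1 - b) * `|U T - U (T - L)| <= 2 * (L `^ (1 - b) / (1 - b)).
  apply: H.
    apply: withinB; last exact: within_continuous.
    by apply: within_continuous => x; exact: cvg_cst.
  move=> s _; have := mlt_le1 s; rewrite ler_norml.
  by move: (mlt 1 s) => x; lra.
rewrite -(ler_pM2l G0); apply: le_trans H _; rewrite GammaS//.
have := powR_ge0 L (1 - b); move: (_ `^ _) (Gamma _) G0 => p G G0 p0.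
by rewrite le_eqVlt; apply/orP; left; apply/eqP; field; rewrite !gt_eqF.
Qed.

(* Taylor at T with |u'| <= 1. *)
Let U_taylor T L : 0 < L <= T -> L * `|u T| <= `|U T - U (T - L)| + L ^+ 2 / 2.
Proof.
move=> /andP[L0 LT]; have r0 : 0 <= T - L by rewrite subr_ge0.
have rT : T - L <= T by rewrite gerBl ltW.
have wU : {within `[T - L, T], continuous U}.
  by apply: continuous_subspaceW (@cU T); apply: subset_itvr; rewrite bnd_simp.
have wsq : {within `[T - L, T], continuous (fun s : R => (T - s) ^+ 2 / 2)}.
  apply: within_continuous => x; apply: cvgM; last exact: cvg_cst.
  by apply: cvgM; (apply: cvgB; [exact: cvg_cst|exact: cvg_id]).
have wl : {within `[T - L, T], continuous (fun s : R => u T * (T - s))}.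
  apply: within_continuous => x; apply: cvgM; first exact: cvg_cst.
  by apply: cvgB; [exact: cvg_cst|exact: cvg_id].
have dsq (s : R) : is_derive s 1 (fun s => (T - s) ^+ 2 / 2) (- (T - s)).
  by apply: is_derive_eq; rewrite /GRing.scale/=; field.
have dl (s : R) : is_derive s 1 (fun s => u T * (T - s)) (- u T).
  by apply: is_derive_eq; rewrite /GRing.scale/=; ring.
have H1 : (U (T - L) + u T * (T - (T - L))) - (T - (T - L)) ^+ 2 / 2 <= (U T + u T * (T - T)) - (T - T) ^+ 2 / 2.
  apply: (@ge0_nondecreasing_itv R (fun s => (U s + u T * (T - s)) - (T - s) ^+ 2 / 2)
    (fun s => (u s + - u T) - (- (T - s))) _ _ rT).
  - by apply: withinB => //; exact: withinD.
  - move=> s /andP[rs sT]; have d := is_derive_U (le_lt_trans r0 rs).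
    by apply: is_deriveB; apply: is_deriveD.
  - move=> s /andP[rs sT]; have := @lip_u s T; rewrite (ltW sT) (le_trans r0 (ltW rs)) ler_norml.
    by move=> /(_ isT); move: (u s) (u T) => p q; lra.
have H2 : - (U (T - L) + u T * (T - (T - L))) - (T - (T - L)) ^+ 2 / 2 <= - (U T + u T * (T - T)) - (T - T) ^+ 2 / 2.
  apply: (@ge0_nondecreasing_itv R (fun s => - (U s + u T * (T - s)) - (T - s) ^+ 2 / 2)
    (fun s => - (u s + - u T) - (- (T - s))) _ _ rT).
  - apply: withinB => //; have := withinD wU wl => H x; apply: cvgN; exact: H.
  - move=> s /andP[rs sT]; have d := is_derive_U (le_lt_trans r0 rs).
    by apply: is_deriveB; apply: is_deriveN; apply: is_deriveD.
  - move=> s /andP[rs sT]; have := @lip_u s T; rewrite (ltW sT) (le_trans r0 (ltW rs)) ler_norml.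
    by move=> /(_ isT); move: (u s) (u T) => p q; lra.
rewrite -{1}(gtr0_norm L0) -normrM.
have -> : L * u T = (U T - U (T - L)) - (U T - U (T - L) - L * u T) by ring.
apply: le_trans (ler_normB _ _) _; rewrite lerD2l ler_norml.
move: H1 H2; rewrite !subrr (_ : T - (T - L) = L); last by ring.
by move: (u T) (U T) (U (T - L)) => p q r; nra.
Qed.

(** For t <= L use |u(t)| <= t. For t > L the Taylor step of length L gives L |u(t)| <= 2 L^2 /
    (L^al Gamma(2 - b)) + L^2 / 2. As L^al >= 12 and Gamma(2 - b) >= 1/3, the first term is at most
    L^2 / 2 as well. *)
Lemma ml2_le_pow t L : 12 <= L `^ al -> 0 < L -> 0 <= t -> `|u t| <= L.
Proof.
move=> L12 L0 t0; have [tL|Lt] := leP t L; first exact: le_trans (le_u t0) tL.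
have LT : 0 < L <= t by rewrite L0 ltW.
have := le_trans (U_taylor LT) (lerD (U_increment LT) (lexx _)).
have G3 : 3^-1 <= Gamma (1 - b + 1).
  by apply: le_trans expRN1_ge3V _; apply: Gamma_ge1; rewrite lerDr ltW.
move=> H; rewrite -(ler_pM2l L0); apply: le_trans H _.
have G0 : 0 < Gamma (1 - b + 1) by apply: lt_le_trans G3; rewrite invr_gt0.
have -> : L `^ (1 - b) = L ^+ 2 / L `^ al.
  apply: (mulIf (lt0r_neq0 (powR_gt0 al L0))).
  rewrite mulfVK ?gt_eqF ?powR_gt0// -powRD ?(gt_eqF L0) ?implybT//.
  rewrite -powR_mulrn ?(ltW L0)//; congr (_ `^ _).
  by rewrite alE; ring.
have L0' := L0; move: (L `^ al) L12 (Gamma _) G3 G0 => X X12 G G3 G0.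
have X0 : 0 < X by exact: lt_le_trans X12.
have XG : 4 <= X * G.
  have : 12 * 3^-1 <= X * G by apply: ler_pM.
  by apply: le_trans; lra.
rewrite -expr2 (_ : 2 * _ = L ^+ 2 * (2 / (X * G))); last by field; rewrite !gt_eqF.
have : 2 / (X * G) <= 2^-1.
  by rewrite ler_pdivrMr ?mulr_gt0//; move: (X * G) XG => Y XG; lra.
have L20 : 0 <= L ^+ 2 by exact: sqr_ge0.
by move: (2 / _) (L ^+ 2) L20 => p q q0; nra.
Qed.

(** With L^al = lam the expression is u(L t) / L. *)
Lemma ml2_le1 lam t : 12 <= lam -> 0 <= t -> `|t * mittag_leffler al 2 (- (lam * t `^ al))| <= 1.
Proof.
move=> l12 t0; have l0 : 0 < lam by exact: lt_le_trans l12.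
pose L := lam `^ al^-1; have L0 : 0 < L by exact: powR_gt0.
have LE : L `^ al = lam by rewrite -powRrM mulVf ?gt_eqF// powRr1// ltW.
have L12 : 12 <= L `^ al by rewrite LE.
have := @ml2_le_pow (L * t) L L12 L0 (mulr_ge0 (ltW L0) t0).
rewrite /u powRr1 ?mulr_ge0 ?(ltW L0)// powRM ?(ltW L0)// LE.
rewrite (_ : 1 + 1 = 2 :> R)// -mittag_lefflerE -mulrA normrM gtr0_norm//.
by rewrite -[leRHS]mulr1 ler_pM2l.
Qed.

End MittagLeffler.

(** * The Bessel function J_0 and its zeros *)

Section Bessel.
Context {R : realType}.
Implicit Types (x y z a b : R) (k m n : nat).
Notation J := (@bessel_J0 R).

Definition bessel_coef k : R := (-1) ^+ k / k`!%:R ^+ 2.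

Lemma bessel_J0E x : J x = psum bessel_coef ((x / 2) ^+ 2).
Proof.
rewrite /bessel_J0 /psum; congr (limn _); congr series; apply/funext => k.
by rewrite exprM.
Qed.

Lemma entire_bessel : entire bessel_coef.
Proof.
apply: (@le_entire _ _ _ 1 1 _ _ _ entire_invfact) => // k.
rewrite expr1n !mul1r /bessel_coef normrM normrX normrN1 expr1n mul1r.
rewrite !ger0_norm ?invr_ge0 ?exprn_ge0// lef_pV2 ?posrE ?exprn_gt0 ?ltr0n ?fact_gt0//.
by rewrite expr2 ler_peMl// ler1n fact_gt0.
Qed.

(** J_0' = - J_1, in the form given by differentiating the series in (x / 2)^2. *)
Definition bessel_J0' x : R := psum (pseries_diffs bessel_coef) ((x / 2) ^+ 2) * (x / 2).
Notation D := bessel_J0'.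

Let is_derive_sq x : is_derive x 1 (fun x => (x / 2) ^+ 2) (x / 2).
Proof. by apply: is_derive_eq; rewrite /GRing.scale/=; field. Qed.

Lemma is_derive_bessel_J0 x : is_derive x 1 J (D x).
Proof.
rewrite (_ : J = fun x => psum bessel_coef ((x / 2) ^+ 2)); last exact/funext/bessel_J0E.
apply: (@is_derive_chain R (fun x => (x / 2) ^+ 2) _ x _ _ _ _ (is_derive_sq x)) => //.
by apply: is_derive_psum; exact: entire_bessel.
Qed.

(** Bessel's equation in divergence form. Two Euler operators multiply the coefficients by k^2, and
    k^2 / k!^2 = 1 / (k - 1)!^2 shifts the series by one index. *)
Lemma is_derive_bessel_xJ0' x : is_derive x 1 (fun x => x * D x) (- (x * J x)).
Proof.
have cd := entire_diffs entire_bessel.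
pose d k := k%:R * bessel_coef k.
have cd' : entire d.
  apply: (@le_entire _ bessel_coef _ 1 2) => //; last exact: entire_bessel.
  by move=> k; rewrite normrM mul1r ger0_norm// ler_wpM2r// -natrX ler_nat ltnW// ltn_expl.
have E y : y * D y = 2 * psum d ((y / 2) ^+ 2).
  rewrite -psum_scale_diffs; last exact: entire_bessel.
  by rewrite /D; move: (psum _ _) => p; field.
rewrite (_ : (fun x => x * D x) = fun y => 2 * psum d ((y / 2) ^+ 2)); last exact/funext.
have dd : is_derive x 1 (fun x => psum d ((x / 2) ^+ 2)) (psum (pseries_diffs d) ((x / 2) ^+ 2) * (x / 2)).
  apply: (@is_derive_chain R (fun x => (x / 2) ^+ 2) _ x _ _ _ _ (is_derive_sq x)) => //.
  exact: is_derive_psum.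
have -> : - (x * J x) = 2 * (psum (pseries_diffs d) ((x / 2) ^+ 2) * (x / 2)).
  rewrite (_ : pseries_diffs d = fun k => -1 * bessel_coef k); last first.
    apply/funext => k; rewrite /pseries_diffs /d /bessel_coef factS natrM exprMn exprS.
    have k0 : k.+1%:R != 0 :> R by rewrite pnatr_eq0.
    have f0 : k`!%:R != 0 :> R by rewrite pnatr_eq0 -lt0n fact_gt0.
    by move: (_ ^+ k) (k.+1%:R) (k`!%:R) k0 f0 => p q r q0 r0; field; rewrite q0 r0.
  by rewrite psumZ ?bessel_J0E; [move: (psum _ _) => p; field|exact: entire_bessel].
exact: is_deriveZ.
Qed.

Lemma bessel_J0_0 : J 0 = 1.
Proof.
rewrite bessel_J0E mul0r expr0n psum0; last exact: entire_bessel.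
by rewrite /bessel_coef expr0 fact0 expr1n divr1.
Qed.

Lemma bessel_J0'0 : D 0 = 0. Proof. by rewrite /D mul0r mulr0. Qed.

Lemma continuous_bessel_J0 : continuous J.
Proof.
move=> x; apply/differentiable_continuous/derivable1_diffP.
by have [] := is_derive_bessel_J0 x.
Qed.

Lemma continuous_bessel_J0' : continuous D.
Proof.
move=> x; apply: cvgM; last by apply: cvgM; [exact: cvg_id|exact: cvg_cst].
apply: (@continuous_comp _ _ _ (fun x : R => (x / 2) ^+ 2)); last first.
  by apply: continuous_psum; apply: entire_diffs; exact: entire_bessel.
by apply: cvgM; (apply: cvgM; [exact: cvg_id|exact: cvg_cst]).
Qed.

Lemma is_derive_bessel_J0' x : 0 < x -> is_derive x 1 D (- (J x + D x / x)).
Proof.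
move=> x0; have xn0 : x != 0 by rewrite gt_eqF.
have E : {near x, (fun y => y^-1 * (y * D y)) =1 D}.
  near=> y; rewrite mulKf// gt_eqF//; near: y; exact: lt_nbhsr.
apply: (near_eq_is_derive E).
have d := is_derive_bessel_xJ0' x.
have di : is_derive x 1 (fun y : R => y^-1) (- x ^- 2).
  by have := is_deriveV xn0 (is_derive_id x 1); rewrite /GRing.scale/= mulr1.
apply: is_derive_eq; rewrite /GRing.scale/=.
by move: (J x) (D x) => p q; field.
Unshelve. all: by end_near. Qed.

Let nondec (F f : R -> R) a b : a <= b -> continuous F -> (forall x, a < x < b -> is_derive x 1 F (f x)) ->
  (forall x, a < x < b -> 0 <= f x) -> F a <= F b.
Proof. by move=> ab cF; apply: ge0_nondecreasing_itv => //; exact: within_continuous. Qed.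

(** By Bessel's equation the derivative of D^2 + J^2 is - 2 D^2 / z. *)
Let energy_noninc x y : 0 <= x <= y -> D y ^+ 2 + J y ^+ 2 <= D x ^+ 2 + J x ^+ 2.
Proof.
move=> /andP[x0 xy]; rewrite -lerN2.
apply: (@nondec (fun z => - (D z ^+ 2 + J z ^+ 2)) (fun z => 2 * D z ^+ 2 / z) x y xy).
- have cD := continuous_bessel_J0'; have cJ := continuous_bessel_J0.
  by move=> z; apply: cvgN; apply: cvgD; apply: cvgM; [exact: cD|exact: cD|exact: cJ|exact: cJ].
- move=> z /andP[xz _]; have z0 : 0 < z by exact: le_lt_trans xz.
  have dD := is_derive_bessel_J0' z0; have dJ := is_derive_bessel_J0 z.
  apply: is_derive_eq; rewrite /GRing.scale/=; move: (J z) (D z) => p q; field.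
  by rewrite gt_eqF.
move=> z /andP[xz _]; have z0 : 0 < z by exact: le_lt_trans xz.
by apply: divr_ge0; [rewrite mulr_ge0// sqr_ge0|exact: ltW].
Qed.

Lemma bessel_energy_le1 x : 0 <= x -> D x ^+ 2 + J x ^+ 2 <= 1.
Proof.
move=> x0; have := @energy_noninc 0 x; rewrite lexx x0 bessel_J0_0 bessel_J0'0 => /(_ isT).
by rewrite expr0n/= add0r expr1n.
Qed.

Lemma bessel_J0_le1 x : 0 <= x -> `|J x| <= 1.
Proof.
move=> /bessel_energy_le1 H; rewrite -(@ler_pXn2r _ 2) ?nnegrE// expr1n real_normK ?num_real//.
by apply: le_trans H; rewrite lerDr sqr_ge0.
Qed.

Let cxD : continuous (fun x => x * D x).
Proof. by move=> x; apply: cvgM; [exact: cvg_id|exact: continuous_bessel_J0']. Qed.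

(** (x J')' = - x J >= - x because |J| <= 1; integrate from 0. *)
Let bessel_J0'_ge x : 0 <= x -> - (x / 2) <= D x.
Proof.
rewrite le_eqVlt => /predU1P[<-|x0]; first by rewrite mul0r oppr0 bessel_J0'0.
have cx : continuous (fun x : R => x * (x / 2)).
  by move=> z; apply: cvgM; [exact: cvg_id|apply: cvgM; [exact: cvg_id|exact: cvg_cst]].
have : 0 * D 0 + 0 * (0 / 2) <= x * D x + x * (x / 2).
  apply: (@nondec (fun x => x * D x + x * (x / 2)) (fun x => - (x * J x) + x) 0 x (ltW x0)).
  - by move=> z; apply: cvgD; [exact: cxD|exact: cx].
  - move=> z _; have d := is_derive_bessel_xJ0' z.
    have d2 : is_derive z 1 (fun x : R => x * (x / 2)) z.
      by apply: is_derive_eq; rewrite /GRing.scale/=; field.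
    exact: is_deriveD.
  move=> z /andP[z0 _]; have := bessel_J0_le1 (ltW z0).
  rewrite ler_norml => /andP[_ J1]; rewrite addrC subr_ge0 ler_piMr//; exact: ltW.
by rewrite !mul0r addr0 -mulrDr pmulr_rge0// -lerBlDr sub0r.
Qed.

Lemma bessel_J0_ge x : 0 <= x -> 1 - (x / 2) ^+ 2 <= J x.
Proof.
move=> x0; have : J 0 + (0 / 2) ^+ 2 <= J x + (x / 2) ^+ 2.
  apply: (@nondec (fun x => J x + (x / 2) ^+ 2) (fun x => D x + x / 2) 0 x x0).
  - move=> z; apply: cvgD; first exact: continuous_bessel_J0.
    by apply: cvgM; (apply: cvgM; [exact: cvg_id|exact: cvg_cst]).
  - move=> z _; have d := is_derive_bessel_J0 z; have d2 := is_derive_sq z.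
    exact: is_deriveD.
  by move=> z /andP[z0 _]; rewrite -lerBlDr sub0r; apply: bessel_J0'_ge; exact: ltW.
by rewrite bessel_J0_0 mul0r expr0n/= addr0 lerBlDr.
Qed.

Lemma bessel_zero_ge2 z : 0 < z -> J z = 0 -> 2 <= z.
Proof.
move=> z0 Jz; have := bessel_J0_ge (ltW z0); rewrite Jz subr_le0 => H.
have : 1 <= z / 2.
  rewrite -(@ler_pXn2r _ 2) ?nnegrE ?expr1n// divr_ge0// ltW//.
by rewrite ler_pdivlMr// mul1r.
Qed.

(* w = sqrt(z) J_0(z) solves w'' = - (1 + 1/(4 z^2)) w; the function bounded
   below is w'^2 + w^2, and (w'^2 + w^2) exp(- 1/(4 z)) increases. *)
Lemma bessel_energy_ge z : 1 <= z ->
  3^-1 <= z * D z ^+ 2 + J z * D z + J z ^+ 2 / (4 * z) + z * J z ^+ 2.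
Proof.
move=> z1.
pose G y := (y * D y ^+ 2 + J y * D y + J y ^+ 2 / (4 * y) + y * J y ^+ 2).
pose H y := G y * expR (- (4 * y)^-1).
have dG y : 0 < y -> is_derive y 1 G (- (J y * D y / (2 * y)) - J y ^+ 2 / (4 * y ^+ 2)).
  move=> y0; have y0' : y != 0 by rewrite gt_eqF.
  have dD := is_derive_bessel_J0' y0; have dJ := is_derive_bessel_J0 y.
  have di : is_derive y 1 (fun y : R => (4 * y)^-1) (- (4 * y ^+ 2)^-1).
    have n0 : 4 * y != 0 by rewrite mulf_neq0.
    apply: is_derive_eq; rewrite /GRing.scale/=; field; exact: y0'.
  apply: is_derive_eq; rewrite /GRing.scale/=.
  by move: (J y) (D y) => p q; field.
have dH y : 0 < y -> is_derive y 1 H ((4 * y)^-1 * (D y + J y / (2 * y) - J y) ^+ 2 * expR (- (4 * y)^-1)).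
  move=> y0; have y0' : y != 0 by rewrite gt_eqF.
  have d1 := dG y y0.
  have di : is_derive y 1 (fun y : R => - (4 * y)^-1) ((4 * y ^+ 2)^-1).
    have n0 : 4 * y != 0 by rewrite mulf_neq0.
    apply: is_derive_eq; rewrite /GRing.scale/=; field; exact: y0'.
  have de : is_derive y 1 (fun y : R => expR (- (4 * y)^-1)) (expR (- (4 * y)^-1) * (4 * y ^+ 2)^-1).
    exact: (@is_derive_chain R (fun y : R => - (4 * y)^-1) expR y _ _ _ (is_derive_expR _) di).
  apply: is_derive_eq; rewrite /GRing.scale/=/G.
  by move: (J y) (D y) (expR _) => p q r; field.
have H1 : H 1 <= H z.
  apply: (@ge0_nondecreasing_itv R H _ 1 z z1).
  - apply: derivable_within_continuous => y; rewrite in_itv/= => /andP[y1 _].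
    by have [] := dH y (lt_le_trans ltr01 y1).
  - by move=> y /andP[y1 _]; apply: dH; exact: lt_trans y1.
  move=> y /andP[y1 _]; have y0 := lt_trans ltr01 y1.
  by rewrite mulr_ge0 ?expR_ge0// mulr_ge0 ?sqr_ge0// invr_ge0 mulr_ge0// ltW.
(* G(1) = (D(1) + J(1) / 2)^2 + J(1)^2 with J(1) >= 3/4. The product of 9/16 with the bound 3/4 on
   the exponential at 1 still exceeds 1/3. *)
have G1 : 9 / 16 <= G 1.
  have := bessel_J0_ge ler01; rewrite /G => J1.
  have : 9 / 16 <= J 1 ^+ 2.
    rewrite (_ : 9 / 16 = (3 / 4) ^+ 2); last by field.
    have J1' : 3 / 4 <= J 1 by apply: le_trans J1; lra.
    by move: (J 1) J1' => p p34; nra.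
  by have := sqr_ge0 (D 1 + J 1 / 2); move: (J 1) (D 1) => p q; nra.
have e1 : 3 / 4 <= expR (- (4 * 1)^-1) :> R.
  by apply: le_trans (expR_ge1Dx _); lra.
have e2 : expR (- (4 * z)^-1) <= 1.
  by rewrite -expR0 ler_expR oppr_le0 invr_ge0 mulr_ge0// (le_trans _ z1).
have Gz0 : 0 <= G z.
  have z0 : 0 < z by exact: lt_le_trans z1.
  have -> : G z = z * (D z + J z / (2 * z)) ^+ 2 + z * J z ^+ 2.
    by rewrite /G; move: (J z) (D z) => p q; field; rewrite gt_eqF.
  by rewrite addr_ge0// mulr_ge0 ?sqr_ge0// ltW.
apply: (@le_trans _ _ (H z)); last by rewrite /H ler_piMr.
apply: le_trans H1; apply: (@le_trans _ _ (9 / 16 * (3 / 4))); first by lra.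
by apply: ler_pM => //; lra.
Qed.

Lemma bessel_J0'_zero_ge z : 0 < z -> J z = 0 -> 3^-1 <= z * D z ^+ 2.
Proof.
move=> z0 Jz; have z1 : 1 <= z by apply: le_trans (bessel_zero_ge2 z0 Jz); rewrite ler1n.
by have := bessel_energy_ge z1; rewrite Jz expr0n/= !(mul0r, mulr0) !addr0.
Qed.

(** Between the two zeros there is a critical point c0. The energy D^2 + J^2 decreases, so |J| <= M
    = |J(c0)| after c0, and two integrations of Bessel's equation bound the variation of J from c0
    to z by M (z - c0)^2 / 2. This variation equals M, whence z - c0 >= 1. *)
Lemma bessel_zero_gap y z : 0 < y < z -> J y = 0 -> J z = 0 -> y + 1 <= z.
Proof.
move=> /andP[y0 yz] Jy Jz.
have [c0 /[!in_itv]/= /andP[yc cz] dc] : exists2 x, x \in `]y, z[ & is_derive x 1 J 0.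
  apply: (@Rolle R J y z yz); last by rewrite Jy Jz.
    by move=> x _; have [] := is_derive_bessel_J0 x.
  by apply: within_continuous; exact: continuous_bessel_J0.
have c00 : 0 < c0 by exact: lt_trans yc.
have Dc : D c0 = 0.
  have := is_derive_bessel_J0 c0 => -[_ <-]; by have [_ ->] := dc.
pose M := `|J c0|.
have JM x : c0 <= x -> `|J x| <= M.
  move=> cx; rewrite -(@ler_pXn2r R 2) ?nnegrE ?normr_ge0// /M !real_normK ?num_real//.
  have := @energy_noninc c0 x; rewrite (ltW c00) cx Dc expr0n/= add0r => /(_ isT).
  by apply: le_trans; rewrite lerDr sqr_ge0.
have M0 : 0 < M.
  rewrite /M normr_gt0; apply/eqP => J0.
  have := bessel_J0'_zero_ge c00 J0; rewrite Dc expr0n/= mulr0 leNgt invr_gt0.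
  by rewrite ltr0n.
(* s stands for a sign, encoded by s^2 = 1, so that each estimate covers J and - J at once. *)
have s2 (s : R) x : s ^+ 2 = 1 -> c0 <= x -> - M <= s * J x <= M.
  move=> ss cx; rewrite -ler_norml normrM.
  rewrite (_ : `|s| = 1) ?mul1r ?JM//.
  by apply/eqP; rewrite -(@eqrXn2 _ 2)// expr1n real_normK ?num_real// ss.
have DM (s : R) x : s ^+ 2 = 1 -> c0 < x -> 0 <= M * (x - c0) + s * D x.
  move=> ss cx; have x0 : 0 < x by exact: lt_trans cx.
  have cp : continuous (fun x : R => M * (x * (x - c0))).
    move=> u; apply: cvgM; first exact: cvg_cst.
    by apply: cvgM; [exact: cvg_id|apply: cvgB; [exact: cvg_id|exact: cvg_cst]].
  have : M * (c0 * (c0 - c0)) + s * (c0 * D c0) <= M * (x * (x - c0)) + s * (x * D x).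
    apply: (@nondec (fun x => M * (x * (x - c0)) + s * (x * D x))
      (fun x => M * (2 * x - c0) + s * - (x * J x)) c0 x (ltW cx)).
    - move=> u; apply: cvgD; first exact: cp.
      by apply: cvgM; [exact: cvg_cst|exact: cxD].
    - move=> u _; have d := is_derive_bessel_xJ0' u.
      have d2 : is_derive u 1 (fun x => M * (x * (x - c0))) (M * (2 * u - c0)).
        by apply: is_derive_eq; rewrite /GRing.scale/=; ring.
      apply: is_deriveD; exact: is_deriveZ.
    move=> u /andP[cu ux]; have /andP[_ H] := s2 s u ss (ltW cu).
    have u0 : 0 < u by exact: lt_trans cu.
    have -> : M * (2 * u - c0) + s * - (u * J u) = M * (u - c0) + u * (M - s * J u) by ring.
    by rewrite addr_ge0// mulr_ge0 ?subr_ge0// ltW.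
  rewrite Dc subrr !mulr0 addr0.
  have -> : M * (x * (x - c0)) + s * (x * D x) = x * (M * (x - c0) + s * D x) by ring.
  by rewrite pmulr_rge0.
have JMz (s : R) : s ^+ 2 = 1 -> s * J c0 <= M * ((z - c0) ^+ 2 / 2).
  move=> ss.
  have cp : continuous (fun x : R => M * ((x - c0) ^+ 2 / 2)).
    move=> u; apply: cvgM; first exact: cvg_cst.
    apply: cvgM; last exact: cvg_cst.
    by apply: cvgM; (apply: cvgB; [exact: cvg_id|exact: cvg_cst]).
  have : M * ((c0 - c0) ^+ 2 / 2) + s * J c0 <= M * ((z - c0) ^+ 2 / 2) + s * J z.
    apply: (@nondec (fun x => M * ((x - c0) ^+ 2 / 2) + s * J x)
      (fun x => M * (x - c0) + s * D x) c0 z (ltW cz)).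
    - move=> u; apply: cvgD; first exact: cp.
      by apply: cvgM; [exact: cvg_cst|exact: continuous_bessel_J0].
    - move=> u _; have d := is_derive_bessel_J0 u.
      have d2 : is_derive u 1 (fun x => M * ((x - c0) ^+ 2 / 2)) (M * (u - c0)).
        by apply: is_derive_eq; rewrite /GRing.scale/=; field.
      apply: is_deriveD; exact: is_deriveZ.
    by move=> u /andP[cu ux]; exact: DM.
  by rewrite Jz subrr expr0n/= mul0r mulr0 add0r mulr0 addr0.
have MM : M <= M * ((z - c0) ^+ 2 / 2).
  have [J0|J0] := leP 0 (J c0).
    by have := JMz 1 (expr1n _ _); rewrite mul1r /M ger0_norm.
  have n1 : (-1) ^+ 2 = 1 :> R by rewrite sqrrN expr1n.
  by have := JMz (-1) n1; rewrite mulN1r /M ltr0_norm.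
have zc : 1 <= z - c0.
  have z0 : 0 < z - c0 by rewrite subr_gt0.
  move: MM; rewrite ler_pMr// => H; rewrite -(@ler_pXn2r _ 2) ?nnegrE ?(ltW z0)// expr1n.
  by apply: le_trans H _; rewrite ler_pdivrMr// ler_peMr ?sqr_ge0// ler1n.
by move: zc yc; lra.
Qed.

End Bessel.

(** * Zeros of J_0: existence, enumeration, orthogonality relations *)

Section BesselZeros.
Context {R : realType}.
Notation mu := (@lebesgue_measure R).
Implicit Types (x y z a b : R) (k m n : nat).
Notation J := (@bessel_J0 R).
Notation D := (@bessel_J0' R).

Let nonincr (F f : R -> R) a b : a <= b -> continuous F ->
  (forall x, a < x < b -> is_derive x 1 F (f x)) ->
  (forall x, a < x < b -> f x <= 0) -> F b <= F a.
Proof.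
move=> ab cF dF f0; rewrite -lerN2.
apply: (@ge0_nondecreasing_itv R (fun x => - F x) (fun x => - f x) a b ab).
- by apply: within_continuous => x; apply: cvgN; exact: cF.
- by move=> x xab; have d := dF x xab; exact: is_deriveN.
- by move=> x /f0; rewrite oppr_ge0.
Qed.

Let cJ : continuous J := continuous_bessel_J0.

Let cxD : continuous (fun x => x * D x).
Proof. by move=> x; apply: cvgM; [exact: cvg_id|exact: continuous_bessel_J0']. Qed.

(** If s J stayed positive, s x J' would decrease. Once it is negative, s J drops at least like a
    logarithm and cannot stay positive. If it is never negative, s J is bounded below by a positive
    constant, so s x J' decreases at least linearly and does become negative. *)
Let bessel_not_eventually_pos (s : R) a : 0 < a ->
  (forall x, a <= x -> 0 < s * J x) -> False.
Proof.
move=> a0 Jpos.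
have dK x : is_derive x 1 (fun x => s * (x * D x)) (s * - (x * J x)).
  by have d := is_derive_bessel_xJ0' x; exact: is_deriveZ.
have cK : continuous (fun x => s * (x * D x)).
  by move=> x; apply: cvgM; [exact: cvg_cst|exact: cxD].
have Kdec x y : a <= x -> x <= y -> s * (y * D y) <= s * (x * D x).
  move=> ax xy; apply: (nonincr xy cK (fun z _ => dK z)) => z /andP[xz _].
  have z0 : 0 < z by apply: lt_trans xz; exact: lt_le_trans ax.
  rewrite mulrN oppr_le0 mulrCA mulr_ge0 ?(ltW z0)// ltW// Jpos//.
  by apply: ltW; exact: le_lt_trans xz.
have csJ : continuous (fun x => s * J x).
  by move=> x; apply: cvgM; [exact: cvg_cst|exact: cJ].
have dsJ x : is_derive x 1 (fun x => s * J x) (s * D x).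
  by have d := is_derive_bessel_J0 x; exact: is_deriveZ.
have [[x0 [ax0 Dx0]]|H] := pselect (exists x, a <= x /\ s * D x < 0).
  have x00 : 0 < x0 by exact: lt_le_trans ax0.
  pose k := - (s * (x0 * D x0)).
  have k0 : 0 < k by rewrite /k mulrCA -mulrN mulr_gt0// oppr_gt0.
  (* At this y the logarithmic decrease k ln(y / x0) equals s J(x0), which forces s J(y) <= 0. *)
  pose y := x0 * expR (s * J x0 / k).
  have y0 : 0 < y by rewrite mulr_gt0// expR_gt0.
  have xy : x0 <= y.
    rewrite /y ler_peMr ?(ltW x00)// -expR0 ler_expR divr_ge0 ?(ltW k0)//.
    exact/ltW/Jpos.
  have : s * J y + k * ln y <= s * J x0 + k * ln x0.
    rewrite -lerN2.
    apply: (@ge0_nondecreasing_itv R (fun x => - (s * J x + k * ln x))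
      (fun x => - (s * D x + k * x^-1)) x0 y xy).
    - apply: derivable_within_continuous => z; rewrite in_itv/= => /andP[xz _].
      have z0 : 0 < z by exact: lt_le_trans xz.
      have d1 := dsJ z; have d2 := is_derive1_ln z0.
      suff [] : is_derive z 1 (fun x => - (s * J x + k * ln x)) (- (s * D z + k * z^-1)) by [].
      by apply: is_derive_eq.
    - move=> z /andP[xz _].
      have z0 : 0 < z by exact: lt_trans xz.
      have d1 := dsJ z; have d2 := is_derive1_ln z0.
      by apply: is_derive_eq.
    move=> z /andP[xz _]; have z0 : 0 < z by exact: lt_trans xz.
    have := Kdec x0 z ax0 (ltW xz); rewrite -[X in _ <= X]opprK -/k => H.
    rewrite oppr_ge0 -(ler_pM2l z0) mulr0.
    rewrite (_ : z * _ = s * (z * D z) + k); last by field; rewrite gt_eqF.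
    by rewrite -lerBrDr sub0r.
  rewrite /y lnM ?posrE ?expR_gt0// expRK mulrDr [k * (_ / k)]mulrC divfK ?gt_eqF//.
  have := Jpos y (le_trans ax0 xy); rewrite -/y.
  by move: (s * J y) (s * J x0) (k * ln x0) => p q r; lra.
have D0 x : a <= x -> 0 <= s * D x.
  by move=> ax; rewrite leNgt; apply/negP => D0; apply: H; exists x.
pose m := s * J a; have m0 : 0 < m by exact: Jpos.
have mJ x : a <= x -> m <= s * J x.
  move=> ax; apply: (@ge0_nondecreasing_itv R (fun x => s * J x) (fun x => s * D x) a x ax).
  - exact: within_continuous.
  - by move=> z /andP[az _]; apply: D0; exact: ltW.
(* Over this length the linear decrease a m l exceeds the initial value s a D(a). *)
pose l := s * (a * D a) / (a * m) + 1.
have am : 0 < a * m by exact: mulr_gt0.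
have l0 : 0 < l.
  by rewrite ltr_pwDr// divr_ge0 ?(ltW am)// mulrCA mulr_ge0 ?(ltW a0) ?D0.
have al : a <= a + l by rewrite lerDl ltW.
have : s * ((a + l) * D (a + l)) + a * m * (a + l) <= s * (a * D a) + a * m * a.
  apply: (@nonincr (fun x => s * (x * D x) + a * m * x)
    (fun x => s * - (x * J x) + a * m) a (a + l) al).
  - move=> x; apply: cvgD; first exact: cK.
    by apply: cvgM; [exact: cvg_cst|exact: cvg_id].
  - move=> x _; have d := dK x.
    have d2 : is_derive x 1 (fun x : R => a * m * x) (a * m).
      by apply: is_derive_eq; rewrite /GRing.scale/= mulr1.
    exact: is_deriveD.
  move=> x /andP[ax _]; rewrite mulrN mulrCA addrC subr_le0.
  by apply: ler_pM; rewrite ?(ltW a0) ?(ltW m0) ?(ltW ax)//; apply: mJ; exact: ltW.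
have := D0 (a + l) al; rewrite -(pmulr_rge0 _ (ltr_wpDl (ltW l0) a0 : 0 < l + a)) addrC mulrCA.
have : a * m * l = s * (a * D a) + a * m.
  by rewrite /l mulrDr mulr1 mulrC divfK// gt_eqF.
by rewrite (mulrDr _ a l); move: (a * m) (a * m * l) am (s * _) (s * _) (a * m * a) => p q p0 r w v; lra.
Qed.

Lemma bessel_zero_unbounded a : exists2 z, a < z & J z = 0.
Proof.
apply: contrapT => H.
have nz x : a < x -> J x != 0 by move=> ax; apply/eqP => Jx; apply: H; exists x.
pose A := Num.max a 0 + 1.
have A0 : 0 < A by rewrite ltr_wpDl// le_max lexx orbT.
have aA : a < A by rewrite ltr_pwDr// le_max lexx.
have s2 (s : R) x : s * J A > 0 -> A <= x -> 0 < s * J x.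
  move=> sA Ax; rewrite ltNge; apply/negP => sx.
  have s0 : s != 0 by apply: contraTneq sA => ->; rewrite mul0r ltxx.
  have cw : {within `[A, x], continuous (fun x => s * J x)}.
    by apply: within_continuous => z; apply: cvgM; [exact: cvg_cst|exact: cJ].
  have [|c] := @IVT R (fun x => s * J x) A x 0 Ax cw.
    by rewrite ge_min le_max sx (ltW sA) !orbT.
  rewrite in_itv/= => /andP[Ac _] /eqP; rewrite mulf_eq0 (negbTE s0)/=.
  by apply/negP; apply: nz; exact: lt_le_trans Ac.
have [JA|JA|JA] := ltgtP 0 (J A).
- by apply: (@bessel_not_eventually_pos 1 A A0) => x Ax; apply: s2; rewrite ?mul1r.
- by apply: (@bessel_not_eventually_pos (-1) A A0) => x Ax; apply: s2; rewrite ?mulN1r ?oppr_gt0.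
- by have := nz A aA; rewrite -JA eqxx.
Qed.

(** A zero at distance less than 1 from the infimum of the zeros beyond a is the first of them, by
    [bessel_zero_gap]. *)
Lemma bessel_next_zero a : 0 <= a ->
  exists z, [/\ a < z, J z = 0 & forall x, a < x < z -> J x <> 0].
Proof.
move=> a0; have [z0 az0 Jz0] := bessel_zero_unbounded a.
pose S := [set z | a < z /\ J z = 0].
have S0 : S !=set0 by exists z0.
have hS : has_inf S by split=> //; exists a => z [/ltW].
have [z [az Jz] zi] := inf_adherent (ltr01 : 0 < 1 :> R) hS.
exists z; split=> // x /andP[ax xz] Jx.
have ix : inf S <= x by apply: ge_inf => //; exists a => y [/ltW].
have := @bessel_zero_gap R x z; rewrite xz (le_lt_trans a0 ax) => /(_ isT Jx Jz).
by move: ix zi; move: (inf S) => i; lra.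
Qed.

(** The zero gamma_(k+1), obtained by repeatedly choosing the next one; the recursion gives access
    to induction, which the counting definition [bessel_J0_zero] does not. *)
Fixpoint bessel_zeta k : R :=
  xget 0 [set z | [/\ (if k is k'.+1 then bessel_zeta k' else 0) < z, J z = 0 &
    forall x, (if k is k'.+1 then bessel_zeta k' else 0) < x < z -> J x <> 0]].
Notation zeta := bessel_zeta.

Let zetaP k : let a := if k is k'.+1 then zeta k' else 0 in
  0 <= a -> [/\ a < zeta k, J (zeta k) = 0 & forall x, a < x < zeta k -> J x <> 0].
Proof.
move=> a a0; have [z Hz] := bessel_next_zero a0.
by case: k @a a0 Hz => [|k] a a0 Hz /=; case: xgetP => [y _ //|/(_ z)].
Qed.

Let zeta_gt0 k : 0 < zeta k.
Proof.
elim: k => [|k IH]; first by have [] := @zetaP 0%N (lexx _).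
by have [H _ _] := @zetaP k.+1 (ltW IH); exact: lt_trans H.
Qed.

Lemma bessel_J0_zeta k : J (zeta k) = 0.
Proof. by case: k => [|k]; [have [] := @zetaP 0%N (lexx _)|have [] := @zetaP k.+1 (ltW (zeta_gt0 k))]. Qed.

Let zeta_next k : zeta k < zeta k.+1 /\ forall x, zeta k < x < zeta k.+1 -> J x <> 0.
Proof. by have [] := @zetaP k.+1 (ltW (zeta_gt0 k)). Qed.

(** The first zero is at least 2 and consecutive zeros are at distance at least 1. *)
Lemma bessel_zeta_ge k : k.+2%:R <= zeta k.
Proof.
elim: k => [|k IH]; first exact: bessel_zero_ge2 (zeta_gt0 0%N) (bessel_J0_zeta 0%N).
rewrite -natr1; apply: le_trans (lerD IH (lexx 1)) _; apply: bessel_zero_gap; try exact: bessel_J0_zeta.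
by rewrite zeta_gt0; have [] := zeta_next k.
Qed.

Lemma bessel_zeta_lt j k : (j < k)%N -> zeta j < zeta k.
Proof.
elim: k => // k IH; rewrite ltnS leq_eqVlt => /predU1P[->|/IH].
  by have [] := zeta_next k.
by move=> /lt_trans; apply; have [] := zeta_next k.
Qed.

Let zeta_inj : injective zeta.
Proof.
move=> j k; have [jk|kj|//] := ltngtP j k.
  by have := bessel_zeta_lt jk => + E; rewrite E ltxx.
by have := bessel_zeta_lt kj => + E; rewrite E ltxx.
Qed.

Let zeta_cover k : [set x | (0 < x <= zeta k)%R /\ J x = 0] = zeta @` `I_k.+1.
Proof.
apply/seteqP; split => [x [/andP[x0 xk] Jx]|x [j/= jk <-]]; last first.
  split; last exact: bessel_J0_zeta.
  rewrite zeta_gt0/=; move: jk; rewrite ltnS leq_eqVlt => /predU1P[->//|].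
  by move=> /bessel_zeta_lt/ltW.
elim: k xk => [|k IH] xk.
  exists 0%N => //; apply/eqP; rewrite eq_le xk andbT leNgt; apply/negP => xz.
  have [_ _ /(_ x)] := @zetaP 0%N (lexx _).
  by rewrite x0 xz => /(_ isT); apply.
have [xk'|kx] := leP x (zeta k).
  by have [j/= jk <-] := IH xk'; exists j => //=; exact: leqW.
exists k.+1 => //=; apply/eqP; rewrite eq_le xk andbT leNgt; apply/negP => xz.
by have [_ /(_ x)] := zeta_next k; rewrite kx xz => /(_ isT); apply.
Qed.

Let zeta_spec k : [/\ 0 < zeta k, J (zeta k) = 0 &
  ([set x | (0 < x <= zeta k)%R /\ J x = 0] #= `I_k.+1)%card].
Proof.
split; [exact: zeta_gt0|exact: bessel_J0_zeta|rewrite zeta_cover].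
by apply: inj_card_eq => i j _ _; exact: zeta_inj.
Qed.

(** Every positive zero is some zeta j, and []0, zeta j]] contains exactly j + 1 zeros, so the count
    determines j. *)
Lemma bessel_J0_zeroE k : bessel_J0_zero k.+1 = zeta k.
Proof.
rewrite /bessel_J0_zero; case: xgetP => [z _ [z0 Jz Hz]|/(_ (zeta k))]; last first.
  by case; exact: zeta_spec.
pose n := Num.truncn z.
have zn : z <= zeta n.
  apply: le_trans (bessel_zeta_ge n); apply/ltW; apply: (@lt_trans _ _ n.+1%:R).
    by rewrite truncnS_gt.
  by rewrite ltr_nat.
have : [set x | (0 < x <= zeta n)%R /\ J x = 0] z by rewrite /= z0 zn.
rewrite zeta_cover => -[j _ zj]; rewrite -zj; congr zeta.
move: Hz; rewrite -zj => Hz; have [_ _ Hj] := zeta_spec j.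
have := card_eq_trans (card_esym Hj) Hz.
by move=> /card_eq_II; case.
Qed.

Let is_derive_scale (F : R -> R) (f a x : R) : is_derive (a * x) 1 F f ->
  is_derive x 1 (fun x => F (a * x)) (a * f).
Proof.
move=> dF; apply: (@is_derive_chain R (fun x => a * x) F x _ a _ dF); last by rewrite mulrC.
by apply: is_derive_eq; rewrite /GRing.scale/= mulr1.
Qed.

Let cscale (F : R -> R) a : continuous F -> continuous (fun x => F (a * x)).
Proof.
move=> cF x; apply: (@continuous_comp _ _ _ (fun x : R => a * x)); last exact: cF.
by apply: cvgM; [exact: cvg_cst|exact: cvg_id].
Qed.

(* ((z J')^2 + z^2 J^2)' = 2 z J^2 *)
Lemma bessel_sqnorm a : 0 < a -> J a = 0 ->
  (\int[mu]_(x in `[0%R, 1%R]) (x * J (a * x) ^+ 2)%:E)%E = (D a ^+ 2 / 2)%:E.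
Proof.
move=> a0 Ja.
pose F x := ((a * x * D (a * x)) ^+ 2 + (a * x) ^+ 2 * J (a * x) ^+ 2) / (2 * a ^+ 2).
have -> : D a ^+ 2 / 2 = F 1 - F 0.
  rewrite /F !mulr1 !mulr0 mul0r Ja expr0n/= mul0r mulr0 !addr0 mul0r subr0.
  by move: (D a) => p; field; rewrite gt_eqF.
have cid : continuous (fun x : R => x) by move=> x; exact: cvg_id.
have c1 := @cscale _ a cxD; have c2 := @cscale _ a cJ; have c3 := @cscale _ a cid.
apply: FTC2_within => //.
- apply: within_continuous => x; apply: cvgM; last exact: cvg_cst.
  apply: cvgD; first by apply: cvgM; exact: c1.
  by apply: cvgM; apply: cvgM; [exact: c3|exact: c3|exact: c2|exact: c2].
- apply: within_continuous => x; apply: cvgM; first exact: cvg_id.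
  by apply: cvgM; exact: c2.
move=> x _.
have d1 := is_derive_scale (is_derive_bessel_xJ0' (a * x)).
have d2 := is_derive_scale (is_derive_bessel_J0 (a * x)).
apply: is_derive_eq; rewrite /GRing.scale/=.
by move: (J (a * x)) (D (a * x)) => p q; field; rewrite gt_eqF.
Qed.

Lemma bessel_orthogonal a b : a ^+ 2 != b ^+ 2 -> J a = 0 -> J b = 0 ->
  (\int[mu]_(x in `[0%R, 1%R]) (x * (J (a * x) * J (b * x)))%:E)%E = 0%E.
Proof.
move=> ab Ja Jb.
(* A Wronskian of the two scaled Bessel functions; it vanishes at 1 because a and b are zeros, and
   at 0 because of the factor x. *)
pose F x := (J (a * x) * (b * x * D (b * x)) - a * x * D (a * x) * J (b * x)) / (a ^+ 2 - b ^+ 2).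
have -> : 0%E = (F 1 - F 0)%:E by rewrite /F !mulr1 !mulr0 !mul0r Ja Jb !(mul0r, mulr0) !(subrr, mul0r).
have c1 := @cscale _ a cxD; have c2 := @cscale _ a cJ.
have c3 := @cscale _ b cxD; have c4 := @cscale _ b cJ.
apply: FTC2_within => //.
- apply: within_continuous => x; apply: cvgM; last exact: cvg_cst.
  by apply: cvgB; apply: cvgM; [exact: c2|exact: c3|exact: c1|exact: c4].
- apply: within_continuous => x; apply: cvgM; first exact: cvg_id.
  by apply: cvgM; [exact: c2|exact: c4].
move=> x _.
have d1 := is_derive_scale (is_derive_bessel_xJ0' (a * x)).
have d2 := is_derive_scale (is_derive_bessel_J0 (a * x)).
have d3 := is_derive_scale (is_derive_bessel_xJ0' (b * x)).
have d4 := is_derive_scale (is_derive_bessel_J0 (b * x)).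
apply: is_derive_eq; rewrite /GRing.scale/=.
move: (J (a * x)) (D (a * x)) (J (b * x)) (D (b * x)) => p q r s; field.
by rewrite subr_eq0.
Qed.

End BesselZeros.

(** * Weighted L2 spaces *)

Section WeightedL2.
Context d (T : measurableType d) {R : realType} (mu : {measure set T -> \bar R}).
Variables (D : set T) (w : T -> R).
Hypotheses (mD : measurable D) (finD : (mu D < +oo)%E).
Hypotheses (mw : measurable_fun D w) (w01 : forall x, D x -> 0 <= w x <= 1).
Implicit Types (f g h : T -> R) (r s : R).

(** The data, the modes and their finite combinations are bounded, which on a set of finite measure
    makes all their inner products integrable. *)
Definition bounded_mfun f :=
  measurable_fun D f /\ exists M, forall x, D x -> `|f x| <= M.

Lemma bounded_mfun_ge0 f : bounded_mfun f ->
  exists M, 0 <= M /\ forall x, D x -> `|f x| <= M.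
Proof.
move=> [_ [M fM]]; exists `|M|; split=> // x /fM /le_trans; apply; exact: ler_norm.
Qed.

Lemma bounded_mfunD f g : bounded_mfun f -> bounded_mfun g ->
  bounded_mfun (fun x => f x + g x).
Proof.
move=> [mf [M fM]] [mg [N gN]]; split; first exact: measurable_funD.
by exists (M + N) => x Dx; apply: le_trans (ler_normD _ _) _; rewrite lerD ?fM ?gN.
Qed.

Lemma bounded_mfunM f g : bounded_mfun f -> bounded_mfun g ->
  bounded_mfun (fun x => f x * g x).
Proof.
move=> bf bg; have [M [M0 fM]] := bounded_mfun_ge0 bf; have [N [N0 gN]] := bounded_mfun_ge0 bg.
case: bf bg => mf _ [mg _]; split; first exact: measurable_funM.
by exists (M * N) => x Dx; rewrite normrM ler_pM ?fM ?gN.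
Qed.

Lemma bounded_mfun_cst r : bounded_mfun (fun=> r).
Proof. by split; [exact: measurable_cst|exists `|r|]. Qed.

Lemma bounded_mfunZ r f : bounded_mfun f -> bounded_mfun (fun x => r * f x).
Proof. by move=> bf; apply: bounded_mfunM => //; exact: bounded_mfun_cst. Qed.

Lemma bounded_mfunB f g : bounded_mfun f -> bounded_mfun g ->
  bounded_mfun (fun x => f x - g x).
Proof.
move=> bf bg; have := bounded_mfunD bf (bounded_mfunZ (-1) bg).
by congr bounded_mfun; apply/funext => x; rewrite mulN1r.
Qed.

Lemma bounded_mfun_sum (I : Type) (F : seq I) (c : I -> R) (e : I -> T -> R) :
  (forall i, bounded_mfun (e i)) -> bounded_mfun (fun x => \sum_(i <- F) c i * e i x).
Proof.
move=> be; elim: F => [|i F IH].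
  have := bounded_mfun_cst 0; congr bounded_mfun; apply/funext => x.
  by rewrite big_nil.
have := bounded_mfunD (bounded_mfunZ (c i) (be i)) IH.
by congr bounded_mfun; apply/funext => x; rewrite big_cons.
Qed.

Let bw : bounded_mfun w.
Proof.
split=> //; exists 1 => x /w01 /andP[w0 w1]; by rewrite ger0_norm.
Qed.

Lemma bounded_mfun_integrable f : bounded_mfun f -> mu.-integrable D (EFin \o f).
Proof.
move=> [mf [M fM]]; apply: measurable_bounded_integrable => //.
exists M; split; first exact: num_real.
by move=> x Mx y Dy; exact: le_trans (fM _ Dy) (ltW Mx).
Qed.

Definition wip f g : R := \int[mu]_(x in D) (w x * (f x * g x)).

Let iwip f g : bounded_mfun f -> bounded_mfun g ->
  mu.-integrable D (EFin \o (fun x => w x * (f x * g x))).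
Proof. by move=> bf bg; apply: bounded_mfun_integrable; do 2 apply: bounded_mfunM => //. Qed.

Lemma wipC f g : wip f g = wip g f.
Proof. by apply: eq_Rintegral => x _; rewrite [f x * _]mulrC. Qed.

Lemma wipDl f g h : bounded_mfun f -> bounded_mfun g -> bounded_mfun h ->
  wip (fun x => f x + g x) h = wip f h + wip g h.
Proof.
move=> bf bg bh; rewrite /wip -RintegralD//; [|exact: iwip|exact: iwip].
by apply: eq_Rintegral => x _; rewrite mulrDl mulrDr.
Qed.

Lemma wipZl r f h : bounded_mfun f -> bounded_mfun h ->
  wip (fun x => r * f x) h = r * wip f h.
Proof.
move=> bf bh; rewrite /wip -RintegralZl//; last exact: iwip.
by apply: eq_Rintegral => x _; rewrite -mulrA mulrCA.
Qed.

Lemma wipBl f g h : bounded_mfun f -> bounded_mfun g -> bounded_mfun h ->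
  wip (fun x => f x - g x) h = wip f h - wip g h.
Proof.
move=> bf bg bh; rewrite -[- wip g h]mulN1r -wipZl// -wipDl//; last exact: bounded_mfunZ.
by congr wip; apply/funext => x; rewrite mulN1r.
Qed.

Lemma wip_ge0 f : 0 <= wip f f.
Proof.
apply: Rintegral_ge0 => x /w01 /andP[w0 _].
by rewrite mulr_ge0// -expr2 sqr_ge0.
Qed.

Lemma wip_suml (I : Type) (F : seq I) (c : I -> R) (e : I -> T -> R) h :
  (forall i, bounded_mfun (e i)) -> bounded_mfun h ->
  wip (fun x => \sum_(i <- F) c i * e i x) h = \sum_(i <- F) c i * wip (e i) h.
Proof.
move=> be bh; elim: F => [|i F IH].
  rewrite big_nil -[RHS](mul0r (wip (fun=> 0) h)) -wipZl//; last exact: bounded_mfun_cst.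
  by congr wip; apply/funext => x; rewrite big_nil mul0r.
rewrite big_cons -IH -wipZl// -wipDl//.
- by congr wip; apply/funext => x; rewrite big_cons.
- exact: bounded_mfunZ.
- exact: bounded_mfun_sum.
Qed.

(** Extended-real valued, since the limits constructed below are known only to be measurable. *)
Definition wsq f : \bar R := \int[mu]_(x in D) (w x * f x ^+ 2)%:E.

Lemma wsq_ge0 f : (0 <= wsq f)%E.
Proof.
apply: integral_ge0 => x /w01 /andP[w0 _].
by rewrite lee_fin mulr_ge0// sqr_ge0.
Qed.

Lemma wsqE f : bounded_mfun f -> wsq f = (wip f f)%:E.
Proof.
move=> bf; rewrite /wip /Rintegral fineK; last exact: (integrable_fin_num mD (iwip bf bf)).
by apply: eq_integral => x _; rewrite expr2.
Qed.

Let mwsq f : measurable_fun D f -> measurable_fun D (fun x => (w x * f x ^+ 2)%:E).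
Proof.
move=> mf; apply/measurable_EFinP; apply: measurable_funM => //.
exact: measurable_funX.
Qed.

Let wsq0 f x : D x -> (0 <= (w x * f x ^+ 2)%:E)%E.
Proof. by move=> /w01 /andP[w0 _]; rewrite lee_fin mulr_ge0// sqr_ge0. Qed.

(** Young's inequality: the two sides differ by r^-1 (f - r g)^2. A small r keeps the factor of
    [wsq g] close to 1. *)
Lemma wsqD_le r f g : 0 < r -> measurable_fun D f -> measurable_fun D g ->
  (wsq (fun x : T => f x + g x)%R <= (1 + r^-1)%:E * wsq f + (1 + r)%:E * wsq g)%E.
Proof.
move=> r0 mf mg.
have r1 : 0 <= 1 + r^-1 by rewrite addr_ge0// invr_ge0 ltW.
have r2 : 0 <= 1 + r by rewrite addr_ge0// ltW.
rewrite /wsq -!ge0_integralZl_EFin//; try exact: mwsq; try exact: wsq0.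
rewrite -ge0_integralD//; first last.
- by apply: measurable_funeM; exact: mwsq.
- by move=> x Dx; rewrite mule_ge0 ?lee_fin// -lee_fin wsq0.
- by apply: measurable_funeM; exact: mwsq.
- by move=> x Dx; rewrite mule_ge0 ?lee_fin// -lee_fin wsq0.
apply: ge0_le_integral => //.
- by move=> x; exact: (wsq0 (fun x => f x + g x)).
- by apply: (mwsq (f := fun x => f x + g x)); exact: measurable_funD.
- by apply: emeasurable_funD; apply: measurable_funeM; exact: mwsq.
move=> x /w01 /andP[w0 _]; rewrite -!EFinM -EFinD lee_fin.
rewrite !(mulrCA _ (w x)) -mulrDr ler_wpM2l// -subr_ge0.
have -> : (1 + r^-1) * f x ^+ 2 + (1 + r) * g x ^+ 2 - (f x + g x) ^+ 2 =
    r^-1 * (f x - r * g x) ^+ 2 by move: (f x) (g x) => p q; field; rewrite gt_eqF.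
by rewrite mulr_ge0 ?sqr_ge0// invr_ge0 ltW.
Qed.

Lemma wsqN f : wsq (fun x => - f x) = wsq f.
Proof. by apply: eq_integral => x _; rewrite sqrrN. Qed.

Lemma wsqB_le f g : measurable_fun D f -> measurable_fun D g ->
  (wsq (fun x => f x - g x)%R <= 2%:E * wsq f + 2%:E * wsq g)%E.
Proof.
move=> mf mg; rewrite -(wsqN g) (_ : 2 = 1 + 1^-1 :> R); last by rewrite invr1.
rewrite {2}invr1; apply: (@wsqD_le 1 f (fun x => - g x)) => //.
exact: measurable_funN.
Qed.

(** As w <= 1, w |f| <= (q w f^2 + q^-1) / 2. The choice q = 2^n turns both the bound r 4^-n and the
    measure of D into multiples of 2^-n. *)
Let wL1_le f n r : 0 <= r -> bounded_mfun f -> wip f f <= r * 4^-1 ^+ n ->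
  (\int[mu]_(x in D) (w x * `|f x|)%:E <= ((r + fine (mu D)) / (2 ^ n.+1)%:R)%:E)%E.
Proof.
move=> r0 bf fr; have [mf _] := bf.
pose q : R := 2 ^+ n; have q0 : 0 < q by rewrite exprn_gt0.
have fD : mu D \is a fin_num by rewrite ge0_fin_numE.
apply: (@le_trans _ _ (\int[mu]_(x in D) ((q / 2)%:E * (w x * f x ^+ 2)%:E + (q^-1 / 2)%:E))%E).
  apply: ge0_le_integral => //.
  - by move=> x /w01 /andP[w0 _]; rewrite lee_fin mulr_ge0.
  - by apply/measurable_EFinP; apply: measurable_funM => //; exact: measurableT_comp.
  - by apply: emeasurable_funD => //; apply: measurable_funeM; exact: mwsq.
  move=> x /w01 /andP[w0 w1]; rewrite -EFinM -EFinD lee_fin.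
  have : 0 <= w x * (q / 2 * (`|f x| - q^-1) ^+ 2) + (1 - w x) * (q^-1 / 2).
    have qV : 0 <= q^-1 by rewrite invr_ge0 ltW.
    apply: addr_ge0; first by rewrite mulr_ge0// mulr_ge0 ?sqr_ge0// divr_ge0// ltW.
    by rewrite mulr_ge0 ?subr_ge0// divr_ge0.
  rewrite -(real_normK (num_real (f x))); move: `|f x| (w x) => p v.
  rewrite -[v * p <= _]subr_ge0; congr (0 <= _).
  by field; rewrite gt_eqF.
rewrite ge0_integralD//; first last.
- by move=> x _; rewrite lee_fin divr_ge0// invr_ge0 ltW.
- by apply: measurable_funeM; exact: mwsq.
- by move=> x Dx; rewrite mule_ge0 ?wsq0// lee_fin divr_ge0// ltW.
rewrite ge0_integralZl_EFin//; [|by move=> x; exact: wsq0|exact: mwsq|by rewrite divr_ge0// ltW].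
rewrite -/(wsq f) wsqE// integral_cst// -(fineK fD) -!EFinM -EFinD lee_fin fineK//.
have -> : (2 ^ n.+1)%:R = 2 * q :> R by rewrite natrX exprS.
have q2 : (4^-1 : R) ^+ n = q^-1 * q^-1 by rewrite -invfM -exprMn -natrM exprVn.
apply: (@le_trans _ _ (q / 2 * (r * 4^-1 ^+ n) + q^-1 / 2 * fine (mu D))).
  by rewrite lerD2r ler_wpM2l// divr_ge0// ltW.
rewrite q2; move: (fine _) => v; rewrite le_eqVlt; apply/orP; left; apply/eqP.
by field; rewrite gt_eqF.
Qed.

(* A sequence with square-summable-fast increments converges almost everywhere;
   Fatou transfers distance bounds to the limit. *)
Lemma fast_cauchy_limit (G : nat -> T -> R) : (forall n, bounded_mfun (G n)) ->
  (forall n, wip (fun x => G n.+1 x - G n x) (fun x => G n.+1 x - G n x) <= 4^-1 ^+ n) ->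
  exists2 g : T -> R, measurable_fun D g & forall f B m, bounded_mfun f ->
    (forall n, (m <= n)%N -> wip (fun x => G n x - f x) (fun x => G n x - f x) <= B) ->
    (wsq (fun x => g x - f x)%R <= B%:E)%E.
Proof.
move=> bG G4.
have mG n : measurable_fun D (G n) by case: (bG n).
pose u n x := G n.+1 x - G n x.
have bu n : bounded_mfun (u n) by exact: bounded_mfunB.
pose U n x := (w x * `|u n x|)%:E.
have mU n : measurable_fun D (U n).
  apply/measurable_EFinP; apply: measurable_funM => //; apply: measurableT_comp => //.
  by case: (bu n).
have U0 n x : D x -> (0 <= U n x)%E.
  by move=> /w01 /andP[w0 _]; rewrite lee_fin mulr_ge0.
pose A := 1 + fine (mu D).
have A0 : 0 <= A by rewrite addr_ge0// fine_ge0.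
have iU n : (\int[mu]_(x in D) U n x <= (A / (2 ^ n.+1)%:R)%:E)%E.
  by apply: wL1_le => //; rewrite mul1r; exact: G4.
have iS : (\int[mu]_(x in D) (\sum_(n <oo) U n x) < +oo)%E.
  rewrite integral_nneseries//; apply: (@le_lt_trans _ _ A%:E); last exact: ltry.
  apply: le_trans (epsilon_trick0 xpredT A0); apply: lee_nneseries => // n _ _.
  by apply: integral_ge0 => x; exact: U0.
have mS : measurable_fun D (fun x => \sum_(n <oo) U n x)%E.
  by apply: ge0_emeasurable_sum => // n x Dx _; exact: U0.
have S0 x : D x -> (0 <= \sum_(n <oo) U n x)%E.
  by move=> Dx; apply: nneseries_ge0 => n _ _; exact: U0.
have iS' : mu.-integrable D (fun x => \sum_(n <oo) U n x)%E.
  apply/integrableP; split => //; apply: le_lt_trans iS.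
  rewrite le_eqVlt; apply/orP; left; apply/eqP; apply: eq_integral => x.
  by rewrite inE => Dx; rewrite gee0_abs// S0.
have := integrable_ae mD iS' => ae1.
(* An upper limit is measurable whether or not the sequence converges. *)
pose g x := fine (limn_esup (fun n => (G n x)%:E)).
have mg : measurable_fun D g.
  apply: (@measurableT_comp _ _ _ _ _ _ fine) => //.
  by apply: measurable_fun_limn_esup => n; apply/measurable_EFinP.
exists g => // f B m bf GB; have [mf _] := bf.
(* Convergence is claimed only where w > 0; where w vanishes, so do the integrands below. *)
have cG x : D x -> (\sum_(n <oo) U n x)%E \is a fin_num -> 0 < w x -> G n x @[n --> \oo] --> g x.
  move=> Dx Ux wx.
  have cS : cvgn (series (fun n => u n x)).
    apply: normed_cvg; apply: nondecreasing_is_cvgn.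
      by apply: nondecreasing_series => n _ _; exact: normr_ge0.
    exists (fine (\sum_(n <oo) U n x)%E / w x) => _ [n _ <-].
    rewrite ler_pdivlMr// -lee_fin fineK// mulrC.
    apply: le_trans (nneseries_lim_ge n _); last by move=> k _ _; exact: U0.
    by rewrite /series/= mulr_sumr -sumEFin.
  have cGn : cvgn (fun n => G n x).
    have -> : (fun n => G n x) = (fun n => G 0%N x + series (fun n => u n x) n).
      apply/funext => n; have := eq_sum_telescope (fun n => G n x) n.
      by move=> ->.
    by apply: is_cvgD => //; exact: is_cvg_cst.
  rewrite /g; move/cvg_ex : cGn => [l Gl].
  have GlE : (G n x)%:E @[n --> \oo] --> l%:E by apply: cvg_EFin => //; exact: nearW.
  by have [_ ->] := cvg_limn_einf_sup GlE.
pose h n x := (w x * (G n x - f x) ^+ 2)%:E.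
have mh n : measurable_fun D (h n) by apply: mwsq; exact: measurable_funB.
have h0 n x : D x -> (0 <= h n x)%E by exact: (wsq0 (fun x => G n x - f x)).
have -> : wsq (fun x => g x - f x) = (\int[mu]_(x in D) limn_einf (h ^~ x))%E.
  apply: ge0_ae_eq_integral => //.
  - by apply: mwsq; exact: measurable_funB.
  - rewrite (_ : (fun x => _) = (fun x => - limn_esup (fun n => - h n x))%E)//.
    apply: measurableT_comp => //; apply: measurable_fun_limn_esup => n.
    exact: measurableT_comp.
  - by move=> x; exact: (wsq0 (fun x => g x - f x)).
  - move=> x Dx; rewrite limn_einf_lim; apply: lime_ge; first exact: is_cvg_einfs.
    by apply: nearW => n; apply: le_ereal_inf_tmp => _ [k _ <-]; exact: h0.
  case: ae1 => N0 [mN N00 sN]; exists N0; split => // x /= /not_implyP[Dx nx].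
  apply: sN => /= H; apply: nx; have {}H := H Dx.
  have /andP[w0 _] := w01 Dx.
  have hl : h n x @[n --> \oo] --> (w x * (g x - f x) ^+ 2)%:E.
    apply: cvg_EFin; first exact: nearW.
    move: w0; rewrite le_eqVlt => /predU1P[w0|w0].
      rewrite (_ : fine \o h ^~ x = fun=> w x * (g x - f x) ^+ 2); first exact: cvg_cst.
      by apply/funext => n; rewrite /= -w0 !mul0r.
    have c := cG x Dx H w0.
    apply: cvgM; first exact: cvg_cst.
    by apply: cvgM; (apply: cvgB; [exact: c|exact: cvg_cst]).
  by have [-> _] := cvg_limn_einf_sup hl.
apply: le_trans (fatou mu mD mh h0) _.
rewrite limn_einf_lim; apply: lime_le; first exact: is_cvg_einfs.
exists m => // n /= mn; apply: (@le_trans _ _ (\int[mu]_(x in D) h n x)%E).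
  by apply: ereal_inf_lbound; exists n => /=.
have := GB n mn; rewrite -lee_fin -wsqE//.
exact: bounded_mfunB.
Qed.

(** * Orthogonal systems: Bessel's inequality and the Riesz-Fischer theorem *)

Section Orthogonal.
Variables (I : choiceType) (e : I -> T -> R) (N : I -> R).
Hypotheses (be : forall i, bounded_mfun (e i)).
Hypotheses (eN : forall i, wip (e i) (e i) = N i) (N0 : forall i, 0 < N i).
Hypothesis (eo : forall i j, i != j -> wip (e i) (e j) = 0).
Implicit Types (F : {fset I}) (c : I -> R).

Definition lincomb c F x := \sum_(i <- F) c i * e i x.

Lemma bounded_lincomb c F : bounded_mfun (lincomb c F).
Proof. exact: bounded_mfun_sum. Qed.

Lemma wip_lincomb c F i : i \in F -> wip (lincomb c F) (e i) = c i * N i.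
Proof.
move=> iF; rewrite wip_suml// (big_rem i)//= eN big1_seq ?addr0// => j.
rewrite mem_rem_uniq ?fset_uniq// !inE => /andP[_ /andP[ji _]].
by rewrite eo// mulr0.
Qed.

Lemma wip_lincomb2 c F : wip (lincomb c F) (lincomb c F) = \sum_(i <- F) c i ^+ 2 * N i.
Proof.
rewrite {1}/lincomb wip_suml//; last exact: bounded_lincomb.
apply: eq_big_seq => i iF.
by rewrite wipC wip_lincomb// mulrA.
Qed.

(** In the nonnegative square of f minus its projection s, the inner product of s with f and the
    square of s are the same sum. *)
Lemma bessel_inequality f F : bounded_mfun f ->
  \sum_(i <- F) (wip f (e i) / N i) ^+ 2 * N i <= wip f f.
Proof.
move=> bf; pose c i := wip f (e i) / N i; pose s := lincomb c F.
have bs : bounded_mfun s by exact: bounded_lincomb.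
have fs : wip s f = \sum_(i <- F) c i ^+ 2 * N i.
  rewrite /s /lincomb wip_suml//; apply: eq_bigr => i _.
  by rewrite wipC /c; field; rewrite gt_eqF.
have := wip_ge0 (fun x => f x - s x).
rewrite wipBl//; [|exact: bounded_mfunB].
rewrite [wip f _]wipC [wip s _]wipC !wipBl// [wip f s]wipC fs wip_lincomb2.
by set S := \sum_(i <- F) _; rewrite subrr subr0 subr_ge0.
Qed.

Lemma lincombB c F0 F x : (F0 `<=` F)%fset ->
  lincomb c F x - lincomb c F0 x = lincomb c (F `\` F0)%fset x.
Proof.
move=> FF; rewrite /lincomb (big_fsetID _ (mem F0))/=.
rewrite (_ : [fset x in F | x \in F0]%fset = F0); last first.
  by apply/fsetP => i; rewrite !inE/= andbC andb_idr// => /(fsubsetP FF).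
rewrite addrAC subrr add0r; apply: eq_fbigl => i; by rewrite !inE/= andbC.
Qed.

Section RieszFischer.
Variables (c : I -> R) (B : R).
Hypothesis cB : forall F, \sum_(i <- F) c i ^+ 2 * N i <= B.

(** F0 nearly attains the supremum of the partial sums, so a finite set disjoint from F0 can add at
    most r. *)
Let tail_small r : 0 < r -> exists F0, forall F, (forall i, i \in F -> i \notin F0) ->
  \sum_(i <- F) c i ^+ 2 * N i <= r.
Proof.
move=> r0; pose S := [set \sum_(i <- F) c i ^+ 2 * N i | F in [set: {fset I}]].
have hS : has_sup S.
  split; first by exists (\sum_(i <- fset0) c i ^+ 2 * N i); exists fset0.
  by exists B => _ [F _ <-]; exact: cB.
have [_ [F0 _ <-] HF0] := sup_adherent r0 hS.
exists F0 => F FF0.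
have : \sum_(i <- (F `|` F0)%fset) c i ^+ 2 * N i <= sup S.
  by apply: ub_le_sup; [exact: hS.2|exists (F `|` F0)%fset].
rewrite (big_fsetID _ (mem F0))/=.
rewrite (_ : [fset x in (F `|` F0)%fset | x \in F0]%fset = F0); last first.
  by apply/fsetP => i; rewrite !inE/=; case: (i \in F0); rewrite ?orbT ?andbF.
rewrite (_ : [fset x in (F `|` F0)%fset | x \notin F0]%fset = F); last first.
  apply/fsetP => i; rewrite !inE/=; case: (boolP (i \in F)) => [/FF0 ->//|_].
  by case: (i \in F0).
move: HF0; move: (sup S) => q.
set s1 := \sum_(i <- F0) _; set s2 := \sum_(i <- F) _.
by move: s1 s2 => s1 s2; lra.
Qed.

(** Both combinations are compared with the one over the union; the differences are then tails. *)
Let dist2 F F' r s :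
  (forall K : {fset I}, (forall i, i \in K -> i \notin F) -> \sum_(i <- K) c i ^+ 2 * N i <= r) ->
  (forall K : {fset I}, (forall i, i \in K -> i \notin F') -> \sum_(i <- K) c i ^+ 2 * N i <= s) ->
  wip (fun x => lincomb c F x - lincomb c F' x) (fun x => lincomb c F x - lincomb c F' x)
    <= 2 * r + 2 * s.
Proof.
move=> Fr Fs; pose H := (F `|` F')%fset.
have bl K := bounded_lincomb c K.
have HF K : (K `<=` H)%fset -> wip (fun x => lincomb c H x - lincomb c K x)
    (fun x => lincomb c H x - lincomb c K x) = \sum_(i <- (H `\` K)%fset) c i ^+ 2 * N i.
  move=> KH; rewrite (_ : (fun x => _) = lincomb c (H `\` K)%fset); last first.
    by apply/funext => x; exact: lincombB.
  exact: wip_lincomb2.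
have b1 K : bounded_mfun (fun x => lincomb c H x - lincomb c K x) by exact: bounded_mfunB.
have := @wsqB_le (fun x => lincomb c H x - lincomb c F' x)
  (fun x => lincomb c H x - lincomb c F x) (b1 _).1 (b1 _).1.
rewrite !wsqE//; last exact: bounded_mfunB.
rewrite -!EFinM -EFinD lee_fin !HF ?fsubsetUl ?fsubsetUr//.
rewrite (_ : (fun x => lincomb c H x - lincomb c F' x - (lincomb c H x - lincomb c F x)) =
  fun x => lincomb c F x - lincomb c F' x); last first.
  by apply/funext => x; ring.
move=> /le_trans; apply; rewrite addrC lerD// ler_pM2l//.
  by apply: Fr => i; rewrite !inE => /andP[].
by apply: Fs => i; rewrite !inE => /andP[].
Qed.

Lemma riesz_fischer : exists2 g : T -> R, measurable_fun D g & forall r, 0 < r ->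
  exists F0, forall F, (F0 `<=` F)%fset -> (wsq (fun x => g x - lincomb c F x)%R <= r%:E)%E.
Proof.
(* With tails of this size [dist2] makes the increments of G at most 4^-n. *)
have v0 n : 0 < (8^-1 * 4^-1 ^+ n : R) by rewrite mulr_gt0// exprn_gt0.
have [Fe FeP] := choice (fun n => tail_small (v0 n)).
pose Fn := fix Fn n := if n is n'.+1 then (Fn n' `|` Fe n)%fset else Fe 0%N.
have FeFn n i : i \in Fe n -> i \in Fn n by case: n => //= n iF; rewrite inE iF orbT.
have tF n (K : {fset I}) : (forall i, i \in K -> i \notin Fn n) -> \sum_(i <- K) c i ^+ 2 * N i <= 8^-1 * 4^-1 ^+ n.
  by move=> H; apply: FeP => i /H; apply: contra; exact: FeFn.
pose G n := lincomb c (Fn n).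
have [|n|g mg gG] := @fast_cauchy_limit G.
- by move=> n; exact: bounded_lincomb.
- have H := @dist2 (Fn n.+1) (Fn n) _ _ (tF n.+1) (tF n).
  apply: (le_trans H).
  have p0 : 0 < (4^-1 : R) ^+ n by rewrite exprn_gt0.
  by rewrite exprS; move: (_ ^+ n) p0 => p p0; lra.
exists g => // r r0.
have r4 : 0 < r / 4 by exact: divr_gt0.
have [F0 F0P] := tail_small r4; exists F0 => F FF.
(* From this index on 4^-n <= r, so [dist2] yields at most 2 (r / 8) + 2 (r / 4), which is below
   r. *)
pose m := Num.truncn r^-1.
apply: (gG _ _ m) => [|n mn]; first exact: bounded_lincomb.
have tF' (K : {fset I}) : (forall i, i \in K -> i \notin F) -> \sum_(i <- K) c i ^+ 2 * N i <= r / 4.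
  by move=> H; apply: F0P => i /H; apply: contra; exact: (fsubsetP FF).
apply: le_trans (dist2 (tF n) tF') _.
have : (4^-1 : R) ^+ n <= r.
  rewrite -[r]invrK exprVn lef_pV2 ?posrE ?invr_gt0 ?exprn_gt0//.
  apply: ltW; apply: lt_le_trans (truncnS_gt _) _.
  rewrite -natrX ler_nat; apply: leq_ltn_trans mn _.
  by apply: leq_trans (ltn_expl n (isT : 1 < 4)%N) _.
by move: (_ ^+ n) => p; lra.
Qed.

End RieszFischer.
End Orthogonal.
End WeightedL2.

(** * The modes on the unit square *)

Section PlanarMeasurability.
Context {R : realType}.
Notation mR := (measurableTypeR R).

(** The plane carries the product sigma-algebra, so a relatively open set has to be written as a
    countable union of boxes with rational corners. *)
Lemma within_continuous_measurable (A : set (R * R)) (f : R * R -> R) :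
  measurable (A : set (mR * mR)) -> {within A, continuous f} ->
  measurable_fun (A : set (mR * mR)) f.
Proof.
move=> mA /subspace_continuousP cf _.
apply: (measurability _ (RGenOInfty.measurableE R)) => //.
move=> _ [_ [a ->] <-].
pose box (q : rat * rat * (rat * rat)) : set (R * R) :=
  `]ratr q.1.1, ratr q.1.2[ `*` `]ratr q.2.1, ratr q.2.2[.
pose P (q : rat * rat * (rat * rat)) := forall y, A y -> box q y -> a < f y.
rewrite (_ : _ `&` _ = A `&` \bigcup_(q1 in [set: rat]) \bigcup_(q2 in [set: rat])
  \bigcup_(q3 in [set: rat]) \bigcup_(q4 in [set: rat])
  [set x | P ((q1, q2), (q3, q4)) /\ box ((q1, q2), (q3, q4)) x]).
  apply: measurableI => //.
  apply: bigcupT_measurable_rat => q1; apply: bigcupT_measurable_rat => q2.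
  apply: bigcupT_measurable_rat => q3; apply: bigcupT_measurable_rat => q4.
  have [H|H] := pselect (P ((q1, q2), (q3, q4))).
    rewrite (_ : [set x | _] = box ((q1, q2), (q3, q4))); last first.
      by apply/seteqP; split=> [x []//|x bx]; split; [exact: H|].
    exact: measurableX.
  by rewrite (_ : [set x | _] = set0)//; apply/seteqP; split=> [x []//|].
apply/seteqP; split => [x [Ax]|x [Ax [q1 _ [q2 _ [q3 _ [q4 _ [Pq bx]]]]]]]; last first.
  by split=> //=; rewrite in_itv/= andbT; exact: Pq Ax bx.
rewrite /= in_itv/= andbT => fx; split=> //.
have /= := cf x Ax; move=> /(_ `]a, +oo[%classic) H.
have /H : nbhs (f x) `]a, +oo[%classic.
  by apply: open_nbhs_nbhs; split; [exact: interval_open|rewrite /= in_itv/= fx].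
rewrite /fmap /within/= => /nbhs_ballP[e /= e0 He].
have [q1] : exists q, ratr q \in `]x.1 - e, x.1[ by apply: rat_in_itvoo; rewrite ltrBlDr ltrDl.
rewrite in_itv/= => /andP[q1l q1r].
have [q2] : exists q, ratr q \in `]x.1, x.1 + e[ by apply: rat_in_itvoo; rewrite ltrDl.
rewrite in_itv/= => /andP[q2l q2r].
have [q3] : exists q, ratr q \in `]x.2 - e, x.2[ by apply: rat_in_itvoo; rewrite ltrBlDr ltrDl.
rewrite in_itv/= => /andP[q3l q3r].
have [q4] : exists q, ratr q \in `]x.2, x.2 + e[ by apply: rat_in_itvoo; rewrite ltrDl.
rewrite in_itv/= => /andP[q4l q4r].
exists q1 => //; exists q2 => //; exists q3 => //; exists q4 => //; split; last first.
  by split; rewrite /= in_itv/= ?q1r ?q2l ?q3r ?q4l.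
move=> y Ay [/=]; rewrite !in_itv/= => /andP[y1 y2] /andP[y3 y4].
have := He y; rewrite /= in_itv/= andbT; apply => //.
split; rewrite /ball/= ltr_distlC.
  by rewrite (lt_trans q1l y1) (lt_trans y2 q2r).
by rewrite (lt_trans q3l y3) (lt_trans y4 q4r).
Qed.

Lemma measurable_unit_square : measurable (@unit_square R : set (mR * mR)).
Proof. by apply: measurableX. Qed.

Lemma leb2_unit_square : leb2 (@unit_square R) = 1%E.
Proof.
rewrite /leb2 /unit_square product_measure1E//= lebesgue_measure_itv/= lte01.
by rewrite -EFinB subr0 mule1.
Qed.

Lemma compact_unit_square : compact (@unit_square R).
Proof. by apply: compact_setX; exact: segment_compact. Qed.

Lemma leb2_setX (F G : R -> R) :
  {within `[0, 1], continuous F} -> {within `[0, 1], continuous G} ->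
  (\int[leb2]_(p in unit_square) (F p.1 * G p.2)%:E =
   \int[lebesgue_measure]_(x in `[0%R, 1%R]) (F x)%:E *
   \int[lebesgue_measure]_(y in `[0%R, 1%R]) (G y)%:E)%E.
Proof.
move=> cF cG.
have iF := continuous_integrable cF; have iG := continuous_integrable cG.
pose F' := F \_ `[0, 1]; pose G' := G \_ `[0, 1].
have mF : measurable_fun setT (F' : mR -> mR).
  have m0 : measurable_fun (`[0, 1]%classic : set mR) (F : mR -> mR).
    by apply/measurable_EFinP; exact: (measurable_int lebesgue_measure iF).
  by have := (measurable_restrictT F (measurable_itv _)).1 m0.
have mG : measurable_fun setT (G' : mR -> mR).
  have m0 : measurable_fun (`[0, 1]%classic : set mR) (G : mR -> mR).
    by apply/measurable_EFinP; exact: (measurable_int lebesgue_measure iG).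
  by have := (measurable_restrictT G (measurable_itv _)).1 m0.
pose f (p : mR * mR) := (F' p.1 * G' p.2)%:E.
have mf : measurable_fun setT f.
  apply/measurable_EFinP; apply: measurable_funM.
    exact: (measurableT_comp mF measurable_fst).
  exact: (measurableT_comp mG measurable_snd).
have fE : (fun p => (F p.1 * G p.2)%:E) \_ unit_square = f.
  apply/funext => -[x y]; rewrite /f /F' /G' !patchE/=.
  have -> : ((x, y) \in @unit_square R) = (x \in `[0, 1]%classic) && (y \in `[0, 1]%classic).
    apply/idP/idP => [/set_mem[/= xi yi]|/andP[/set_mem xi /set_mem yi]].
      by apply/andP; split; exact: mem_set.
    exact: mem_set.
  by case: (x \in _); case: (y \in _); rewrite /= ?(mulr0, mul0r).
rewrite integral_mkcond fE.
have [M M0 HM] := continuous_itv_bounded cF; have [N N0 HN] := continuous_itv_bounded cG.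
have fi : (@leb2 R).-integrable setT f.
  rewrite -fE -integrable_mkcond//; last exact: measurable_unit_square.
  apply: measurable_bounded_integrable => //.
  - exact: measurable_unit_square.
  - have Q1 : (leb2 (@unit_square R) < +oo)%E by rewrite leb2_unit_square ltry.
    exact: Q1.
  - apply/measurable_EFinP.
    have := (measurable_restrictT (fun p : mR * mR => (F p.1 * G p.2)%:E) measurable_unit_square).2.
    by rewrite fE => /(_ mf).
  exists (M * N); split; first exact: num_real.
  move=> z Mz [x y] [/=]; rewrite !in_itv/= => xi yi.
  by apply: le_trans (ltW Mz); rewrite normrM ler_pM// ?HM ?HN.
have := @integral12_prod_meas1 _ _ mR mR R lebesgue_measure lebesgue_measure f fi.
rewrite -/leb2 => <-; rewrite [X in (X * _)%E]integral_mkcond [X in (_ * X)%E]integral_mkcond.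
have mI : measurable (`[0%R, 1%R]%classic : set mR) by exact: measurable_itv.
have iF' : lebesgue_measure.-integrable [set: mR] (EFin \o F').
  by have := (integrable_mkcond (mu := lebesgue_measure) (EFin \o F) mI).1 iF; rewrite restrict_EFin.
have iG' : lebesgue_measure.-integrable [set: mR] (EFin \o G').
  by have := (integrable_mkcond (mu := lebesgue_measure) (EFin \o G) mI).1 iG; rewrite restrict_EFin.
rewrite !restrict_EFin -/F' -/G'.
transitivity (\int[lebesgue_measure]_x ((F' x)%:E * \int[lebesgue_measure]_y (G' y)%:E))%E.
  apply: eq_integral => x _; rewrite -integralZl//; exact: eq_integral.
have fG : (\int[lebesgue_measure]_y (G' y)%:E)%E \is a fin_num by exact: integrable_fin_num iG'.
rewrite -(fineK fG); exact: integralZr.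
Qed.

End PlanarMeasurability.

(** * The sine factors, and a lower bound for pi *)

Section Trigo.
Context {R : realType}.
Notation mu := (@lebesgue_measure R).
Implicit Types (x a b : R) (n m : nat).

Lemma sin_natpi n : sin (n%:R * pi) = 0 :> R.
Proof.
elim: n => [|n IH]; first by rewrite mul0r sin0.
by rewrite -natr1 mulrDl mul1r sinD IH sinpi mul0r mulr0 addr0.
Qed.

Lemma cos_ge (x : R) : 0 <= x -> 1 - x ^+ 2 / 2 <= cos x.
Proof.
move=> x0.
have sx (y : R) : 0 <= y -> sin y <= y.
  move=> y0; have : 0 - sin 0 <= y - sin y.
    apply: (@ge0_nondecreasing_itv R (fun y => y - sin y) (fun y => 1 - cos y) 0 y y0).
    - apply: within_continuous => z; apply: cvgB; first exact: cvg_id.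
      exact: continuous_sin.
    - by move=> z _; rewrite subr_ge0 cos_le1.
  by rewrite sin0 subr0 subr_ge0.
have : cos 0 + 0 ^+ 2 / 2 <= cos x + x ^+ 2 / 2.
  apply: (@ge0_nondecreasing_itv R (fun y => cos y + y ^+ 2 / 2) (fun y => - sin y + y) 0 x x0).
  - apply: within_continuous => z; apply: cvgD; first exact: continuous_cos.
    by apply: cvgM; [apply: cvgM; exact: cvg_id|exact: cvg_cst].
  - move=> z _; have d : is_derive z 1 (fun y : R => y ^+ 2 / 2) z.
      by apply: is_derive_eq; rewrite /GRing.scale/=; field.
    exact: is_deriveD.
  - by move=> z /andP[z0 _]; rewrite addrC subr_ge0 sx// ltW.
by rewrite cos0 expr0n/= mul0r addr0 lerBlDr.
Qed.

(** Evaluate cos x >= 1 - x^2 / 2 at x = pi / 2, where the cosine vanishes. *)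
Lemma sqr_pi_ge8 : 8 <= (pi : R) ^+ 2.
Proof.
have := cos_ge (divr_ge0 (pi_ge0 R) (ler0n R 2)); rewrite cos_pihalf subr_le0.
by rewrite exprMn => H; move: (pi ^+ 2) H => p; lra.
Qed.

Lemma integral_sin_sqr n : (0 < n)%N ->
  (\int[mu]_(y in `[0%R, 1%R]) (sin (n%:R * pi * y) ^+ 2)%:E = (2^-1)%:E)%E.
Proof.
move=> n0; set a := n%:R * pi.
have a0 : a != 0 by rewrite mulf_neq0 ?gt_eqF ?pi_gt0// ltr0n.
pose F y : R := y / 2 - sin (a * y) * cos (a * y) / (2 * a).
have -> : 2^-1 = F 1 - F 0.
  by rewrite /F mulr0 sin0 mulr1 sin_natpi !mul0r !subr0 mul1r.
have cS : continuous (fun y => sin (a * y)).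
  move=> y; apply: (@continuous_comp _ _ _ (fun y : R => a * y)); last exact: continuous_sin.
  by apply: cvgM; [exact: cvg_cst|exact: cvg_id].
have cC : continuous (fun y => cos (a * y)).
  move=> y; apply: (@continuous_comp _ _ _ (fun y : R => a * y)); last exact: continuous_cos.
  by apply: cvgM; [exact: cvg_cst|exact: cvg_id].
apply: FTC2_within => //.
- apply: within_continuous => y; apply: cvgB.
    by apply: cvgM; [exact: cvg_id|exact: cvg_cst].
  by apply: cvgM; [apply: cvgM; [exact: cS|exact: cC]|exact: cvg_cst].
- by apply: within_continuous => y; apply: cvgM; exact: cS.
move=> y _.
have dl : is_derive y 1 (fun y : R => a * y) a by apply: is_derive_eq; rewrite /GRing.scale/= mulr1.
have dS : is_derive y 1 (fun y : R => sin (a * y)) (cos (a * y) * a).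
  exact: (@is_derive_chain R (fun y => a * y) sin y _ _ _ (is_derive_sin _) dl).
have dC : is_derive y 1 (fun y : R => cos (a * y)) (- sin (a * y) * a).
  exact: (@is_derive_chain R (fun y => a * y) cos y _ _ _ (is_derive_cos _) dl).
apply: is_derive_eq; rewrite /GRing.scale/=.
have := cos2Dsin2 (a * y); move: (cos _) (sin _) => p q pq.
have {}pq : p ^+ 2 = 1 - q ^+ 2 by rewrite -pq addrK.
transitivity (1 / 2 - (p ^+ 2 - q ^+ 2) / 2); first by field.
by rewrite pq; field.
Qed.

Lemma integral_sin_sin n m : n != m ->
  (\int[mu]_(y in `[0%R, 1%R]) (sin (n%:R * pi * y) * sin (m%:R * pi * y))%:E = 0)%E.
Proof.
move=> nm; set a := n%:R * pi; set b := m%:R * pi.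
have ab : a ^+ 2 - b ^+ 2 != 0.
  rewrite /a /b !exprMn -mulrBl mulf_neq0//; last by rewrite expf_neq0// gt_eqF// pi_gt0.
  by rewrite subr_eq0 -!natrX eqr_nat eqn_exp2r.
pose F y := (b * sin (a * y) * cos (b * y) - a * cos (a * y) * sin (b * y)) / (a ^+ 2 - b ^+ 2).
have -> : 0%E = (F 1 - F 0)%:E :> \bar R.
  by rewrite /F !mulr0 sin0 !mulr1 !sin_natpi !(mul0r, mulr0, subrr).
have cS (c : R) : continuous (fun y => sin (c * y)).
  move=> y; apply: (@continuous_comp _ _ _ (fun y : R => c * y)); last exact: continuous_sin.
  by apply: cvgM; [exact: cvg_cst|exact: cvg_id].
have cC (c : R) : continuous (fun y => cos (c * y)).
  move=> y; apply: (@continuous_comp _ _ _ (fun y : R => c * y)); last exact: continuous_cos.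
  by apply: cvgM; [exact: cvg_cst|exact: cvg_id].
apply: FTC2_within => //.
- apply: within_continuous => y; apply: cvgM; last exact: cvg_cst.
  apply: cvgB; apply: cvgM.
  - by apply: cvgM; [exact: cvg_cst|exact: cS].
  - exact: cC.
  - by apply: cvgM; [exact: cvg_cst|exact: cC].
  - exact: cS.
- by apply: within_continuous => y; apply: cvgM; exact: cS.
move=> y _.
have dl (c : R) : is_derive y 1 (fun y : R => c * y) c by apply: is_derive_eq; rewrite /GRing.scale/= mulr1.
have dS (c : R) : is_derive y 1 (fun y : R => sin (c * y)) (cos (c * y) * c).
  exact: (@is_derive_chain R (fun y => c * y) sin y _ _ _ (is_derive_sin _) (dl c)).
have dC (c : R) : is_derive y 1 (fun y : R => cos (c * y)) (- sin (c * y) * c).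
  exact: (@is_derive_chain R (fun y => c * y) cos y _ _ _ (is_derive_cos _) (dl c)).
have dSa := dS a; have dSb := dS b; have dCa := dC a; have dCb := dC b.
apply: is_derive_eq; rewrite /GRing.scale/=.
by move: (cos _) (sin _) (cos _) (sin _) => p q r s; field.
Qed.

End Trigo.

(** * Norms, orthogonality and eigenvalues of the modes *)

Section Modes.
Context {R : realType}.
Notation mR := (measurableTypeR R).
Notation mu := (@lebesgue_measure R).
Notation Q := (@unit_square R : set (mR * mR)).
Notation lam := (@leb2 R : {measure set (mR * mR) -> \bar R}).
Notation ip := (wip lam Q fst).
Notation sqn := (wsq lam Q fst).
Notation bm := (bounded_mfun Q).
Implicit Types (p : R * R) (k : nat * nat) (f : R * R -> R) (g : R * R -> cplx R).

Lemma leb2_unit_square_fin : (lam Q < +oo)%E.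
Proof. have -> : (lam Q = 1)%E by exact: leb2_unit_square. exact: ltry. Qed.

Lemma measurable_weight : measurable_fun Q (fst : mR * mR -> R).
Proof. by apply: measurable_funTS; exact: measurable_fst. Qed.

Lemma weight01 (p : mR * mR) : Q p -> 0 <= p.1 <= 1.
Proof. by move=> [/=]; rewrite in_itv. Qed.

(** Pairs are counted from 0, so k stands for the mode of index (k.1 + 1, k.2 + 1). *)
Definition bessel_root k : R := bessel_J0_zero k.1.+1.

Definition real_mode k p : R :=
  bessel_J0 (bessel_root k * p.1) * sin (k.2.+1%:R * pi * p.2).

Lemma modeE k p : mode k.1.+1 k.2.+1 p = (real_mode k p)%:C%C.
Proof. by []. Qed.

Lemma bessel_root_ge k : k.1.+2%:R <= bessel_root k.
Proof. by rewrite /bessel_root bessel_J0_zeroE; exact: bessel_zeta_ge. Qed.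

Lemma bessel_root_gt0 k : 0 < bessel_root k.
Proof. by apply: lt_le_trans (bessel_root_ge k); rewrite ltr0n. Qed.

Lemma bessel_J0_root k : bessel_J0 (bessel_root k) = 0.
Proof. by rewrite /bessel_root bessel_J0_zeroE bessel_J0_zeta. Qed.

Lemma real_mode_le1 k p : Q p -> `|real_mode k p| <= 1.
Proof.
move=> /weight01 /andP[p0 _]; rewrite normrM -[leRHS]mulr1; apply: ler_pM => //.
  by apply: bessel_J0_le1; rewrite mulr_ge0// ltW// bessel_root_gt0.
by rewrite ler_norml sin_geN1 sin_le1.
Qed.

Let cscale (F : R -> R) (a : R) : continuous F -> continuous (fun x => F (a * x)).
Proof.
move=> cF x; apply: (@continuous_comp _ _ _ (fun x : R => a * x)); last exact: cF.
by apply: cvgM; [exact: cvg_cst|exact: cvg_id].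
Qed.

Let cJ k : continuous (fun x : R => bessel_J0 (bessel_root k * x)).
Proof. by apply: cscale; exact: continuous_bessel_J0. Qed.

Let cS k : continuous (fun y : R => sin (k.2.+1%:R * pi * y)).
Proof. by apply: cscale; exact: continuous_sin. Qed.

Lemma bounded_mode k : bm (real_mode k).
Proof.
split; last by exists 1 => p; exact: real_mode_le1.
have m1 := continuous_measurable_fun (@cJ k); have m2 := continuous_measurable_fun (@cS k).
apply: measurable_funTS; apply: measurable_funM.
  exact: (measurableT_comp m1 measurable_fst).
exact: (measurableT_comp m2 measurable_snd).
Qed.

Lemma wip_modes k l : (ip (real_mode k) (real_mode l))%:E =
  ((\int[mu]_(x in `[0%R, 1%R]) (x * (bessel_J0 (bessel_root k * x) * bessel_J0 (bessel_root l * x)))%:E) *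
  (\int[mu]_(y in `[0%R, 1%R]) (sin (k.2.+1%:R * pi * y) * sin (l.2.+1%:R * pi * y))%:E))%E.
Proof.
rewrite -leb2_setX; first last.
- by apply: within_continuous => x; apply: cvgM; exact: cS.
- apply: within_continuous => x; apply: cvgM; first exact: cvg_id.
  by apply: cvgM; exact: cJ.
rewrite /wip /Rintegral fineK.
  apply: eq_integral => p _; congr _%:E; rewrite /real_mode.
  by move: (bessel_J0 _) (bessel_J0 _) (sin _) (sin _) => a b c d; ring.
have H : lam.-integrable Q (EFin \o (fun p : mR * mR => p.1 * (real_mode k p * real_mode l p))).
  apply: bounded_mfun_integrable; [exact: measurable_unit_square|exact: leb2_unit_square_fin|].
  apply: bounded_mfunM; last by apply: bounded_mfunM; exact: bounded_mode.
  split; first exact: measurable_weight.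
  by exists 1 => p /weight01 /andP[p0 p1]; rewrite ger0_norm.
by apply: integrable_fin_num H; exact: measurable_unit_square.
Qed.

(** The Bessel factor contributes J_0'(gamma)^2 / 2 and the sine factor 1 / 2. *)
Definition mode_sqnorm k : R := bessel_J0' (bessel_root k) ^+ 2 / 4.

Lemma wip_mode k : ip (real_mode k) (real_mode k) = mode_sqnorm k.
Proof.
apply: EFin_inj; rewrite wip_modes.
have -> : (\int[mu]_(y in `[0%R, 1%R]) (sin (k.2.+1%:R * pi * y) * sin (k.2.+1%:R * pi * y))%:E =
  (2^-1)%:E)%E by rewrite -(@integral_sin_sqr R k.2.+1).
rewrite (_ : (\int[mu]_(x in _) _)%E = (bessel_J0' (bessel_root k) ^+ 2 / 2)%:E).
  by rewrite -EFinM /mode_sqnorm; congr _%:E; field.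
by rewrite -bessel_sqnorm ?bessel_root_gt0 ?bessel_J0_root.
Qed.

Lemma mode_sqnorm_gt0 k : 0 < mode_sqnorm k.
Proof.
have := bessel_J0'_zero_ge (bessel_root_gt0 k) (bessel_J0_root k).
rewrite /mode_sqnorm => H; rewrite divr_gt0// -(pmulr_rgt0 _ (bessel_root_gt0 k)).
by apply: lt_le_trans H; rewrite invr_gt0.
Qed.

(** 12 = 4 * 3, from the divisor 4 in [mode_sqnorm] and the lower bound 1/3 on gamma
    J_0'(gamma)^2. *)
Lemma mode_sqnormV_le k : (mode_sqnorm k)^-1 <= 12 * bessel_root k.
Proof.
have := bessel_J0'_zero_ge (bessel_root_gt0 k) (bessel_J0_root k).
have g0 := bessel_root_gt0 k; have := mode_sqnorm_gt0 k; rewrite /mode_sqnorm.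
move: (bessel_root k) g0 (bessel_J0' (bessel_root k) ^+ 2) => g g0 q q0 gq.
have {}q0 : 0 < q by move: q0; lra.
rewrite -[leRHS]invrK lef_pV2 ?posrE ?invr_gt0 ?mulr_gt0//.
by rewrite -(@ler_pM2l _ (12 * g)) ?mulr_gt0// divff ?gt_eqF ?mulr_gt0//; move: gq; lra.
Qed.

Lemma bessel_root_neq k l : k.1 != l.1 -> bessel_root k ^+ 2 != bessel_root l ^+ 2.
Proof.
move=> kl; rewrite eqrXn2 ?ltW ?bessel_root_gt0// /bessel_root !bessel_J0_zeroE.
have [h|h|h] := ltngtP k.1 l.1.
- by rewrite lt_eqF// bessel_zeta_lt.
- by rewrite gt_eqF// bessel_zeta_lt.
- by rewrite h eqxx in kl.
Qed.

Lemma wip_modes_neq k l : k != l -> ip (real_mode k) (real_mode l) = 0.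
Proof.
move=> kl; apply: EFin_inj; rewrite wip_modes.
have [k1|k1] := eqVneq k.1 l.1; last first.
  by rewrite bessel_orthogonal ?mul0e ?bessel_J0_root// bessel_root_neq.
rewrite [X in (_ * X)%E](_ : _ = 0%E) ?mule0//.
apply: integral_sin_sin; apply: contra kl; rewrite eqSS => /eqP k2.
by apply/eqP; rewrite [k]surjective_pairing [l]surjective_pairing k1 k2.
Qed.

(** pi^2 >= 8 and gamma >= 2 give 8 + 4, exactly the threshold of [ml2_le1]. *)
Lemma mode_eigenvalue_ge12 k : 12 <= mode_eigenvalue k.1.+1 k.2.+1 :> R.
Proof.
rewrite /mode_eigenvalue -/(bessel_root k) exprMn.
have g2 : 2 <= bessel_root k.
  by apply: le_trans (bessel_root_ge k); rewrite ler_nat.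
have n1 : 1 <= k.2.+1%:R ^+ 2 :> R by rewrite -natrX ler1n expn_gt0.
have := @sqr_pi_ge8 R; move: (k.2.+1%:R ^+ 2) (pi ^+ 2) (bessel_root k) n1 g2 => a b c a1 c2 b8.
have : 8 <= a * b by rewrite -[8]mul1r; apply: ler_pM.
by nra.
Qed.

Lemma mode_eigenvalue_gt0 k : 0 < mode_eigenvalue k.1.+1 k.2.+1 :> R.
Proof. exact: lt_le_trans (mode_eigenvalue_ge12 k). Qed.

Lemma normc2 (z : cplx R) : normc z ^+ 2 = complex.Re z ^+ 2 + complex.Im z ^+ 2.
Proof. by case: z => a b /=; rewrite sqr_sqrtr// addr_ge0// sqr_ge0. Qed.

Lemma wL2norm_sqr g : measurable_fun Q (fun p => complex.Re (g p)) ->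
  measurable_fun Q (fun p => complex.Im (g p)) ->
  (wL2norm g ^+ 2 = sqn (fun p => complex.Re (g p)) + sqn (fun p => complex.Im (g p)))%E.
Proof.
move=> mr mi; rewrite /wL2norm sqr_sqrte; last first.
  apply: integral_ge0 => p /weight01 /andP[p0 _].
  by rewrite lee_fin mulr_ge0// sqr_ge0.
have m f : measurable_fun Q f -> measurable_fun Q (fun p : mR * mR => (p.1 * f p ^+ 2)%:E).
  move=> mf; apply/measurable_EFinP; apply: measurable_funM; first exact: measurable_weight.
  exact: measurable_funX.
have n f (p : mR * mR) : Q p -> (0 <= (p.1 * f p ^+ 2)%:E)%E.
  by move=> /weight01 /andP[p0 _]; rewrite lee_fin mulr_ge0// sqr_ge0.
rewrite /wsq -ge0_integralD//.
- by apply: eq_integral => p _; rewrite normc2 mulrDr EFinD.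
- exact: measurable_unit_square.
- by move=> p; exact: (n (fun p => complex.Re (g p))).
- exact: (m (fun p => complex.Re (g p))).
- by move=> p; exact: (n (fun p => complex.Im (g p))).
- exact: (m (fun p => complex.Im (g p))).
Qed.

Lemma wL2norm_mode k : fine (wL2norm (@mode R k.1.+1 k.2.+1)) ^+ 2 = mode_sqnorm k.
Proof.
have H : wL2norm (@mode R k.1.+1 k.2.+1) = (Num.sqrt (mode_sqnorm k))%:E.
  rewrite /wL2norm -[RHS]/(sqrte (mode_sqnorm k)%:E) -wip_mode; congr sqrte.
  rewrite -(wsqE measurable_unit_square leb2_unit_square_fin measurable_weight weight01 (bounded_mode k)).
  by apply: eq_integral => p _; rewrite modeE normc2 expr0n/= addr0.
by rewrite H/= sqr_sqrtr// ltW// mode_sqnorm_gt0.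
Qed.

Definition real_coef f k : R := ip f (real_mode k) / mode_sqnorm k.

(** The modes are real, so a complex coefficient splits into two real ones and the real theory
    applies to each part. *)
Lemma coefficientE g k : coefficient g k.1.+1 k.2.+1 =
  (real_coef (fun p => complex.Re (g p)) k +i* real_coef (fun p => complex.Im (g p)) k)%C.
Proof.
rewrite /coefficient wL2norm_mode /Cintegral /real_coef /wip.
have -> : \int[lam]_(p in Q) complex.Re (p.1%:C%C * g p * mode k.1.+1 k.2.+1 p) =
  \int[lam]_(p in Q) (p.1 * (complex.Re (g p) * real_mode k p)).
  by apply: eq_Rintegral => p _; rewrite modeE; case: (g p) => a b /=; ring.
have -> : \int[lam]_(p in Q) complex.Im (p.1%:C%C * g p * mode k.1.+1 k.2.+1 p) =
  \int[lam]_(p in Q) (p.1 * (complex.Im (g p) * real_mode k p)).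
  by apply: eq_Rintegral => p _; rewrite modeE; case: (g p) => a b /=; ring.
by move: (Rintegral _ _ _) (Rintegral _ _ _) => a b; congr (_ +i* _)%C; rewrite /=; ring.
Qed.

End Modes.

(** * The homogeneous problem *)

Section ComplexContinuity.
Context {R : realType}.

Lemma Re_le_norm (z : cplx R) : (`|complex.Re z|%:C)%C <= `|z|.
Proof. exact: normc_ge_Re. Qed.

Lemma Im_le_norm (z : cplx R) : (`|complex.Im z|%:C)%C <= `|z|.
Proof.
rewrite normc_def lecR -sqrtr_sqr; apply: ler_wsqrtr.
by rewrite lerDr sqr_ge0.
Qed.

Let continuous_part (P : cplx R -> R) : (forall y z, P (y - z) = P y - P z) ->
  (forall z, (`|P z|%:C)%C <= `|z|) -> continuous P.
Proof.
move=> PB Ple z; apply/(@cvgrPdist_lt _ _ _ _ (nbhs_filter z)) => e e0.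
have : \forall y \near z, `|z - y| < (e%:C)%C :> cplx R.
  by apply: ((@cvgrPdist_lt _ _ _ _ (nbhs_filter z) _ _).1 (@cvg_id _ (nbhs z))); rewrite ltcR.
apply: filterS => y H; rewrite -ltcR -PB; exact: le_lt_trans (Ple _) H.
Qed.

Lemma ReB (y z : cplx R) : complex.Re (y - z) = complex.Re y - complex.Re z.
Proof. by case: y; case: z. Qed.

Lemma ImB (y z : cplx R) : complex.Im (y - z) = complex.Im y - complex.Im z.
Proof. by case: y; case: z. Qed.

Lemma continuous_Re : continuous (@complex.Re R : cplx R -> R).
Proof. by apply: continuous_part; [exact: ReB|exact: Re_le_norm]. Qed.

Lemma continuous_Im : continuous (@complex.Im R : cplx R -> R).
Proof. by apply: continuous_part; [exact: ImB|exact: Im_le_norm]. Qed.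

Lemma sum_complex (I : Type) (s : seq I) (a b : I -> R) :
  \sum_(i <- s) ((a i +i* b i)%C : cplx R) = ((\sum_(i <- s) a i) +i* (\sum_(i <- s) b i))%C.
Proof.
elim: s => [|i s IH]; first by rewrite !big_nil.
by rewrite !big_cons IH.
Qed.

Lemma partial_seriesE (s : nat -> nat -> R * R -> cplx R) F p :
  partial_series s F p = \sum_(k <- F) s k.1.+1 k.2.+1 p.
Proof. by rewrite /partial_series /partial_sum big_seq_fsetE. Qed.

Lemma nearby_totally (I : choiceType) (P : set {fset I}) :
  (\forall F \near totally, P F) <-> exists F0, forall F, (F0 `<=` F)%fset -> P F.
Proof.
split=> [[F0 _ H]|[F0 H]]; first by exists F0 => F FF; exact: H.
by exists F0.
Qed.

End ComplexContinuity.

(** * The weighted norm of complex functions through real and imaginary parts *)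

Section ComplexL2.
Context {R : realType}.
Notation mR := (measurableTypeR R).
Notation Q := (@unit_square R : set (mR * mR)).
Notation lam := (@leb2 R : {measure set (mR * mR) -> \bar R}).
Notation ip := (wip lam Q fst).
Notation sqn := (wsq lam Q fst).
Notation bm := (bounded_mfun Q).
Implicit Types (p : R * R) (f g : R * R -> R) (h : R * R -> cplx R) (r : R).

Let mQ : measurable Q := measurable_unit_square.
Let finQ := @leb2_unit_square_fin R.
Let mW := @measurable_weight R.
Let w01 := @weight01 R.

Definition re_part h p : R := complex.Re (h p).
Definition im_part h p : R := complex.Im (h p).

Definition measurable_cplx h := measurable_fun Q (re_part h) /\ measurable_fun Q (im_part h).
Definition bounded_cplx h := bm (re_part h) /\ bm (im_part h).
(** The square of [wL2norm] on measurable functions; estimates are made on squares, and the root is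
    taken at the end. *)
Definition wsqc h : \bar R := (sqn (re_part h) + sqn (im_part h))%E.

Lemma re_partD h1 h2 : re_part (fun p => h1 p + h2 p) = fun p => re_part h1 p + re_part h2 p.
Proof. by apply/funext => p; rewrite /re_part; case: (h1 p); case: (h2 p). Qed.

Lemma im_partD h1 h2 : im_part (fun p => h1 p + h2 p) = fun p => im_part h1 p + im_part h2 p.
Proof. by apply/funext => p; rewrite /im_part; case: (h1 p); case: (h2 p). Qed.

Lemma re_partN h : re_part (fun p => - h p) = fun p => - re_part h p.
Proof. by apply/funext => p; rewrite /re_part; case: (h p). Qed.

Lemma im_partN h : im_part (fun p => - h p) = fun p => - im_part h p.
Proof. by apply/funext => p; rewrite /im_part; case: (h p). Qed.

Lemma measurable_cplxD h1 h2 : measurable_cplx h1 -> measurable_cplx h2 ->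
  measurable_cplx (fun p => h1 p + h2 p).
Proof.
move=> [m1 m2] [m3 m4]; rewrite /measurable_cplx re_partD im_partD.
by split; exact: measurable_funD.
Qed.

Lemma measurable_cplxN h : measurable_cplx h -> measurable_cplx (fun p => - h p).
Proof.
move=> [m1 m2]; rewrite /measurable_cplx re_partN im_partN.
by split; exact: measurable_funN.
Qed.

Lemma bounded_cplx_measurable h : bounded_cplx h -> measurable_cplx h.
Proof. by move=> [[m1 _] [m2 _]]. Qed.

Lemma wsqc_ge0 h : (0 <= wsqc h)%E.
Proof. by apply: adde_ge0; exact: wsq_ge0. Qed.

Lemma wL2normE h : measurable_cplx h -> wL2norm h = sqrte (wsqc h).
Proof.
move=> [m1 m2]; have <- : (wL2norm h ^+ 2 = wsqc h)%E by exact: wL2norm_sqr.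
by rewrite sqrte_sqr gee0_abs// sqrte_ge0.
Qed.

Lemma wL2norm2 h : measurable_cplx h -> (wL2norm h ^+ 2 = wsqc h)%E.
Proof. by move=> [m1 m2]; exact: wL2norm_sqr. Qed.

Lemma wsqcN h : wsqc (fun p => - h p) = wsqc h.
Proof. by rewrite /wsqc re_partN im_partN !wsqN. Qed.

Lemma wsqcD_le r h1 h2 : 0 < r -> measurable_cplx h1 -> measurable_cplx h2 ->
  (wsqc (fun p => h1 p + h2 p)%R <= (1 + r^-1)%:E * wsqc h1 + (1 + r)%:E * wsqc h2)%E.
Proof.
move=> r0 [m1 m2] [m3 m4].
have D x f g : (x%:E * (sqn f + sqn g) = x%:E * sqn f + x%:E * sqn g)%E.
  by rewrite ge0_muleDr//; exact: wsq_ge0.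
rewrite /wsqc re_partD im_partD !D [leRHS]addeACA; apply: leeD; exact: wsqD_le.
Qed.

Lemma wsqcE h f g : re_part h = f -> im_part h = g -> bm f -> bm g ->
  wsqc h = (ip f f + ip g g)%:E.
Proof. by move=> <- <- b1 b2; rewrite EFinD /wsqc -!wsqE. Qed.

Lemma bounded_cplx_fin h : bounded_cplx h -> (wsqc h < +oo)%E.
Proof. by move=> [b1 b2]; rewrite (wsqcE erefl erefl b1 b2) ltry. Qed.

(** Convergence of the norms is restated for their squares, the form in which [riesz_fischer]
    delivers it. *)
Lemma cvg_wL2norm (I : choiceType) (G : {fset I} -> R * R -> cplx R) :
  (forall F, measurable_cplx (G F)) ->
  ((wL2norm (G F) @[F --> totally] --> 0%E) <->
  (forall r, 0 < r -> exists F0, forall F, (F0 `<=` F)%fset -> (wsqc (G F) <= r%:E)%E)).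
Proof.
have Ft := @totally_filter I.
move=> mG; split=> [/fine_cvgP[fG cG] r r0|H].
  move/cvgrPdist_le : cG => /(_ (Num.sqrt r)); rewrite sqrtr_gt0 => /(_ r0) H.
  have [F0 HF] := (nearby_totally _).1 (filterI fG H); exists F0 => F /HF[/= fF].
  rewrite sub0r normrN => le; have c0 := wsqc_ge0 (G F).
  rewrite -wL2norm2// -(fineK fF) -EFin_expe lee_fin.
  rewrite -(sqr_sqrtr (ltW r0)) -(real_normK (num_real (fine _))).
  by rewrite ler_pXn2r ?nnegrE ?sqrtr_ge0.
apply/fine_cvgP; split.
  have [F0 HF] := H 1 ltr01; apply/nearby_totally; exists F0 => F /HF c1.
  rewrite wL2normE// sqrte_fin_num ?wsqc_ge0// ge0_fin_numE ?wsqc_ge0//.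
  by rewrite (le_lt_trans c1) ?ltry.
apply/cvgrPdist_le => e e0; have [F0 HF] := H (e ^+ 2) (exprn_gt0 _ e0).
apply/nearby_totally; exists F0 => F /HF c1 /=.
have fc : wsqc (G F) \is a fin_num.
  by rewrite ge0_fin_numE ?wsqc_ge0// (le_lt_trans c1) ?ltry.
rewrite sub0r normrN wL2normE// -(fineK fc)/= ger0_norm ?sqrtr_ge0//.
rewrite -(ger0_norm (ltW e0)) -sqrtr_sqr ler_wsqrtr//.
by rewrite -lee_fin fineK.
Qed.

End ComplexL2.

(** * Existence, bound and linearity for the homogeneous series *)

Section Homogeneous.
Context {R : realType}.
Notation mR := (measurableTypeR R).
Notation Q := (@unit_square R : set (mR * mR)).
Notation lam := (@leb2 R : {measure set (mR * mR) -> \bar R}).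
Notation ip := (wip lam Q fst).
Notation bm := (bounded_mfun Q).
Variable alpha : R.
Hypothesis alpha12 : 1 < alpha < 2.
Implicit Types (p : R * R) (k : nat * nat) (f g : R * R -> R) (phi psi h : R * R -> cplx R).
Implicit Types (F : {fset nat * nat}) (r t : R).

Let mQ : measurable Q := measurable_unit_square.
Let finQ := @leb2_unit_square_fin R.
Let mW := @measurable_weight R.
Let w01 := @weight01 R.

Let b01 : 0 < alpha - 1 < 1.
Proof. by case/andP: alpha12 => a1 a2; rewrite subr_gt0 a1/= ltrBlDr. Qed.

Let alE : alpha = alpha - 1 + 1. Proof. by rewrite subrK. Qed.

Definition time_factor0 k t : R := mittag_leffler alpha 1 (- mode_eigenvalue k.1.+1 k.2.+1 * t `^ alpha).
Definition time_factor1 k t : R := t * mittag_leffler alpha 2 (- mode_eigenvalue k.1.+1 k.2.+1 * t `^ alpha).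

Let mlA_le1 k t : 0 <= t -> time_factor0 k t ^+ 2 <= 1.
Proof.
move=> t0; rewrite -(real_normK (num_real _)) exprn_ile1// /time_factor0 mulNr.
apply: (ml1_le1 b01 alE); rewrite mulr_ge0 ?powR_ge0//.
exact/ltW/mode_eigenvalue_gt0.
Qed.

Let mlB_le1 k t : 0 <= t -> time_factor1 k t ^+ 2 <= 1.
Proof.
move=> t0; rewrite -(real_normK (num_real _)) exprn_ile1// /time_factor1 mulNr.
by apply: (ml2_le1 b01 alE) => //; exact: mode_eigenvalue_ge12.
Qed.

Definition homogeneous_coef f g t k : R :=
  real_coef f k * time_factor0 k t + real_coef g k * time_factor1 k t.
Definition homogeneous_sum f g t F := lincomb real_mode (homogeneous_coef f g t) F.

Let bm_hsum f g t F : bm (homogeneous_sum f g t F).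
Proof. by apply: bounded_lincomb => //; exact: bounded_mode. Qed.

Let partial_homogeneousE phi psi t F p :
  partial_series (homogeneous_term alpha phi psi t) F p =
  (homogeneous_sum (re_part phi) (re_part psi) t F p +i*
   homogeneous_sum (im_part phi) (im_part psi) t F p)%C.
Proof.
rewrite partial_seriesE /homogeneous_sum /lincomb -sum_complex; apply: eq_bigr => k _.
rewrite /homogeneous_term !coefficientE modeE /homogeneous_coef /time_factor0 /time_factor1.
rewrite -/(re_part phi) -/(re_part psi) -/(im_part phi) -/(im_part psi).
move: (real_coef (re_part phi) k) (real_coef (re_part psi) k) => a1 a2.
move: (real_coef (im_part phi) k) (real_coef (im_part psi) k) => a3 a4.
move: (mittag_leffler _ 1 _) (t * _) (real_mode k p) => c1 c2 e.
by congr (_ +i* _)%C; rewrite /=; ring.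
Qed.

Let re_partial phi psi t F : re_part (partial_series (homogeneous_term alpha phi psi t) F) =
  homogeneous_sum (re_part phi) (re_part psi) t F.
Proof. by apply/funext => p; rewrite {1}/re_part partial_homogeneousE. Qed.

Let im_partial phi psi t F : im_part (partial_series (homogeneous_term alpha phi psi t) F) =
  homogeneous_sum (im_part phi) (im_part psi) t F.
Proof. by apply/funext => p; rewrite {1}/im_part partial_homogeneousE. Qed.

Let real_coef_bessel f F : bm f -> \sum_(k <- F) real_coef f k ^+ 2 * mode_sqnorm k <= ip f f.
Proof.
move=> bf; exact: (bessel_inequality mQ finQ mW w01 (@bounded_mode R) (@wip_mode R)
  (@mode_sqnorm_gt0 R) (@wip_modes_neq R) F bf).
Qed.

(** The factor 2 of the final estimate comes from (a x + b y)^2 <= 2 (a^2 x^2 + b^2 y^2); the time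
    factors x and y are at most 1 in absolute value, and Bessel's inequality does the rest. *)
Let hcoef_le f g t F : 0 <= t -> bm f -> bm g ->
  \sum_(k <- F) homogeneous_coef f g t k ^+ 2 * mode_sqnorm k <= 2 * (ip f f + ip g g).
Proof.
move=> t0 bf bg.
apply: le_trans (ler_wpM2l (ler0n R 2) (lerD (real_coef_bessel F bf) (real_coef_bessel F bg))).
rewrite -big_split/= mulr_sumr; apply: ler_sum => k _.
rewrite -mulrDl mulrA ler_wpM2r//; first exact/ltW/mode_sqnorm_gt0.
rewrite /homogeneous_coef.
have := mlA_le1 k t0; have := mlB_le1 k t0.
move: (real_coef f k) (real_coef g k) (time_factor0 k t) (time_factor1 k t) => a b x y y1 x1.
have h1 : 0 <= a ^+ 2 * (1 - x ^+ 2) by rewrite mulr_ge0 ?sqr_ge0 ?subr_ge0.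
have h2 : 0 <= b ^+ 2 * (1 - y ^+ 2) by rewrite mulr_ge0 ?sqr_ge0 ?subr_ge0.
by have := sqr_ge0 (a * x - b * y); lra.
Qed.

Let wsq_hsum f g t F : ip (homogeneous_sum f g t F) (homogeneous_sum f g t F) =
  \sum_(k <- F) homogeneous_coef f g t k ^+ 2 * mode_sqnorm k.
Proof.
exact: (wip_lincomb2 mQ finQ mW w01 (@bounded_mode R) (@wip_mode R) (@wip_modes_neq R)).
Qed.

Let bpartial phi psi t F : bounded_cplx (partial_series (homogeneous_term alpha phi psi t) F).
Proof. by rewrite /bounded_cplx re_partial im_partial; split; exact: bm_hsum. Qed.

Let mpartial phi psi t F : measurable_cplx (partial_series (homogeneous_term alpha phi psi t) F).
Proof. exact: bounded_cplx_measurable. Qed.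

Lemma homogeneous_solution_exists T phi psi : bounded_cplx phi -> bounded_cplx psi ->
  exists v, homogeneous_solution alpha T phi psi v.
Proof.
move=> [b1 b2] [b3 b4].
have H t : exists h, 0 <= t <= T -> measurable_cplx h /\
  (forall r, 0 < r -> exists F0, forall F, (F0 `<=` F)%fset ->
    (wsqc (fun p => h p - partial_series (homogeneous_term alpha phi psi t) F p)%R <= r%:E)%E).
  have [/andP[t0 tT]|nt] := boolP (0 <= t <= T); last by exists (fun=> 0).
  have RF f g (bf : bm f) (bg : bm g) := riesz_fischer mQ finQ mW w01 (@bounded_mode R) (@wip_mode R)
    (@wip_modes_neq R) (fun F => hcoef_le F t0 bf bg).
  have [g1 m1 H1] := RF _ _ b1 b3; have [g2 m2 H2] := RF _ _ b2 b4.
  exists (fun p => (g1 p +i* g2 p)%C) => _; split; first by split.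
  move=> r r0; have r2 : 0 < r / 2 by exact: divr_gt0.
  have [F1 HF1] := H1 _ r2; have [F2 HF2] := H2 _ r2.
  exists (F1 `|` F2)%fset => F; rewrite fsubUset => /andP[/HF1 c1 /HF2 c2].
  rewrite (splitr r) EFinD /wsqc re_partD im_partD re_partN im_partN re_partial im_partial.
  rewrite (_ : re_part (fun p => (g1 p +i* g2 p)%C) = g1)// (_ : im_part (fun p => (g1 p +i* g2 p)%C) = g2)//.
  exact: (leeD c1 c2).
have [v0 Hv] := choice H; exists (fun q => v0 q.2 q.1) => t tT /=.
have [mv cv] := Hv t tT; split; last first.
  apply/cvg_wL2norm => // F; apply: measurable_cplxD => //.
  by apply: measurable_cplxN; exact: mpartial.
have [m1 m2] := mv; split=> //.
(* The solution at time t is within distance 1 of a bounded partial sum, hence has finite norm. *)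
have [F0 HF0] := cv 1 ltr01; have c1 := HF0 F0 (fsubset_refl _).
have ms := mpartial phi psi t F0; have bs := bpartial phi psi t F0.
rewrite wL2normE// -ge0_fin_numE ?sqrte_ge0// sqrte_fin_num ?wsqc_ge0//.
rewrite ge0_fin_numE ?wsqc_ge0//.
move: (partial_series _ F0) ms bs c1 => S ms bs c1.
have md : measurable_cplx (fun p => v0 t p - S p).
  by apply: measurable_cplxD => //; exact: measurable_cplxN.
have := wsqcD_le ltr01 md ms.
rewrite (_ : (fun p => _ + S p) = v0 t); last by apply/funext => p; rewrite subrK.
move=> /le_lt_trans; apply; apply: lte_add_pinfty; apply: lte_mul_pinfty => //.
- exact: le_lt_trans c1 (ltry _).
- exact: bounded_cplx_fin.
Qed.

Lemma homogeneous_solution_bound T phi psi v : bounded_cplx phi -> bounded_cplx psi ->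
  homogeneous_solution alpha T phi psi v -> forall t, 0 <= t <= T ->
  (wL2norm (fun p => v (p, t)) <= sqrte (2%:E * (wL2norm phi ^+ 2 + wL2norm psi ^+ 2)))%E.
Proof.
move=> bphi bpsi Hv t tT; have [[m1 m2 _] cv] := Hv t tT.
have [b1 b2] := bphi; have [b3 b4] := bpsi.
have /andP[t0 _] := tT.
have mv : measurable_cplx (fun p => v (p, t)) by [].
rewrite wL2normE// !wL2norm2; [|exact: bounded_cplx_measurable..].
rewrite lee_sqrt; last by rewrite mule_ge0// adde_ge0// wsqc_ge0.
rewrite (wsqcE (h := phi) erefl erefl b1 b2) (wsqcE (h := psi) erefl erefl b3 b4) -EFinD -EFinM.
set B := 2 * _; have B0 : 0 <= B by rewrite mulr_ge0// !addr_ge0//; exact: wip_ge0.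
pose S F := partial_series (homogeneous_term alpha phi psi t) F.
have SB F : (wsqc (S F) <= B%:E)%E.
  rewrite (wsqcE (re_partial _ _ _ _) (im_partial _ _ _ _) (bm_hsum _ _ _ _) (bm_hsum _ _ _ _)).
  rewrite lee_fin !wsq_hsum.
  apply: le_trans (lerD (hcoef_le F t0 b1 b3) (hcoef_le F t0 b2 b4)) _.
  by rewrite /B -mulrDr ler_wpM2l// le_eqVlt; apply/orP; left; apply/eqP; rewrite addrACA.
have mS F : measurable_cplx (fun p => v (p, t) - S F p).
  by apply: measurable_cplxD => //; apply: measurable_cplxN; exact: mpartial.
move/(cvg_wL2norm mS) : cv => cv.
apply/lee_addgt0Pr => e e0.
(* This r satisfies r B <= e / 2. The squared distance to the partial sum is then made so small
   that, multiplied by 1 + r^-1, it is at most e / 2. *)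
pose r := e / (2 * (B + 1)).
have B1 : 0 < 2 * (B + 1) by rewrite mulr_gt0// ltr_wpDl.
have r0 : 0 < r by exact: divr_gt0.
have r1 : 0 < 1 + r^-1 by rewrite addr_gt0// invr_gt0.
have d0 : 0 < e / 2 / (1 + r^-1) by rewrite divr_gt0// divr_gt0.
have [F0 /(_ F0 (fsubset_refl _)) cF] := cv _ d0.
have := wsqcD_le r0 (mS F0) (mpartial phi psi t F0).
rewrite (_ : (fun p => _ + _) = fun p => v (p, t)); last by apply/funext => p; rewrite subrK.
move=> /le_trans; apply; apply: (@le_trans _ _ ((1 + r^-1)%:E * (e / 2 / (1 + r^-1))%:E + (1 + r)%:E * B%:E)%E).
  by apply: leeD; apply: lee_wpmul2l => //; rewrite ?SB// lee_fin ltW// addr_gt0.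
rewrite -!EFinM -!EFinD lee_fin mulrC divfK ?gt_eqF//.
have : r * B <= e / 2.
  rewrite /r mulrAC ler_pdivrMr// -subr_ge0.
  have -> : e / 2 * (2 * (B + 1)) - e * B = e by field.
  exact: ltW.
by rewrite mulrDl mul1r; move: (r * B) => z; lra.
Qed.

Let real_coefB f g k : bm f -> bm g ->
  real_coef (fun p => f p - g p) k = real_coef f k - real_coef g k.
Proof.
move=> bf bg; rewrite /real_coef -mulrBl; congr (_ / _).
by apply: (wipBl mQ finQ mW w01) => //; exact: bounded_mode.
Qed.

Let hsumB f g f' g' t F p : bm f -> bm g -> bm f' -> bm g' ->
  homogeneous_sum (fun p => f p - f' p) (fun p => g p - g' p) t F p =
  homogeneous_sum f g t F p - homogeneous_sum f' g' t F p.
Proof.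
move=> bf bg bf' bg'; rewrite /homogeneous_sum /lincomb -sumrB; apply: eq_bigr => k _.
by rewrite -mulrBl /homogeneous_coef !real_coefB//; congr (_ * _); ring.
Qed.

Lemma homogeneous_solutionB T phi psi phi' psi' v v' :
  bounded_cplx phi -> bounded_cplx psi -> bounded_cplx phi' -> bounded_cplx psi' ->
  homogeneous_solution alpha T phi psi v -> homogeneous_solution alpha T phi' psi' v' ->
  homogeneous_solution alpha T (fun p => phi p - phi' p) (fun p => psi p - psi' p)
    (fun q => v q - v' q).
Proof.
move=> [b1 b2] [b3 b4] [b1' b2'] [b3' b4'] Hv Hv' t tT.
have [[m1 m2 f1] cv] := Hv t tT; have [[m1' m2' f1'] cv'] := Hv' t tT.
have mv : measurable_cplx (fun p => v (p, t)) by [].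
have mv' : measurable_cplx (fun p => v' (p, t)) by [].
have mvv : measurable_cplx (fun p => v (p, t) - v' (p, t)).
  by apply: measurable_cplxD => //; exact: measurable_cplxN.
have B h1 h2 : measurable_cplx h1 -> measurable_cplx h2 ->
    (wsqc (fun p => h1 p - h2 p)%R <= 2%:E * wsqc h1 + 2%:E * wsqc h2)%E.
  move=> mh1 mh2; have := wsqcD_le ltr01 mh1 (measurable_cplxN mh2).
  by rewrite wsqcN invr1.
have fin h : measurable_cplx h -> (wL2norm h < +oo)%E -> (wsqc h < +oo)%E.
  move=> mh; rewrite wL2normE// -ge0_fin_numE ?sqrte_ge0// sqrte_fin_num ?wsqc_ge0//.
  by rewrite ge0_fin_numE ?wsqc_ge0.
split.
  case: (mvv) => m3 m4; split=> //.
  rewrite wL2normE// -ge0_fin_numE ?sqrte_ge0// sqrte_fin_num ?wsqc_ge0//.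
  rewrite ge0_fin_numE ?wsqc_ge0//; apply: le_lt_trans (B _ _ mv mv') _.
  by apply: lte_add_pinfty; apply: lte_mul_pinfty => //; exact: fin.
pose S F := partial_series (homogeneous_term alpha phi psi t) F.
pose S' F := partial_series (homogeneous_term alpha phi' psi' t) F.
have mS F : measurable_cplx (fun p => v (p, t) - S F p).
  by apply: measurable_cplxD => //; apply: measurable_cplxN; exact: mpartial.
have mS' F : measurable_cplx (fun p => v' (p, t) - S' F p).
  by apply: measurable_cplxD => //; apply: measurable_cplxN; exact: mpartial.
have SE F : (fun p => (v (p, t) - v' (p, t)) - partial_series (homogeneous_term alpha
    (fun p => phi p - phi' p) (fun p => psi p - psi' p) t) F p) =
    (fun p => (v (p, t) - S F p) - (v' (p, t) - S' F p)).
  apply/funext => p; rewrite /S /S' !partial_homogeneousE !re_partD !im_partD !re_partN !im_partN.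
  rewrite !hsumB//.
  move: (homogeneous_sum _ _ _ _ _) (homogeneous_sum _ _ _ _ _) (homogeneous_sum _ _ _ _ _) (homogeneous_sum _ _ _ _ _).
  case: (v (p, t)) => a b; case: (v' (p, t)) => c d x y z w.
  by congr (_ +i* _)%C; rewrite /=; ring.
have -> : (fun F => wL2norm (fun p => (v (p, t) - v' (p, t)) - partial_series (homogeneous_term alpha
    (fun p => phi p - phi' p) (fun p => psi p - psi' p) t) F p)) =
    (fun F => wL2norm (fun p => (v (p, t) - S F p) - (v' (p, t) - S' F p))).
  by apply/funext => F; rewrite SE.
move/(cvg_wL2norm mS) : cv => cv; move/(cvg_wL2norm mS') : cv' => cv'.
apply/cvg_wL2norm => [F|r r0].
  by apply: measurable_cplxD => //; exact: measurable_cplxN.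
have r4 : 0 < r / 4 by exact: divr_gt0.
have [F1 HF1] := cv _ r4; have [F2 HF2] := cv' _ r4.
exists (F1 `|` F2)%fset => F; rewrite fsubUset => /andP[/HF1 c1 /HF2 c2].
apply: le_trans (B _ _ (mS F) (mS' F)) _.
apply: (@le_trans _ _ (2%:E * (r / 4)%:E + 2%:E * (r / 4)%:E)%E).
  have two : (0%R <= 2%:E :> \bar R)%E by rewrite lee_fin.
  exact: (leeD (lee_wpmul2l two c1) (lee_wpmul2l two c2)).
by rewrite -!EFinM -EFinD lee_fin le_eqVlt; apply/orP; left; apply/eqP; field.
Qed.

End Homogeneous.

(** * The non-homogeneous problem *)

Section Summability.
Context {R : realType} (I : choiceType).
Implicit Types (x y : I -> R) (F : {fset I}).

Let sum_cvg_ge0 x (B : R) : (forall i, 0 <= x i) -> (forall F, \sum_(i <- F) x i <= B) ->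
  exists l : R, (fun F : {fset I} => \sum_(i <- F) x i) @ totally --> l.
Proof.
move=> x0 xB; pose S := [set \sum_(i <- F) x i | F in [set: {fset I}]].
have hS : has_sup S.
  by split; [exists (\sum_(i <- fset0) x i); exists fset0|exists B => _ [F _ <-]].
have Ft := @totally_filter I.
exists (sup S); apply/cvgrPdist_le => e e0; apply/nearby_totally.
have [_ [F0 _ <-] HF0] := sup_adherent e0 hS.
exists F0 => F FF.
have F0F : \sum_(i <- F0) x i <= \sum_(i <- F) x i.
  rewrite [leRHS](big_fsetID _ (mem F0))/=.
  rewrite (_ : [fset x in F | x \in F0]%fset = F0) ?lerDl ?sumr_ge0//.
  by apply/fsetP => i; rewrite !inE/= andbC andb_idr// => /(fsubsetP FF).
have FS : \sum_(i <- F) x i <= sup S by apply: ub_le_sup; [exact: hS.2|exists F].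
rewrite ger0_norm ?subr_ge0//; move: HF0 F0F FS.
set s1 := \sum_(i <- F0) _; set s2 := \sum_(i <- F) _.
by move: s1 s2 (sup S) => s1 s2 q; lra.
Qed.

(** x is the difference of the nonnegative families |x| and |x| - x, and both have bounded finite
    sums. *)
Lemma absolutely_summable_cvg x (B : R) : (forall F, \sum_(i <- F) `|x i| <= B) ->
  exists l : R, (fun F : {fset I} => \sum_(i <- F) x i) @ totally --> l.
Proof.
move=> xB; have Ft := @totally_filter I.
have [|l1 H1] := @sum_cvg_ge0 (fun i => `|x i|) B _ xB; first by move=> i; exact: normr_ge0.
have [||l2 H2] := @sum_cvg_ge0 (fun i => `|x i| - x i) (B + B).
- by move=> i; rewrite subr_ge0 ler_norm.
- move=> F; rewrite sumrB lerD//; apply: le_trans (xB F).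
  by rewrite -sumrN; apply: ler_sum => i _; rewrite -normrN ler_norm.
exists (l1 - l2).
rewrite (_ : (fun F : {fset I} => \sum_(i <- F) x i) =
  (fun F : {fset I} => \sum_(i <- F) `|x i| - \sum_(i <- F) (`|x i| - x i))).
  exact: (cvgB H1 H2).
apply/funext => F; rewrite -sumrB; apply: eq_bigr => i _.
by rewrite opprB addrCA subrr addr0.
Qed.

End Summability.

(** * The majorant series *)

Section PowerSums.
Context {R : realType}.
Implicit Types (j K : nat).

Definition zsum_term j : R := j.+1%:R `^ (- (5 / 4)).

Lemma zsum_term_ge0 j : 0 <= zsum_term j. Proof. exact: powR_ge0. Qed.

(* x^(-5/4) is decreasing with primitive - 4 x^(-1/4). *)
Let zsum_term_le j : zsum_term j.+1 <= 4 * (j.+1%:R `^ (- 4^-1) - j.+2%:R `^ (- 4^-1)).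
Proof.
pose z := zsum_term j.+1.
have j0 : 0 < j.+1%:R :> R by rewrite ltr0n.
have H : - 4 * j.+1%:R `^ (- 4^-1) - z * j.+1%:R <= - 4 * j.+2%:R `^ (- 4^-1) - z * j.+2%:R.
  have d (x : R) : 0 < x -> is_derive x 1 (fun x => - 4 * x `^ (- 4^-1) - z * x) (x `^ (- (5 / 4)) - z).
    move=> x0; have d1 := is_derive1_powR (- 4^-1) x0.
    apply: is_derive_eq; rewrite /GRing.scale/= mulr1.
    rewrite (_ : - 4^-1 - 1 = - (5 / 4)); last by field.
    by move: (x `^ _) => p; field.
  apply: (@ge0_nondecreasing_itv R (fun x => - 4 * x `^ (- 4^-1) - z * x) (fun x => x `^ (- (5 / 4)) - z)).
  - by rewrite ler_nat.
  - apply: derivable_within_continuous => x; rewrite in_itv/= => /andP[x1 _].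
    by have [] := d x (lt_le_trans j0 x1).
  - by move=> x /andP[x1 _]; apply: d; exact: lt_trans x1.
  move=> x /andP[x1 x2]; rewrite subr_ge0 /z /zsum_term.
  have x0 : 0 < x by exact: lt_trans x1.
  rewrite !powRN lef_pV2 ?posrE ?powR_gt0//.
  by apply: ge0_ler_powR; rewrite ?nnegrE ?(ltW x0) ?(ltW x2)//.
have E : j.+2%:R = j.+1%:R + 1 :> R by rewrite natr1.
rewrite -/z; move: (j.+1%:R `^ (- 4^-1)) (j.+2%:R `^ (- 4^-1)) H; rewrite E.
by move: (j.+1%:R : R) => s p q; rewrite mulrDr mulr1; lra.
Qed.

(** The first term is 1 and the others telescope to less than 4. *)
Lemma zsum_le5 K : \sum_(j <- iota 0 K) zsum_term j <= 5.
Proof.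
have H n : \sum_(j <- iota 0 n.+1) zsum_term j <= 5 - 4 * n.+1%:R `^ (- 4^-1).
  elim: n => [|n IH].
    by rewrite big_seq1 /zsum_term !powR1; lra.
  have -> : \sum_(j <- iota 0 n.+2) zsum_term j = \sum_(j <- iota 0 n.+1) zsum_term j + zsum_term n.+1.
    by rewrite -[n.+2]addn1 iotaD big_cat big_seq1.
  by have := zsum_term_le n; move: IH; move: (\sum_(j <- iota 0 n.+1) _) => s; lra.
case: K => [|n]; first by rewrite big_nil.
by apply: le_trans (H n) _; rewrite gerBl mulr_ge0// powR_ge0.
Qed.

(** A finite set of pairs lies in a square box, over which the double sum is a product of two sums
    bounded by 5. *)
Lemma zsum2_le25 (F : {fset nat * nat}) : \sum_(k <- F) zsum_term k.1 * zsum_term k.2 <= 25.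
Proof.
pose K := (\max_(k <- F) maxn k.1 k.2).+1.
pose box := [seq (i, j) | i <- iota 0 K, j <- iota 0 K].
have ub : uniq box by apply: allpairs_uniq; rewrite ?iota_uniq// => -[? ?] [? ?].
have FK k : k \in (F : seq _) -> k \in box.
  move=> kF; have : (maxn k.1 k.2 <= \max_(k <- F) maxn k.1 k.2)%N.
    by rewrite (big_rem k)//= leq_maxl.
  rewrite geq_max => /andP[k1 k2]; rewrite [k]surjective_pairing.
  by apply: allpairs_f; rewrite mem_iota add0n ltnS.
have -> : \sum_(k <- F) zsum_term k.1 * zsum_term k.2 =
    \sum_(k <- [seq k <- box | k \in F]) zsum_term k.1 * zsum_term k.2.
  apply: perm_big; apply: uniq_perm; rewrite ?filter_uniq ?fset_uniq// => k.
  by rewrite mem_filter; apply/idP/andP => [kF|[]//]; split=> //; exact: FK.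
rewrite big_filter; apply: (@le_trans _ _ (\sum_(k <- box) zsum_term k.1 * zsum_term k.2)).
  rewrite [leRHS](bigID (mem F))/= lerDl sumr_ge0// => k _.
  by rewrite mulr_ge0// zsum_term_ge0.
have -> : \sum_(k <- box) zsum_term k.1 * zsum_term k.2 =
    (\sum_(j <- iota 0 K) zsum_term j) * (\sum_(j <- iota 0 K) zsum_term j).
  by rewrite big_allpairs mulr_suml; apply: eq_bigr => i _; rewrite mulr_sumr.
rewrite -[25](_ : 5 * 5 = _); last by rewrite -natrM.
by apply: ler_pM; rewrite ?zsum_le5// sumr_ge0// => j _; exact: zsum_term_ge0.
Qed.

End PowerSums.

(** * Continuity and boundedness on the closed domain *)

Section WithinContinuous.
Context {R : realType}.

Lemma within_continuous_comp (X Y Z : topologicalType) (A : set X) (B : set Y)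
    (f : X -> Y) (g : Y -> Z) : continuous f -> (forall x, A x -> B (f x)) ->
  {within B, continuous g} -> {within A, continuous (fun x => g (f x))}.
Proof.
move=> cf AB /subspace_continuousP cg; apply/subspace_continuousP => x Ax U HU.
have H := cg _ (AB x Ax) U HU; have H2 := cf x _ H.
apply: (@filterS _ (nbhs x) _ (fun y => B (f y) -> U (g (f y))) _ _ H2) => y /= Hy Ay.
exact: Hy (AB _ Ay).
Qed.

Lemma continuous_comp_within (X Y Z : topologicalType) (B : set Y)
    (f : X -> Y) (g : Y -> Z) : continuous f -> (forall x, B (f x)) ->
  {within B, continuous g} -> continuous (fun x => g (f x)).
Proof.
move=> cf fB /subspace_continuousP cg x U HU.
have H := cg _ (fB x) U HU; have H2 := cf x _ H.
apply: (@filterS _ (nbhs x) _ (fun y => B (f y) -> U (g (f y))) _ _ H2) => y /= Hy.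
exact: Hy (fB _).
Qed.

Lemma within_bounded (X : topologicalType) (A : set X) (f : X -> R) :
  compact A -> {within A, continuous f} -> exists M, forall x, A x -> `|f x| <= M.
Proof.
move=> cA cf; have /compact_bounded[M [_ HM]] := continuous_compact cf cA.
exists (M + 1) => x Ax; apply: (HM (M + 1)); first by rewrite ltrDl.
by exists x.
Qed.

Lemma compact_Omega (T : R) : compact (Omega T).
Proof. by apply: compact_setX; [exact: compact_unit_square|exact: segment_compact]. Qed.

Lemma within_Re (X : topologicalType) (A : set X) (f : X -> cplx R) :
  {within A, continuous f} -> {within A, continuous (fun x => complex.Re (f x) : R)}.
Proof. by move=> cf x; apply: continuous_comp; [exact: cf|exact: continuous_Re]. Qed.

Lemma within_Im (X : topologicalType) (A : set X) (f : X -> cplx R) :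
  {within A, continuous f} -> {within A, continuous (fun x => complex.Im (f x) : R)}.
Proof. by move=> cf x; apply: continuous_comp; [exact: cf|exact: continuous_Im]. Qed.

Lemma within_bounded_mfun (f : R * R -> R) :
  {within unit_square, continuous f} -> bounded_mfun (unit_square : set (measurableTypeR R * measurableTypeR R)) f.
Proof.
move=> cf; split; last by apply: within_bounded => //; exact: compact_unit_square.
by apply: within_continuous_measurable => //; exact: measurable_unit_square.
Qed.

Lemma within_bounded_cplx (f : R * R -> cplx R) :
  {within unit_square, continuous f} -> bounded_cplx f.
Proof.
by move=> cf; split; apply: within_bounded_mfun; [exact: within_Re|exact: within_Im].
Qed.

End WithinContinuous.

Section ComplexLimits.
Context {R : realType}.

Let pos_cplx (e : cplx R) : 0 < e -> exists2 r : R, 0 < r & e = r%:C%C.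
Proof.
case: e => a b; rewrite ltcE/= => /andP[/eqP b0 a0]; exists a => //.
by rewrite b0.
Qed.

Let normcE (z : cplx R) : `|z| = (normc z)%:C%C.
Proof. by case: z. Qed.

Lemma normc_le_ReIm (z : cplx R) : normc z <= `|complex.Re z| + `|complex.Im z|.
Proof.
case: z => a b /=; rewrite -[leRHS]ger0_norm ?addr_ge0// -sqrtr_sqr ler_wsqrtr//.
rewrite sqrrD !real_normK ?num_real// lerD2r lerDl.
by rewrite mulrn_wge0// mulr_ge0.
Qed.

Lemma cvg_cplx (X : Type) (G : set_system X) (x y : X -> R) (lx ly : R) : Filter G ->
  x @ G --> lx -> y @ G --> ly ->
  (fun i => (x i +i* y i)%C : cplx R) @ G --> ((lx +i* ly)%C : cplx R).
Proof.
move=> FG cx cy; apply/(@cvgrPdist_le _ _ _ _ FG) => e /pos_cplx[r r0 ->].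
have r2 : 0 < r / 2 by exact: divr_gt0.
move/cvgrPdist_le : cx => /(_ _ r2) cx; move/cvgrPdist_le : cy => /(_ _ r2) cy.
apply: filterS2 cx cy => i xi yi; rewrite normcE lecR.
apply: le_trans (normc_le_ReIm _) _; rewrite [leRHS]splitr.
exact: lerD.
Qed.

Lemma cvg_normc_le (X : Type) (G : set_system X) (z : X -> cplx R) (l : cplx R) (B : R) :
  ProperFilter G -> z @ G --> l -> (forall i, normc (z i) <= B) -> normc l <= B.
Proof.
move=> FG cz zB; apply/ler_addgt0Pr => e e0.
move/(@cvgrPdist_le _ _ _ _ _) : cz => /(_ (e%:C)%C); rewrite ltcR => /(_ e0).
move=> near_l; have [j] := @filter_ex _ G FG _ near_l; rewrite normcE lecR => H.
have -> : l = z j + (l - z j) by rewrite addrC subrK.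
by apply: le_trans (le_normcD _ _) _; rewrite lerD.
Qed.

End ComplexLimits.

Section SumIntegral.
Context d (X : measurableType d) {R : realType} (mu : {measure set X -> \bar R}).

Lemma Rintegral_sum_seq (D : set X) (I : Type) (s : seq I) (f : I -> X -> R) :
  measurable D -> (forall i, mu.-integrable D (EFin \o f i)) ->
  mu.-integrable D (EFin \o (fun x => \sum_(i <- s) f i x)) /\
  \sum_(i <- s) \int[mu]_(x in D) f i x = \int[mu]_(x in D) (\sum_(i <- s) f i x).
Proof.
move=> mD fi; elim: s => [|i s [IH1 IH2]].
  rewrite big_nil (_ : (fun x => _) = fun=> 0); last by apply/funext => x; rewrite big_nil.
  split; first exact: integrable0.
  by rewrite /Rintegral integral0.
rewrite big_cons IH2 (_ : (fun x => _) = fun x => f i x + \sum_(j <- s) f j x); last first.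
  by apply/funext => x; rewrite big_cons.
split; last by rewrite RintegralD.
have := integrableD mD (fi i) IH1; exact.
Qed.

End SumIntegral.

(** * Absolute convergence of the Duhamel series *)

Section Nonhomogeneous.
Context {R : realType}.
Notation mR := (measurableTypeR R).
Notation mu := (@lebesgue_measure R).
Notation Q := (@unit_square R : set (mR * mR)).
Notation lam := (@leb2 R : {measure set (mR * mR) -> \bar R}).
Notation bm := (bounded_mfun Q).
Variable alpha : R.
Hypothesis alpha12 : 1 < alpha < 2.
Implicit Types (p : R * R) (k : nat * nat) (F : {fset nat * nat}) (s t x T M : R).
Implicit Types (a : R * R * R -> R).

Let mQ : measurable Q := measurable_unit_square.
Let finQ := @leb2_unit_square_fin R.
Let mW := @measurable_weight R.
Let w01 := @weight01 R.

Let b01 : 0 < alpha - 1 < 1.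
Proof. by case/andP: alpha12 => a1 a2; rewrite subr_gt0 a1/= ltrBlDr. Qed.

Let alE : alpha = alpha - 1 + 1. Proof. by rewrite subrK. Qed.

Let al0 : 0 < alpha. Proof. by case/andP: alpha12 => + _; exact: lt_trans. Qed.

Definition duhamel_kernel k s : R :=
  s `^ (alpha - 1) * mittag_leffler alpha alpha (- mode_eigenvalue k.1.+1 k.2.+1 * s `^ alpha).

Let ev k : R := mode_eigenvalue k.1.+1 k.2.+1.

Let ev0 k : 0 < ev k. Proof. exact: mode_eigenvalue_gt0. Qed.

(** alpha - 1 - 7 alpha / 8 = alpha / 8 - 1: the decay in the eigenvalue is paid for in powers of s,
    and the singularity that remains is integrable. *)
Let kernel_le C0 k s : (forall x, 0 < x -> `|mittag_leffler alpha alpha (- x)| <= C0 * x `^ (- (7 / 8))) ->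
  0 <= s -> `|duhamel_kernel k s| <= C0 * ev k `^ (- (7 / 8)) * s `^ (alpha / 8 - 1).
Proof.
(* At s = 0 both sides vanish, since 0 to a nonzero exponent is 0 for [powR], even if the exponent
   is negative. *)
move=> HC; rewrite le_eqVlt => /predU1P[<-|s0].
  have /andP[a0 _] := b01; have a8 : alpha / 8 - 1 != 0.
    by case/andP: alpha12 => _ a2; rewrite lt_eqF// subr_lt0; lra.
  have z1 : 0 `^ (alpha - 1) = 0 :> R by rewrite powR0// gt_eqF.
  have z2 : 0 `^ (alpha / 8 - 1) = 0 :> R by rewrite powR0.
  by rewrite /duhamel_kernel z1 z2 mul0r mulr0 normr0.
have x0 : 0 < ev k * s `^ alpha by rewrite mulr_gt0// powR_gt0.
rewrite /duhamel_kernel normrM ger0_norm ?powR_ge0// mulNr.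
apply: le_trans (ler_wpM2l (powR_ge0 _ _) (HC _ x0)) _.
rewrite powRM ?powR_ge0 ?(ltW (ev0 k))// -powRrM.
have E : s `^ (alpha / 8 - 1) = s `^ (alpha - 1) * s `^ (alpha * - (7 / 8)).
  by rewrite -powRD ?(gt_eqF s0) ?implybT//; congr (_ `^ _); field.
rewrite E le_eqVlt; apply/orP; left; apply/eqP.
by move: (s `^ _) (s `^ _) (ev k `^ _) => u v z; ring.
Qed.

Let measurable_kernel k : measurable_fun setT (duhamel_kernel k : mR -> mR).
Proof.
apply: measurable_funM; first exact: measurable_powR.
rewrite (_ : (fun x => mittag_leffler _ _ _) =
  psum (ml_coef alpha alpha) \o (fun s : mR => - ev k * s `^ alpha)); last first.
  by apply/funext => s; rewrite /= mittag_lefflerE.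
apply: measurableT_comp.
  apply: continuous_measurable_fun; apply: continuous_psum.
  by apply: (ml_entire b01 alE); case/andP: alpha12 => /ltW.
by apply: measurable_funM => //; exact: measurable_powR.
Qed.

(** Split 7/4 = 9/8 + 5/8. The first power of the eigenvalue dominates gamma^(9/4), which absorbs
    the factor gamma and leaves gamma^(5/4), at least (k.1 + 1)^(5/4); the second dominates (k.2 +
    1)^(5/4). *)
Let ev_pow k : ev k `^ (- (7 / 4)) * bessel_root k <= zsum_term k.1 * zsum_term k.2.
Proof.
have g0 := @bessel_root_gt0 R k; have m0 : 0 < k.1.+1%:R :> R by rewrite ltr0n.
have n0 : 0 < k.2.+1%:R :> R by rewrite ltr0n.
have gm : k.1.+1%:R <= bessel_root k :> R.
  by apply: le_trans (bessel_root_ge k); rewrite ler_nat.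
have e1 : bessel_root k ^+ 2 <= ev k by rewrite /ev /mode_eigenvalue lerDr sqr_ge0.
have e2 : k.2.+1%:R ^+ 2 <= ev k.
  rewrite /ev /mode_eigenvalue; apply: (@le_trans _ _ ((k.2.+1%:R * pi) ^+ 2)); last by rewrite lerDl sqr_ge0.
  rewrite ler_pXn2r ?nnegrE ?mulr_ge0 ?pi_ge0// ler_peMr// (le_trans _ (pi_ge2 R))//.
  by rewrite ler1n.
have sq (y r : R) : 0 < y -> (y ^+ 2) `^ r = y `^ (2 * r).
  by move=> y0; rewrite -powR_mulrn ?(ltW y0)// -powRrM.
have E : ev k `^ (7 / 4) = ev k `^ (9 / 8) * ev k `^ (5 / 8).
  by rewrite -powRD ?(gt_eqF (ev0 k)) ?implybT//; congr (_ `^ _); field.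
have f1 : bessel_root k `^ (9 / 4) <= ev k `^ (9 / 8).
  rewrite (_ : 9 / 4 = 2 * (9 / 8)); last by field.
  by rewrite -sq//; apply: ge0_ler_powR; rewrite ?nnegrE ?sqr_ge0 ?(ltW (ev0 k)).
have f2 : k.2.+1%:R `^ (5 / 4) <= ev k `^ (5 / 8).
  rewrite (_ : 5 / 4 = 2 * (5 / 8)); last by field.
  by rewrite -sq//; apply: ge0_ler_powR; rewrite ?nnegrE ?sqr_ge0 ?(ltW (ev0 k)).
have f3 : k.1.+1%:R `^ (5 / 4) <= bessel_root k `^ (5 / 4) :> R.
  by apply: ge0_ler_powR; rewrite ?nnegrE ?(ltW m0) ?(ltW g0).
have G : bessel_root k `^ (9 / 4) = bessel_root k * bessel_root k `^ (5 / 4) :> R.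
  rewrite -{2}[bessel_root k]powRr1 ?(ltW g0)// -powRD ?(gt_eqF g0) ?implybT//.
  by congr (_ `^ _); field.
rewrite /zsum_term !powRN -invfM mulrC ler_pdivrMr ?powR_gt0//.
rewrite -ler_pdivrMl ?invr_gt0 ?mulr_gt0 ?powR_gt0// invrK E.
rewrite mulrC mulrA mulrC; apply: (@le_trans _ _ (bessel_root k `^ (9 / 4) * k.2.+1%:R `^ (5 / 4))).
  by rewrite G [leLHS]mulrC ler_wpM2r ?powR_ge0// ler_wpM2l ?(ltW g0).
by apply: ler_pM; rewrite ?powR_ge0.
Qed.

(** 300 = 12 * 25, from [mode_sqnormV_le] and [zsum2_le25]. *)
Let sum_weight F : \sum_(k <- F) (ev k `^ (- (7 / 8))) ^+ 2 / mode_sqnorm k <= 300.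
Proof.
apply: (@le_trans _ _ (\sum_(k <- F) 12 * (zsum_term k.1 * zsum_term k.2))); last first.
  rewrite -mulr_sumr; apply: le_trans (ler_wpM2l _ (zsum2_le25 F)) _; first by [].
  by rewrite -natrM.
apply: ler_sum => k _.
have -> : (ev k `^ (- (7 / 8))) ^+ 2 = ev k `^ (- (7 / 4)).
  by rewrite -powR_mulrn ?powR_ge0// -powRrM; congr (_ `^ _); field.
apply: le_trans (ler_wpM2l (powR_ge0 _ _) (mode_sqnormV_le k)) _.
by rewrite mulrCA ler_pM2l//; exact: ev_pow.
Qed.

Section RealSource.
Variables (T M : R) (a : R * R * R -> R).
Hypotheses (T0 : 0 < T) (M0 : 0 < M).
Hypothesis ca : {within Omega T, continuous a}.
Hypothesis aM : forall q, Omega T q -> `|a q| <= M.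

Definition source_coef k x : R := real_coef (fun p => a (p, x)) k.

Lemma bounded_slice x : 0 <= x <= T -> bm (fun p => a (p, x)).
Proof.
move=> xT; apply: within_bounded_mfun.
apply: (@within_continuous_comp _ _ _ (@unit_square R) (Omega T) (fun p => (p, x))) => //.
- move=> p; exact: (@cvg_pair _ _ _ (nbhs p) (nbhs p) (nbhs x) _ _ _ (fun p => p) (fun=> x)
    (@cvg_id _ _) (cvg_cst x)).
Qed.

Let source_bessel x F : 0 <= x <= T -> \sum_(k <- F) source_coef k x ^+ 2 * mode_sqnorm k <= M ^+ 2.
Proof.
move=> xT; have bs := bounded_slice xT.
apply: le_trans (bessel_inequality mQ finQ mW w01 (@bounded_mode R) (@wip_mode R)
  (@mode_sqnorm_gt0 R) (@wip_modes_neq R) F bs) _.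
rewrite -lee_fin -(wsqE mQ finQ mW w01 bs).
apply: (@le_trans _ _ (\int[lam]_(p in Q) (M ^+ 2)%:E)%E).
  apply: ge0_le_integral => //.
  - by move=> p /w01 /andP[p0 _]; rewrite lee_fin mulr_ge0// sqr_ge0.
  - apply/measurable_EFinP; apply: measurable_funM; first exact: mW.
    by apply: measurable_funX; case: bs.
  move=> p Qp; have /andP[p0 p1] := w01 Qp; rewrite lee_fin -[leRHS]mul1r.
  apply: ler_pM; rewrite ?sqr_ge0// -(real_normK (num_real _)) ler_pXn2r ?nnegrE ?(ltW M0)//.
  by apply: aM; split => //=; rewrite in_itv.
rewrite integral_cst//; have Q1 : (lam Q = 1)%E by exact: leb2_unit_square.
by rewrite Q1 mule1.
Qed.

(* AM-GM replaces Cauchy-Schwarz: 2 c |y| <= M c^2 / N + y^2 N / M. *)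
Let sum_source_le x F : 0 <= x <= T ->
  \sum_(k <- F) ev k `^ (- (7 / 8)) * `|source_coef k x| <= 151 * M.
Proof.
move=> xT.
apply: (@le_trans _ _ (\sum_(k <- F) (M / 2 * ((ev k `^ (- (7 / 8))) ^+ 2 / mode_sqnorm k) +
    (2 * M)^-1 * (source_coef k x ^+ 2 * mode_sqnorm k)))).
  apply: ler_sum => k _; have N0 := @mode_sqnorm_gt0 R k.
  rewrite -(real_normK (num_real (source_coef k x))).
  move: (ev k `^ _) `|_| (mode_sqnorm k) N0 => c y N N0; rewrite -subr_ge0.
  have -> : M / 2 * (c ^+ 2 / N) + (2 * M)^-1 * (y ^+ 2 * N) - c * y =
      (2 * M * N)^-1 * (M * c - y * N) ^+ 2 by field; rewrite !gt_eqF.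
  by rewrite mulr_ge0 ?sqr_ge0// invr_ge0 !mulr_ge0// ltW.
rewrite big_split/= -!mulr_sumr.
have h1 := ler_wpM2l (divr_ge0 (ltW M0) (ler0n R 2)) (sum_weight F).
have h2 : (2 * M)^-1 * \sum_(k <- F) source_coef k x ^+ 2 * mode_sqnorm k <= (2 * M)^-1 * M ^+ 2.
  by rewrite ler_wpM2l// ?invr_ge0 ?mulr_ge0 ?(ltW M0)//; exact: source_bessel.
(* The two sums contribute 150 M and M / 2. *)
apply: le_trans (lerD h1 h2) _.
have -> : (2 * M)^-1 * M ^+ 2 = M / 2 by field; rewrite gt_eqF.
by move: M0; lra.
Qed.

(** Clamping extends the slices of a continuously to all times, so that continuity under the
    integral can be applied on an open interval around any time. *)
Let clamp x : R := Num.max 0 (Num.min T x).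

Let clampT x : 0 <= clamp x <= T.
Proof. by rewrite /clamp le_max lexx/= ge_max ge_min lexx (ltW T0). Qed.

Let clampE x : 0 <= x <= T -> clamp x = x.
Proof. by move=> /andP[x0 xT]; rewrite /clamp min_r// max_r. Qed.

Let cclamp : continuous clamp.
Proof.
move=> x; apply: continuous_max; first exact: cst_continuous.
by apply: continuous_min; [exact: cst_continuous|exact: cvg_id].
Qed.

Let continuous_clamp_slice (p : R * R) : unit_square p ->
  continuous (fun x : R => a (p, clamp x)).
Proof.
move=> Qp; have cc : continuous (fun x : R => (p, clamp x) : R * R * R).
  move=> y; exact: (@cvg_pair _ _ _ (nbhs y) (nbhs p) (nbhs (clamp y)) _ _ _ (fun=> p) clamp
    (cvg_cst p) (@cclamp y)).
have cO y : Omega T ((p, clamp y) : R * R * R) by split => //=; rewrite in_itv/= clampT.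
exact: (continuous_comp_within cc cO ca).
Qed.

(** Dominated convergence with the constant M. The continuity serves to make the Duhamel integrand
    measurable. *)
Let continuous_source k : continuous (fun x => source_coef k (clamp x)).
Proof.
move=> x0; apply: cvgM; last exact: cvg_cst.
pose g x p := p.1 * (a (p, clamp x) * real_mode k p).
have gb x p : Q p -> `|g x p| <= M.
  move=> Qp; have /andP[p0 p1] := w01 Qp; rewrite (normrM p.1) (normrM (a _)) (ger0_norm p0) -[leRHS]mul1r.
  apply: ler_pM => //; rewrite -[leRHS]mulr1; apply: ler_pM => //; last exact: real_mode_le1.
  by apply: aM; split => //=; rewrite in_itv/= clampT.
have bg x : bm (g x).
  apply: bounded_mfunM; last by apply: bounded_mfunM; [exact: bounded_slice|exact: bounded_mode].
  split; first exact: mW.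
  by exists 1 => p /w01 /andP[p0 p1]; rewrite ger0_norm.
have := @continuity_under_integral R _ _ lam g Q mQ (x0 - 1) (x0 + 1).
move=> /(_ _ _ (fun=> M) _ _ x0); apply.
- by move=> x _; exact: (bounded_mfun_integrable mQ finQ (bg x)).
- apply: aeW => p Qp x _.
  apply: cvgM; first exact: cvg_cst.
  apply: cvgM; last exact: cvg_cst.
  exact: (continuous_clamp_slice Qp).
- apply: (bounded_mfun_integrable mQ finQ); exact: bounded_mfun_cst.
- by move=> x _; apply: aeW => p Qp; exact: gb.
- by rewrite inE/= in_itv/= ltrBlDr !ltrDl ltr01.
Qed.

Definition duhamel k t : R := \int[mu]_(x in `[0, t]) (duhamel_kernel k (t - x) * source_coef k x).

Variable C0 : R.
Hypothesis C00 : 0 < C0.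
Hypothesis HC : forall x, 0 < x -> `|mittag_leffler alpha alpha (- x)| <= C0 * x `^ (- (7 / 8)).

Let a8 : 0 < alpha / 8. Proof. exact: divr_gt0. Qed.

(** Summing over the modes before integrating in time keeps Bessel's inequality for the slice at
    time x available. *)
Let duhamel_pointwise F t x : 0 <= x <= t -> t <= T ->
  \sum_(k <- F) `|duhamel_kernel k (t - x) * source_coef k x| <=
  C0 * (151 * M) * (t - x) `^ (alpha / 8 - 1).
Proof.
move=> /andP[x0 xt] tT; have xT : 0 <= x <= T by rewrite x0 (le_trans xt).
apply: (@le_trans _ _ (\sum_(k <- F) C0 * (t - x) `^ (alpha / 8 - 1) *
    (ev k `^ (- (7 / 8)) * `|source_coef k x|))).
  apply: ler_sum => k _; rewrite normrM.
  have tx : 0 <= t - x by rewrite subr_ge0.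
  apply: le_trans (ler_wpM2r (normr_ge0 _) (kernel_le k HC tx)) _.
  by rewrite le_eqVlt; apply/orP; left; apply/eqP; move: (ev k `^ (- (7 / 8))) ((t - x) `^ _) `|_| => u v w; ring.
rewrite -mulr_sumr; apply: le_trans (ler_wpM2l _ (sum_source_le F xT)) _.
  by rewrite mulr_ge0 ?powR_ge0// ltW.
by rewrite le_eqVlt; apply/orP; left; apply/eqP; ring.
Qed.

Lemma duhamel_integrable k t : 0 <= t <= T ->
  mu.-integrable `[0, t] (EFin \o (fun x => duhamel_kernel k (t - x) * source_coef k x)).
Proof.
move=> /andP[t0 tT].
have iK : mu.-integrable `[0, t] (fun x : mR => (C0 * (151 * M))%:E * ((t - x) `^ (alpha / 8 - 1))%:E)%E.
  by apply: integrableZl => //; exact: abel_kernel_integrable.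
apply: le_integrable iK => //.
  apply/measurable_EFinP; apply: measurable_funM.
    apply: measurable_funTS; apply: (measurableT_comp (measurable_kernel k)).
    by apply: measurable_funB.
  apply: (eq_measurable_fun (fun x => source_coef k (clamp x))).
    by move=> x; rewrite inE/= in_itv/= => /andP[x0 xt]; rewrite clampE// x0 (le_trans xt).
  by apply: measurable_funTS; apply: continuous_measurable_fun; exact: continuous_source.
move=> x /=; rewrite in_itv/= => xt; rewrite lee_fin.
have := duhamel_pointwise [fset k]%fset xt tT.
rewrite big_seq_fset1 => /le_trans; apply.
by rewrite ler_norm.
Qed.

(** 1208 = 151 * 8, where 8 bounds the factor (alpha / 8)^-1 produced by integrating the kernel.
    Since alpha < 2, the power t^(alpha/8) is at most [Num.max T 1] to the power 1/4. *)
Lemma duhamel_sum_le F t p : 0 <= t <= T -> Q p ->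
  \sum_(k <- F) `|duhamel k t * real_mode k p| <= 1208 * C0 * Num.max T 1 `^ 4^-1 * M.
Proof.
move=> tT Qp; have /andP[t0 tT'] := tT.
pose f k x := `|duhamel_kernel k (t - x) * source_coef k x|.
have fi k : mu.-integrable `[0, t] (EFin \o f k).
  by have := integrable_norm (duhamel_integrable k tT).
have [iS ES] := Rintegral_sum_seq (mu := mu) F (measurable_itv `[0, t] : measurable (`[0, t]%classic : set mR)) fi.
apply: (@le_trans _ _ (\sum_(k <- F) \int[mu]_(x in `[0, t]) f k x)).
  apply: ler_sum => k _; rewrite normrM -[leRHS]mulr1; apply: ler_pM => //.
    by apply: le_normr_Rintegral => //; exact: duhamel_integrable.
  exact: real_mode_le1.
rewrite ES.
have iK : mu.-integrable `[0, t] (EFin \o (fun x : mR => (t - x) `^ (alpha / 8 - 1))).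
  exact: abel_kernel_integrable.
apply: (@le_trans _ _ (\int[mu]_(x in `[0, t]) (C0 * (151 * M) * (t - x) `^ (alpha / 8 - 1)))).
  apply: le_Rintegral => //.
    rewrite (_ : EFin \o _ = fun x : mR => ((C0 * (151 * M))%:E * ((EFin \o (fun x : mR => ((t - x) `^ (alpha / 8 - 1))%R)) x))%E)//.
    exact: integrableZl.
  by move=> x /=; rewrite in_itv/= => xt; exact: duhamel_pointwise.
rewrite RintegralZl// /Rintegral integral_abel_kernel//=.
have tpow : t `^ (alpha / 8) <= Num.max T 1 `^ 4^-1.
  apply: (@le_trans _ _ (Num.max T 1 `^ (alpha / 8))).
    by apply: ge0_ler_powR; rewrite ?nnegrE ?(ltW a8)// le_max ?tT' ?ler01 ?orbT.
  apply: ler_powR; first by rewrite le_max lexx orbT.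
  by case/andP: alpha12 => _; lra.
have a8V : (alpha / 8)^-1 <= 8.
  rewrite invf_div ler_pdivrMr// ler_peMr//.
  by case/andP: alpha12 => /ltW.
have CM : 0 <= C0 * (151 * M) by rewrite !mulr_ge0// ltW.
apply: (@le_trans _ _ (C0 * (151 * M) * (Num.max T 1 `^ 4^-1 * 8))).
  by rewrite ler_wpM2l// ler_pM ?powR_ge0// invr_ge0 ltW.
by rewrite le_eqVlt; apply/orP; left; apply/eqP; move: (_ `^ _) => z; ring.
Qed.

End RealSource.

End Nonhomogeneous.

(** * Existence, uniform bound and linearity for the non-homogeneous series *)

Section NonhomogeneousSolution.
Context {R : realType}.
Notation mu := (@lebesgue_measure R).
Variable alpha : R.
Hypothesis alpha12 : 1 < alpha < 2.
Implicit Types (p : R * R) (k : nat * nat) (F : {fset nat * nat}) (t T M : R).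
Implicit Types (f w : R * R * R -> cplx R).

Let re f q : R := complex.Re (f q).
Let im f q : R := complex.Im (f q).

Let duhamel_term (a : R * R * R -> R) t p k := duhamel alpha a k t * real_mode k p.

Lemma nonhomogeneous_termE f t k p : nonhomogeneous_term alpha f t k.1.+1 k.2.+1 p =
  (duhamel_term (re f) t p k +i* duhamel_term (im f) t p k)%C.
Proof.
rewrite /nonhomogeneous_term modeE /Cintegral /duhamel_term /duhamel.
have -> : \int[mu]_(x in `[0, t]) complex.Re (((t - x) `^ (alpha - 1) *
    mittag_leffler alpha alpha (- mode_eigenvalue k.1.+1 k.2.+1 * (t - x) `^ alpha))%:C%C *
    coefficient (fun p' => f (p', x)) k.1.+1 k.2.+1) =
    \int[mu]_(x in `[0, t]) (duhamel_kernel alpha k (t - x) * source_coef (re f) k x).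
  apply: eq_Rintegral => x _; rewrite coefficientE /duhamel_kernel /source_coef /re/=.
  by rewrite mul0r subr0.
have -> : \int[mu]_(x in `[0, t]) complex.Im (((t - x) `^ (alpha - 1) *
    mittag_leffler alpha alpha (- mode_eigenvalue k.1.+1 k.2.+1 * (t - x) `^ alpha))%:C%C *
    coefficient (fun p' => f (p', x)) k.1.+1 k.2.+1) =
    \int[mu]_(x in `[0, t]) (duhamel_kernel alpha k (t - x) * source_coef (im f) k x).
  apply: eq_Rintegral => x _; rewrite coefficientE /duhamel_kernel /source_coef /im/=.
  by rewrite mul0r addr0.
by move: (Rintegral _ _ _) (Rintegral _ _ _) => x y; congr (_ +i* _)%C; rewrite /=; ring.
Qed.

Lemma partial_nonhomogeneousE f t F p : partial_series (nonhomogeneous_term alpha f t) F p =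
  ((\sum_(k <- F) duhamel_term (re f) t p k) +i* (\sum_(k <- F) duhamel_term (im f) t p k))%C.
Proof.
rewrite partial_seriesE -sum_complex; apply: eq_bigr => k _.
exact: nonhomogeneous_termE.
Qed.

Let complexB (a b c d : R) :
  ((a - b) +i* (c - d))%C = (a +i* c)%C - (b +i* d)%C :> cplx R.
Proof. by []. Qed.

Let re_le (z : cplx R) : `|complex.Re z| <= normc z.
Proof. by case: z => a b /=; rewrite -sqrtr_sqr ler_wsqrtr// lerDl sqr_ge0. Qed.

Let im_le (z : cplx R) : `|complex.Im z| <= normc z.
Proof. by case: z => a b /=; rewrite -sqrtr_sqr ler_wsqrtr// lerDr sqr_ge0. Qed.

Variable C0 : R.
Hypothesis C00 : 0 < C0.
Hypothesis HC : forall x, 0 < x -> `|mittag_leffler alpha alpha (- x)| <= C0 * x `^ (- (7 / 8)).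

Let B T M := 1208 * C0 * Num.max T 1 `^ 4^-1 * M.

Section Source.
Variables (T M : R) (f : R * R * R -> cplx R).
Hypotheses (T0 : 0 < T) (M0 : 0 < M).
Hypothesis cf : {within Omega T, continuous f}.
Hypothesis fM : forall q, Omega T q -> normc (f q) <= M.

Let sum_re_le F p t : Omega T (p, t) -> \sum_(k <- F) `|duhamel_term (re f) t p k| <= B T M.
Proof.
move=> [/= Qp]; rewrite in_itv/= => tT.
apply: (@duhamel_sum_le R alpha alpha12 T M (re f) T0 M0) => //.
  exact: within_Re.
by move=> q Oq; apply: le_trans (re_le _) (fM Oq).
Qed.

Let sum_im_le F p t : Omega T (p, t) -> \sum_(k <- F) `|duhamel_term (im f) t p k| <= B T M.
Proof.
move=> [/= Qp]; rewrite in_itv/= => tT.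
apply: (@duhamel_sum_le R alpha alpha12 T M (im f) T0 M0) => //.
  exact: within_Im.
by move=> q Oq; apply: le_trans (im_le _) (fM Oq).
Qed.

Lemma nonhomogeneous_solution_exists_bounded : exists w, nonhomogeneous_solution alpha T f w.
Proof.
have H q : exists z : cplx R, Omega T q ->
    (partial_series (nonhomogeneous_term alpha f q.2) F q.1 @[F --> totally] --> z).
  have [Oq|nq] := pselect (Omega T q); last by exists 0.
  case: q Oq => p t Oq /=.
  have [x cx] := absolutely_summable_cvg (fun F => sum_re_le F Oq).
  have [y cy] := absolutely_summable_cvg (fun F => sum_im_le F Oq).
  exists (x +i* y)%C => _.
  rewrite (_ : (fun F => partial_series _ F p) = (fun F : {fset nat * nat} =>
    ((\sum_(k <- F) duhamel_term (re f) t p k) +i* (\sum_(k <- F) duhamel_term (im f) t p k))%C)).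
    by apply: cvg_cplx => //; exact: totally_filter.
  by apply/funext => F; exact: partial_nonhomogeneousE.
have [w Hw] := choice H; exists w => p t Oq.
by have := Hw (p, t) Oq.
Qed.

(** Real and imaginary parts are bounded separately, hence the factor 2; the bound on all partial
    sums passes to the limit. *)
Lemma nonhomogeneous_solution_normc_le w : nonhomogeneous_solution alpha T f w ->
  forall q, Omega T q -> normc (w q) <= 2 * B T M.
Proof.
move=> Hw [p t] Oq; have := Hw p t Oq.
move=> wp; apply: (cvg_normc_le (@totally_filter (nat * nat)%type) wp) => F.
 rewrite partial_nonhomogeneousE; apply: le_trans (normc_le_ReIm _) _ => /=.
rewrite (_ : 2 * _ = B T M + B T M); last by ring.
apply: lerD; apply: le_trans (ler_norm_sum _ _ _) _; [exact: sum_re_le|exact: sum_im_le].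
Qed.

Lemma duhamel_part_integrable k t : 0 <= t <= T ->
  mu.-integrable `[0, t] (EFin \o (fun x => duhamel_kernel alpha k (t - x) * source_coef (re f) k x)) /\
  mu.-integrable `[0, t] (EFin \o (fun x => duhamel_kernel alpha k (t - x) * source_coef (im f) k x)).
Proof.
move=> tT; split.
  apply: (@duhamel_integrable R alpha alpha12 T M (re f) T0 M0 _ _ C0) => //.
    exact: within_Re.
  by move=> q Oq; apply: le_trans (re_le _) (fM Oq).
apply: (@duhamel_integrable R alpha alpha12 T M (im f) T0 M0 _ _ C0) => //.
  exact: within_Im.
by move=> q Oq; apply: le_trans (im_le _) (fM Oq).
Qed.

End Source.

Lemma Omega_bounded T f : {within Omega T, continuous f} ->
  exists2 M, 0 < M & forall q, Omega T q -> normc (f q) <= M.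
Proof.
move=> cf.
have [M1 H1] := within_bounded (@compact_Omega R T) (within_Re cf).
have [M2 H2] := within_bounded (@compact_Omega R T) (within_Im cf).
exists (`|M1| + `|M2| + 1); first by rewrite ltr_wpDl// addr_ge0.
move=> q Oq; apply: le_trans (normc_le_ReIm _) _.
apply: (@le_trans _ _ (`|M1| + `|M2|)); last by rewrite lerDl.
by apply: lerD; [apply: le_trans (H1 q Oq) _|apply: le_trans (H2 q Oq) _]; exact: ler_norm.
Qed.

Lemma nonhomogeneous_solution_exists T f : 0 < T -> {within Omega T, continuous f} ->
  exists w, nonhomogeneous_solution alpha T f w.
Proof.
move=> T0 cf; have [M M0 fM] := Omega_bounded cf.
exact: nonhomogeneous_solution_exists_bounded T0 M0 cf fM.
Qed.

Lemma nonhomogeneous_solution_bound T f w : 0 < T -> {within Omega T, continuous f} ->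
  nonhomogeneous_solution alpha T f w ->
  (sup_norm T w <= (2 * 1208 * C0 * Num.max T 1 `^ 4^-1)%:E * sup_norm T f)%E.
Proof.
move=> T0 cf Hw; have [Mb Mb0 fMb] := Omega_bounded cf.
have O0 : Omega T ((0, 0), 0).
  by split; [split => /=; rewrite in_itv/= lexx ler01|rewrite /= in_itv/= lexx ltW].
have sup_ub h q : Omega T q -> ((normc (h q))%:E <= sup_norm T h :> \bar R)%E.
  by move=> Oq; apply: ereal_sup_ubound; exists q.
have s0 : (0%R <= sup_norm T f)%E.
  by apply: le_trans (sup_ub f _ O0); rewrite lee_fin; case: (f _) => a b /=; exact: sqrtr_ge0.
have sfin : sup_norm T f \is a fin_num.
  rewrite ge0_fin_numE//; apply: (@le_lt_trans _ _ Mb%:E); last exact: ltry.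
  by apply: ge_ereal_sup => _ [q Oq <-]; rewrite lee_fin; exact: fMb.
set K := 2 * 1208 * C0 * _; have K0 : 0 < K.
  rewrite /K; apply: mulr_gt0; last by rewrite powR_gt0// lt_max ltr01 orbT.
  by rewrite (pmulr_lgt0 _ C00) -natrM ltr0n.
rewrite -(fineK sfin); set m := fine _; have m0 : 0 <= m by exact: fine_ge0.
rewrite -EFinM; apply: ge_ereal_sup => _ [q Oq <-]; rewrite lee_fin.
apply/ler_addgt0Pr => e e0.
(* The bound M on the source has to be positive while the supremum m may vanish; the excess e / K
   costs only e after multiplication by K. *)
have Me : 0 < m + e / K by rewrite ltr_wpDl// divr_gt0.
have fM q' : Omega T q' -> normc (f q') <= m + e / K.
  move=> Oq'; apply: (@le_trans _ _ m); last by rewrite lerDl divr_ge0// ltW.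
  by rewrite -lee_fin fineK//; exact: sup_ub.
apply: le_trans (nonhomogeneous_solution_normc_le T0 Me cf fM Hw Oq) _.
rewrite /B /K; have Kn : K != 0 by rewrite gt_eqF.
have -> : 2 * (1208 * C0 * Num.max T 1 `^ 4^-1 * (m + e / K)) = K * (m + e / K).
  by rewrite /K -!mulrA.
by rewrite mulrDr [K * (e / K)]mulrC divfK.
Qed.

Lemma nonhomogeneous_solutionB T f f' w w' : 0 < T ->
  {within Omega T, continuous f} -> {within Omega T, continuous f'} ->
  nonhomogeneous_solution alpha T f w -> nonhomogeneous_solution alpha T f' w' ->
  nonhomogeneous_solution alpha T (fun q => f q - f' q) (fun q => w q - w' q).
Proof.
move=> T0 cf cf' Hw Hw' p t Oq.
have [M M0 fM] := Omega_bounded cf; have [M' M0' fM'] := Omega_bounded cf'.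
have Ft := @totally_filter (nat * nat)%type.
have tT : 0 <= t <= T by case: Oq => _ /=; rewrite in_itv.
have dB (a b c : R * R * R -> R) k : (forall q, c q = a q - b q) ->
    {within Omega T, continuous a} -> {within Omega T, continuous b} ->
    mu.-integrable `[0, t] (EFin \o (fun x => duhamel_kernel alpha k (t - x) * source_coef a k x)) ->
    mu.-integrable `[0, t] (EFin \o (fun x => duhamel_kernel alpha k (t - x) * source_coef b k x)) ->
    duhamel_term c t p k = duhamel_term a t p k - duhamel_term b t p k.
  move=> cE ca cb ia ib; rewrite /duhamel_term -mulrBl; congr (_ * _).
  rewrite /duhamel -RintegralB//; apply: eq_Rintegral => x.
  rewrite inE/= in_itv/= => /andP[x0 xt]; rewrite -mulrBr; congr (_ * _).
  have xT : 0 <= x <= T by rewrite x0 (le_trans xt)//; case/andP: tT.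
  rewrite /source_coef /real_coef -mulrBl; congr (_ / _).
  rewrite (_ : (fun p => c (p, x)) = fun p => a (p, x) - b (p, x)); last exact/funext.
  apply: (wipBl measurable_unit_square (@leb2_unit_square_fin R) (@measurable_weight R) (@weight01 R)).
  - exact: bounded_slice ca _ xT.
  - exact: bounded_slice cb _ xT.
  - exact: bounded_mode.
rewrite (_ : (fun F => partial_series _ F p) = (fun F => partial_series (nonhomogeneous_term alpha f t) F p -
   partial_series (nonhomogeneous_term alpha f' t) F p)).
  by apply: cvgB; [exact: Hw|exact: Hw'].
apply/funext => F.
refine (etrans (partial_nonhomogeneousE _ t F p) (etrans _ (esym (congr2 (fun x y => x - y)
  (partial_nonhomogeneousE f t F p) (partial_nonhomogeneousE f' t F p))))).
cbv beta.
have Er : \sum_(k <- F) duhamel_term (re (fun q => f q - f' q)) t p k =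
    \sum_(k <- F) duhamel_term (re f) t p k - \sum_(k <- F) duhamel_term (re f') t p k.
  rewrite -sumrB; apply: eq_bigr => k _.
  have [i1 _] := duhamel_part_integrable T0 M0 cf fM k tT.
  have [i2 _] := duhamel_part_integrable T0 M0' cf' fM' k tT.
  exact: (dB _ _ _ k (fun q => ReB (f q) (f' q)) (within_Re cf) (within_Re cf') i1 i2).
have Ei : \sum_(k <- F) duhamel_term (im (fun q => f q - f' q)) t p k =
    \sum_(k <- F) duhamel_term (im f) t p k - \sum_(k <- F) duhamel_term (im f') t p k.
  rewrite -sumrB; apply: eq_bigr => k _.
  have [_ i1] := duhamel_part_integrable T0 M0 cf fM k tT.
  have [_ i2] := duhamel_part_integrable T0 M0' cf' fM' k tT.
  exact: (dB _ _ _ k (fun q => ImB (f q) (f' q)) (within_Im cf) (within_Im cf') i1 i2).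
exact: (etrans (congr2 (fun x y => (x +i* y)%C) Er Ei) (complexB _ _ _ _)).
Qed.

End NonhomogeneousSolution.

Theorem mainTheorem3 (R : realType) (alpha : R) (halpha : 1 < alpha < 2) :
  (forall (T : R) (phi psi : R * R -> cplx R), 0 < T ->
     {within unit_square, continuous phi} ->
     {within unit_square, continuous psi} ->
     (exists v, homogeneous_solution alpha T phi psi v) /\
     (forall v, homogeneous_solution alpha T phi psi v ->
      forall t, 0 <= t <= T ->
        (wL2norm (fun p => v (p, t))
         <= sqrte (2%:E * (wL2norm phi ^+ 2 + wL2norm psi ^+ 2)))%E)) /\
  (exists C : R, 0 < C /\
     (forall (T : R) (f : R * R * R -> cplx R), 0 < T ->
        {within Omega T, continuous f} ->
        (exists w, nonhomogeneous_solution alpha T f w) /\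
        (forall w, nonhomogeneous_solution alpha T f w ->
           (sup_norm T w
            <= (C * Num.max T 1 `^ 4^-1)%:E * sup_norm T f)%E)) /\
     (forall (T : R) (phi psi phi' psi' : R * R -> cplx R)
        (f f' : R * R * R -> cplx R), 0 < T ->
        {within unit_square, continuous phi} ->
        {within unit_square, continuous psi} ->
        {within Omega T, continuous f} ->
        {within unit_square, continuous phi'} ->
        {within unit_square, continuous psi'} ->
        {within Omega T, continuous f'} ->
        forall u u', solution alpha T phi psi f u ->
          solution alpha T phi' psi' f' u' ->
        exists V W,
          [/\ homogeneous_solution alpha T
                (fun p => phi p - phi' p) (fun p => psi p - psi' p) V,
              nonhomogeneous_solution alpha T (fun q => f q - f' q) W,
              forall q, Omega T q -> u q - u' q = V q + W q,
              forall t, 0 <= t <= T ->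
                (wL2norm (fun p => V (p, t))
                 <= sqrte (2%:E * (wL2norm (fun p => phi p - phi' p)%R ^+ 2
                                   + wL2norm (fun p => psi p - psi' p)%R ^+ 2)))%E
            & (sup_norm T W
               <= (C * Num.max T 1 `^ 4^-1)%:E
                  * sup_norm T (fun q => f q - f' q)%R)%E])).
Proof.
split.
  move=> T phi psi _ cphi cpsi.
  have bphi := within_bounded_cplx cphi; have bpsi := within_bounded_cplx cpsi.
  split; first exact: homogeneous_solution_exists.
  by move=> v; exact: homogeneous_solution_bound.
have b01 : 0 < alpha - 1 < 1.
  by case/andP: halpha => a1 a2; rewrite subr_gt0 a1/= ltrBlDr.
have alE : alpha = alpha - 1 + 1 by rewrite subrK.
have [C0 C00 HC] := ml_al_decay b01 alE.
have C1 : 0 < 2 * 1208 * C0 by rewrite (pmulr_lgt0 _ C00) -natrM ltr0n.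
exists (2 * 1208 * C0); split; first exact: C1.
split.
  move=> T f T0 cf; split; first exact: (nonhomogeneous_solution_exists halpha C00 HC).
  by move=> w; exact: (nonhomogeneous_solution_bound halpha C00 HC).
move=> T phi psi phi' psi' f f' T0 cphi cpsi cf cphi' cpsi' cf' u u' [v [w [Hv Hw uE]]] [v' [w' [Hv' Hw' uE']]].
have cB (g g' : R * R -> cplx R) : {within unit_square, continuous g} ->
    {within unit_square, continuous g'} -> {within unit_square, continuous (fun p => g p - g' p)}.
  by move=> cg cg' x; apply: cvgB; [exact: cg|exact: cg'].
have cBf : {within Omega T, continuous (fun q => f q - f' q)}.
  by move=> x; apply: cvgB; [exact: cf|exact: cf'].
have HV : homogeneous_solution alpha T (fun p => phi p - phi' p) (fun p => psi p - psi' p)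
    (fun q => v q - v' q).
  by apply: homogeneous_solutionB => //; exact: within_bounded_cplx.
have HW := nonhomogeneous_solutionB halpha C00 HC T0 cf cf' Hw Hw'.
exists (fun q => v q - v' q), (fun q => w q - w' q); split => //.
- by move=> q Oq; rewrite uE// uE'// opprD addrACA.
- apply: homogeneous_solution_bound HV => //; apply: within_bounded_cplx; exact: cB.
- exact: (nonhomogeneous_solution_bound halpha C00 HC).
Qed.
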